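(* Let $\Omega\subset\mathbb{R}^d$ be a bounded domain. Suppose the activation function $\sigma:\mathbb{R}\to\mathbb{R}$ satisfies: (A1) $\sigma\in C^2(\mathbb{R})$ is non-constant, and $\sigma$ and its first and second derivatives are bounded and Lipschitz continuous on $\mathbb{R}$; (A2) $\sigma(x)=(1+x^2)^t\psi(x)$ for a constant $t\ge0$, where $\psi,\mathcal{F}_1[\psi]\in L^1(\mathbb{R})$, and $\mathcal{F}_1[\psi]$ is smooth and not identically zero on a closed interval $[w_1,w_2]$ that excludes the origin. Then for any multi-index $\vec k\in\mathbb{N}^d$ with $|\vec k|\le2$ and any $v\in B^s(\Omega)$ with $|\vec k|+1\le s$, there exists a function $\alpha:\mathbb{R}^d\times\mathbb{R}\to\mathbb{R}$ such that $$D^{\vec k}v(\mathbf{x})=\int_{\mathbb{R}^d}\int_{\mathbb{R}}D^{\vec k}\sigma(\vec\omega\cdot\mathbf{x}+b)\,\alpha(\vec\omega,-b)\,db\,d\vec\omega,\qquad\forall\,\mathbf{x}\in\Omega.$$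
   Context: $\mathcal{F}_d[v](\vec\omega)=\int_{\mathbb{R}^d}v(\mathbf{x})e^{-i\vec\omega\cdot\mathbf{x}}d\mathbf{x}$ is the Fourier transform on $\mathbb{R}^d$ ($\mathcal{F}_1$ the case $d=1$). For $s\ge1$, $B^s(\Omega)=\{v\in L^2(\Omega):\|v\|_{B^s(\Omega)}<\infty\}$, where $\|v\|_{B^s(\Omega)}=\inf_{v_e|_\Omega=v}\int_{\mathbb{R}^d}(1+\|\vec\omega\|_1)^s|\mathcal{F}_d[v_e](\vec\omega)|\,d\vec\omega$, the infimum being over all extensions $v_e\in L^1(\mathbb{R}^d)$ of $v$. $D^{\vec k}\sigma(\vec\omega\cdot\mathbf{x}+b)$ denotes the $\vec k$-th partial derivative in $\mathbf{x}$ of $\mathbf{x}\mapsto\sigma(\vec\omega\cdot\mathbf{x}+b)$, i.e. $\vec\omega^{\vec k}\sigma^{(|\vec k|)}(\vec\omega\cdot\mathbf{x}+b)$. $\mathbb{N}$ includes $0$. Elements of $B^s(\Omega)$ are identified with their continuous representatives. *)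

(* Defs.v *)
From HB Require Import structures.
From mathcomp Require Import all_boot all_order all_algebra.
From mathcomp Require Import all_classical all_reals all_analysis.
From mathcomp Require Import complex.

Set Implicit Arguments.
Unset Strict Implicit.
Unset Printing Implicit Defensive.

Import Order.TTheory GRing.Theory Num.Theory.
Import numFieldNormedType.Exports.

Local Open Scope classical_set_scope.
Local Open Scope ring_scope.
Local Open Scope complex_scope.

(* R^d is 'rV[R]_d. Its sigma-algebra is generated by the coordinates, i.e. it
   is the Borel sigma-algebra of the topology of 'rV[R]_d. *)
Definition rV_display : measure_display.
Proof. exact: (measure_tuple_display default_measure_display). Qed.

Section measurable_rV.
Context {R : realType}.
Variable d : nat.

Let coor (i : 'I_d) (x : 'rV[R]_d) : R := x ord0 i.

Let rV_set0 : g_sigma_preimage coor set0.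
Proof. exact: sigma_algebra0. Qed.

Let rV_setC A : g_sigma_preimage coor A -> g_sigma_preimage coor (~` A).
Proof. exact: sigma_algebraC. Qed.

Let rV_bigcup (F : _^nat) : (forall i, g_sigma_preimage coor (F i)) ->
  g_sigma_preimage coor (\bigcup_i (F i)).
Proof. exact: sigma_algebra_bigcup. Qed.

HB.instance Definition _ := @isMeasurable.Build rV_display
  'rV[R]_d (g_sigma_preimage coor) rV_set0 rV_setC rV_bigcup.

Lemma measurable_coord (i : 'I_d) :
  measurable_fun [set: 'rV[R]_d] (fun x : 'rV[R]_d => x ord0 i).
Proof.
move=> _ Y mY; rewrite setTI; apply: sub_sigma_algebra => /=.
rewrite -bigcup_seq/=; exists i => /=; first by rewrite mem_index_enum.
by exists Y => //; rewrite setTI.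
Qed.

Lemma measurable_fun_rV d' (T : measurableType d') (f : T -> 'rV[R]_d) :
  (forall i, measurable_fun [set: T] (fun t => f t ord0 i)) ->
  measurable_fun [set: T] f.
Proof.
move=> mf.
have pref : g_sigma_preimage (fun i => coor i \o f) `<=` measurable.
  apply: smallest_sub; first exact: sigma_algebra_measurable.
  rewrite -bigcup_seq; apply: bigcup_sub => i _ A [B mB <-].
  exact: mf.
move: pref; rewrite g_sigma_preimage_comp => pref _ A mA.
by apply: pref; exists A.
Qed.

End measurable_rV.

(* The Lebesgue measure on R^d, by recursion on d through the identification
   R^(d+1) = R * R^d; see rV_lebesgue_box for its values on boxes. *)
Section rV_lebesgue.
Context {R : realType}.

Definition consrV d (p : measurableTypeR R * 'rV[R]_d) : 'rV[R]_d.+1 :=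
  row_mx (const_mx p.1 : 'rV[R]_1) p.2.

Definition unconsrV d (x : 'rV[R]_d.+1) : measurableTypeR R * 'rV[R]_d :=
  (x ord0 ord0, \row_i x ord0 (lift ord0 i)).

Lemma consrV0 d (p : measurableTypeR R * 'rV[R]_d) : consrV p ord0 ord0 = p.1.
Proof.
transitivity ((const_mx p.1 : 'rV[R]_1) ord0 ord0); last by rewrite mxE.
rewrite -(row_mxEl (const_mx p.1 : 'rV[R]_1) p.2 ord0 ord0).
by congr (row_mx _ _ _ _); exact/val_inj.
Qed.

Lemma consrVS d (p : measurableTypeR R * 'rV[R]_d) i :
  consrV p ord0 (lift ord0 i) = p.2 ord0 i.
Proof.
rewrite -(row_mxEr (const_mx p.1 : 'rV[R]_1) p.2 ord0 i).
by congr (row_mx _ _ _ _); exact/val_inj.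
Qed.

Lemma consrVK d : cancel (@consrV d) (@unconsrV d).
Proof.
move=> p; rewrite /unconsrV consrV0; case: p => a x /=; congr pair.
by apply/rowP => i; rewrite mxE consrVS.
Qed.

Lemma measurable_consrV d :
  measurable_fun [set: measurableTypeR R * 'rV[R]_d] (@consrV d).
Proof.
apply: measurable_fun_rV => i; have [j ->|->] := unliftP ord0 i.
- rewrite [X in measurable_fun _ X](_ : _ = (fun x : 'rV[R]_d => x ord0 j) \o snd).
    by apply: measurableT_comp => //; exact: measurable_coord.
  by apply/funext => p; rewrite consrVS.
- rewrite [X in measurable_fun _ X](_ : _ = fst) //.
  by apply/funext => p; rewrite consrV0.
Qed.

Lemma measurable_unconsrV d :
  measurable_fun [set: 'rV[R]_d.+1] (@unconsrV d).
Proof.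
apply/measurable_fun_pairP; split; first exact: measurable_coord.
apply: measurable_fun_rV => i /=.
rewrite [X in measurable_fun _ X](_ : _ = fun x : 'rV[R]_d.+1 => x ord0 (lift ord0 i)).
  exact: measurable_coord.
by apply/funext => x; rewrite mxE.
Qed.

Definition consrV_measure d (mu : {sigma_finite_measure set 'rV[R]_d -> \bar R})
  : set 'rV[R]_d.+1 -> \bar R :=
  pushforward (@lebesgue_measure R \x mu)%E (@consrV d).

Section consrV_measure.
Variables (d : nat) (mu : {sigma_finite_measure set 'rV[R]_d -> \bar R}).

Let measurable_preimage_consrV (A : set 'rV[R]_d.+1) :
  measurable A -> measurable (@consrV d @^-1` A).
Proof. by move=> mA; rewrite -[X in measurable X]setTI; exact: measurable_consrV. Qed.

Let consrV_measure0 : consrV_measure mu set0 = 0%E.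
Proof. by rewrite /consrV_measure /pushforward preimage_set0 measure0. Qed.

Let consrV_measure_ge0 A : (0 <= consrV_measure mu A)%E.
Proof. by rewrite /consrV_measure /pushforward; exact: measure_ge0. Qed.

Let consrV_measure_sigma_additive : semi_sigma_additive (consrV_measure mu).
Proof.
move=> F mF tF mUF; rewrite /consrV_measure /pushforward preimage_bigcup.
apply: measure_semi_sigma_additive.
- by move=> n; exact: measurable_preimage_consrV.
- apply/trivIsetP => /= i j _ _ ij; rewrite -preimage_setI.
  by move/trivIsetP : tF => /(_ _ _ _ _ ij) ->//; rewrite preimage_set0.
- by rewrite -preimage_bigcup; exact: measurable_preimage_consrV.
Qed.

HB.instance Definition _ := isMeasure.Build _ _ _ (consrV_measure mu)
  consrV_measure0 consrV_measure_ge0 consrV_measure_sigma_additive.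

Let consrV_sigma_finite : sigma_finite setT (consrV_measure mu).
Proof.
have /sigma_finiteP[F [TF ndF mF]] := sigma_finiteT (@lebesgue_measure R).
have /sigma_finiteP[G [TG ndG mG]] := sigma_finiteT mu.
exists (fun n => @unconsrV d @^-1` (F n `*` G n)).
  rewrite -preimage_bigcup (_ : \bigcup_n _ = setT) ?preimage_setT//.
  apply/seteqP; split => // -[x y] _.
  have [n _ Fnx] : (\bigcup_n F n) x by rewrite -TF.
  have [m _ Gmy] : (\bigcup_n G n) y by rewrite -TG.
  exists (maxn n m) => //; split => /=.
    by move: x Fnx; exact/subsetPset/ndF/leq_maxl.
  by move: y Gmy; exact/subsetPset/ndG/leq_maxr.
move=> n; have [mFn Fnoo] := mF n; have [mGn Gnoo] := mG n.
have mFG := measurableX mFn mGn.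
split; first by rewrite -[X in measurable X]setTI; exact: measurable_unconsrV.
rewrite /consrV_measure /pushforward -comp_preimage.
rewrite (_ : _ @^-1` _ = F n `*` G n); last first.
  by apply/funext => p; rewrite /preimage/= -[in RHS](consrVK p).
by rewrite product_measure1E// lte_mul_pinfty// ge0_fin_numE.
Qed.

HB.instance Definition _ := Measure_isSigmaFinite.Build _ _ _
  (consrV_measure mu) consrV_sigma_finite.

End consrV_measure.

Fixpoint rV_lebesgue d : {sigma_finite_measure set 'rV[R]_d -> \bar R} :=
  match d with
  | 0 => \d_(0 : 'rV[R]_0)
  | d'.+1 => consrV_measure (rV_lebesgue d')
  end.

Lemma rV_lebesgue_box d (A : 'I_d -> set R) : (forall i, measurable (A i)) ->
  rV_lebesgue d [set x | forall i, A i (x ord0 i)] =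
  (\prod_(i < d) lebesgue_measure (A i))%E.
Proof.
elim: d A => [|d IHd] A mA.
  rewrite big_ord0 /= diracE mem_set//= => -[]//.
have mB : measurable [set x : 'rV[R]_d | forall i, A (lift ord0 i) (x ord0 i)].
  rewrite (_ : [set x | _] = \bigcap_(i in [set: 'I_d])
      ((fun x : 'rV[R]_d => x ord0 i) @^-1` A (lift ord0 i))); last first.
    by apply/seteqP; split => x /= h i; [move=> _|]; exact: h.
  apply: fin_bigcap_measurable => // i _.
  by rewrite -[X in measurable X]setTI; exact: measurable_coord.
rewrite big_ord_recl -IHd// -product_measure1E//=; last exact: mA.
rewrite /consrV_measure /pushforward.
congr product_measure1; apply/seteqP; split => [[a x]|[a x] [/= Aa Ax] i] /=.
  move=> h; split; first by have := h ord0; rewrite consrV0.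
  by move=> i; have := h (lift ord0 i); rewrite consrVS.
by have [j ->|->] := unliftP ord0 i; rewrite (consrV0, consrVS).
Qed.

End rV_lebesgue.
Arguments rV_lebesgue {R} d.

Section fourier.
Context {R : realType}.

Definition dotrV d (w x : 'rV[R]_d) : R := \sum_(i < d) w ord0 i * x ord0 i.

Definition l1norm d (w : 'rV[R]_d) : R := \sum_(i < d) `|w ord0 i|.

(* For a real-valued v, the integral of v(x) e^(-i theta(x)), by real and
   imaginary parts. *)
Definition phase_integral disp (T : measurableType disp)
    (mu : {measure set T -> \bar R}) (theta v : T -> R) : R[i] :=
  (\int[mu]_x (v x * cos (theta x))) +i* (- \int[mu]_x (v x * sin (theta x))).

Definition fourier d (v : 'rV[R]_d -> R) (w : 'rV[R]_d) : R[i] :=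
  phase_integral (rV_lebesgue d) (dotrV w) v.

Definition fourier1 (v : R -> R) (w : R) : R[i] :=
  phase_integral lebesgue_measure (fun x => w * x) v.

End fourier.

Section barron.
Context {R : realType}.
Variables (d : nat) (s : R) (Omega : set 'rV[R]_d).

(* Extensions agree with v almost everywhere on Omega, v being an element of
   L^2(Omega). The norm is +oo when v has no extension in L^1(R^d). *)
Definition barron_norm (v : 'rV[R]_d -> R) : \bar R :=
  ereal_inf [set (\int[rV_lebesgue d]_w
                   ((1 + l1norm w) `^ s * ComplexField.Normc.normc (fourier ve w))%:E)%E
            | ve in [set ve : 'rV[R]_d -> R |
                (rV_lebesgue d).-integrable setT (EFin \o ve) /\
                {ae rV_lebesgue d, forall x, Omega x -> ve x = v x}]].

Definition barron (v : 'rV[R]_d -> R) : Prop :=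
  [/\ measurable_fun Omega v,
      (rV_lebesgue d).-integrable Omega (fun x => (v x ^+ 2)%:E) &
      (barron_norm v < +oo)%E].

End barron.

Section partial_derivatives.
Context {R : realType}.
Variable d : nat.
Implicit Types (f : 'rV[R]_d -> R) (l : seq 'I_d) (k : 'I_d -> nat).

Definition partial (i : 'I_d) f : 'rV[R]_d -> R :=
  fun x => 'D_(delta_mx ord0 i) f x.

Definition partials l f := foldr partial f l.

(* 'D_ is total: this says that all the derivatives occurring in
   partials l f x are genuine ones. *)
Fixpoint partials_exist l f (x : 'rV[R]_d) : Prop :=
  if l is i :: l' then
    (\forall y \near x, partials_exist l' f y) /\
    derivable (partials l' f) x (delta_mx ord0 i)
  else True.

(* (d/dx_0)^(k_0) ... (d/dx_(d-1))^(k_(d-1)), the last coordinate being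
   differentiated first. *)
Definition directions k : seq 'I_d := flatten [seq nseq (k i) i | i <- enum 'I_d].

Definition morder k : nat := (\sum_(i < d) k i)%N.

Definition mpartial k f := partials (directions k) f.

Definition mpartial_exists k f x := partials_exist (directions k) f x.

End partial_derivatives.

Section activation.
Context {R : realType}.
Implicit Types sigma f : R -> R.

Definition activation_A1 sigma : Prop :=
  [/\ forall n x, (n < 2)%N -> derivable (derive1n n sigma) x 1,
      continuous (derive1n 2 sigma),
      exists x y, sigma x != sigma y &
      forall n, (n <= 2)%N ->
        bounded_fun (derive1n n sigma) /\ lipschitz (derive1n n sigma)].

(* C^oo on a possibly non-open set: restriction of a C^oo function on R. *)
Definition smooth_on (A : set R) f : Prop :=
  exists g : R -> R, (forall n x, derivable (derive1n n g) x 1) /\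
                     {in A, f =1 g}.

Definition activation_A2 sigma : Prop :=
  exists (t : R) (psi : R -> R) (w1 w2 : R),
  [/\ 0 <= t,
      forall x, sigma x = (1 + x ^+ 2) `^ t * psi x,
      lebesgue_measure.-integrable setT (EFin \o psi),
      (lebesgue_measure.-integrable setT
         (EFin \o (fun w => complex.Re (fourier1 psi w))) /\
       lebesgue_measure.-integrable setT
         (EFin \o (fun w => complex.Im (fourier1 psi w)))) &
      [/\ w1 < w2, 0 \notin `[w1, w2],
          smooth_on `[w1, w2] (fun w => complex.Re (fourier1 psi w)),
          smooth_on `[w1, w2] (fun w => complex.Im (fourier1 psi w)) &
          exists2 w, w \in `[w1, w2] & fourier1 psi w != 0]].

End activation.

(* Main.v *)
Require Import Defs.
From HB Require Import structures.
From mathcomp Require Import all_boot all_order all_algebra.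
From mathcomp Require Import all_classical all_reals all_analysis.
From mathcomp Require Import measurable_realfun ring lra.

Set Implicit Arguments.
Unset Strict Implicit.
Unset Printing Implicit Defensive.

Import Order.TTheory GRing.Theory Num.Theory.
Import numFieldNormedType.Exports.

Local Open Scope classical_set_scope.
Local Open Scope ring_scope.

(** Let K be the order of k and f the K-th derivative of sigma. By the chain rule the
    k-th partial derivative of y |-> sigma(w.y + b) is w^k f(w.y + b), where f is continuous,
    bounded and, because a bounded function with constant derivative is constant,
    nonconstant ([activation_derivative], [partials_ridge]). The monomial w^k vanishes on a
    null set only, so that dividing by it reduces the theorem to writing the k-th partial
    derivative of v as a double integral of f(w.x + b) beta(w, b).

    Fourier inversion, applied to an extension of v with finite weighted spectral norm,
    writes v on Omega as a trigonometric integral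
      T(P, Q)(x) = \int (P(w) cos(w.x) + Q(w) sin(w.x)) dw
    ([fourier_inversion], [barron_trig_integral]). It is proved pointwise by smoothing with
    Gaussians, and uses that v is continuous at each point of the open set Omega. A partial
    derivative turns T(P, Q) into another trigonometric integral, whose amplitudes have been
    multiplied by a coordinate of w, and the weight (1 + |w|_1)^(K+1) is what allows K
    derivatives and leaves one power of |w|_1 ([partials_trig_integral]).

    It remains to turn T(P, Q), with (1 + |w|_1)(|P| + |Q|) integrable, into a superposition
    of ridge functions ([ridge_representation]). The tool is a reproducing formula on the
    line. Let p_a(r) = a/(a^2 + r^2), q_a(r) = r/(a^2 + r^2), and, for a1, a2 > 0,
      A_H(u, b) = \int H(s) (q_a1 - q_a2)'(b - us) ds.
    Integrating the kernel over -n <= u <= n gives (q(b + ny) - q(b - ny))/y, an approximate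
    identity in y, and hence
      \int A_H(u, u s0 - b) du = 2 pi (p_a1 - p_a2)(b) H(s0)
    ([integral_profile_transform]). Multiplying by f(b) and integrating,
      \int \int f(u s0 + b) A_H(u, -b) db du = c H(s0),  c = 2 pi \int f (p_a1 - p_a2)
    ([ridge_reproduction]). Two integrations by parts in s show that A_H decays like
    (1 + u^2)^-1, uniformly and in L^1(db), with a constant controlled by the size of H, of
    H'' and of their support; this justifies the use of Fubini's theorem.

    The constant c is nonzero for suitable a1, a2 after a translation of f
    ([poisson_separates]): otherwise the Poisson extension of f to the half-plane would not
    depend on the height, whereas it tends to f at height 0 and flattens out to a constant at
    great height, and f would be constant.

    Finally, for each frequency w the formula is applied to H(s) = P(w) cos s + Q(w) sin s,
    cut off outside of an interval of length O(1 + |w|_1) which contains every w.x with x in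
    the bounded set Omega. Taking s0 = w.x, integrating over w and substituting w by w/u
    makes f(w.x + b) appear, integrated against a function of (w, b)
    ([ridge_superposition]). *)

(** * Integrals of real-valued functions *)

Section real_integrals.
Context {d : measure_display} {T : measurableType d} {R : realType}.
Variable mu : {measure set T -> \bar R}.
Implicit Types (f g : T -> R) (k M : R).

Definition summable_fun (f : T -> R) := mu.-integrable setT (EFin \o f).

Lemma summable_meas f : summable_fun f -> measurable_fun setT f.
Proof. by move=> /integrableP[mf _]; apply/measurable_EFinP. Qed.

Lemma le_summable f g : measurable_fun setT f ->
  (forall x, `|f x| <= g x) -> summable_fun g -> summable_fun f.
Proof.
move=> mf fg; apply: le_integrable => //; first exact/measurable_EFinP.
move=> x _ /=; rewrite lee_fin (le_trans (fg x))//; exact: ler_norm.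
Qed.

Lemma summable_norm f : summable_fun f -> summable_fun (fun x => `|f x|).
Proof. exact: integrable_norm. Qed.

Lemma summableP f : measurable_fun setT f ->
  (\int[mu]_x (`|f x|%:E) < +oo)%E -> summable_fun f.
Proof.
move=> mf h; apply/integrableP; split; first exact/measurable_EFinP.
exact: h.
Qed.

Lemma summable_lt f : summable_fun f -> (\int[mu]_x (`|f x|%:E) < +oo)%E.
Proof. by move/integrableP => []. Qed.

Lemma summable_funZ k f : summable_fun f -> summable_fun (fun x => k * f x).
Proof. by move=> sf; exact: (integrableZl measurableT k sf). Qed.

Lemma summable_funD f g : summable_fun f -> summable_fun g ->
  summable_fun (fun x => f x + g x).
Proof. by move=> sf sg; exact: (integrableD measurableT sf sg). Qed.

Lemma summable_funB f g : summable_fun f -> summable_fun g ->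
  summable_fun (fun x => f x - g x).
Proof. by move=> sf sg; exact: (integrableB measurableT sf sg). Qed.

Lemma summable_funM f g M : measurable_fun setT g -> (forall x, `|g x| <= M) ->
  summable_fun f -> summable_fun (fun x => g x * f x).
Proof.
move=> mg gM sf.
apply: (@le_summable _ (fun x => M * `|f x|)).
- by apply: measurable_funM => //; exact: summable_meas.
- by move=> x; rewrite normrM ler_wpM2r.
- exact/summable_funZ/summable_norm.
Qed.

Lemma EFin_Rintegral f : summable_fun f ->
  ((\int[mu]_x f x)%:E = \int[mu]_x (f x)%:E)%E.
Proof. by move=> sf; rewrite fineK//; exact: integrable_fin_num. Qed.

Lemma norm_Rintegral_le f g : summable_fun g -> measurable_fun setT f ->
  (forall x, `|f x| <= g x) -> `|\int[mu]_x f x| <= \int[mu]_x g x.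
Proof.
move=> sg mf fg.
have sf := le_summable mf fg sg.
apply: le_trans (le_normr_Rintegral _ sf) _ => //.
by apply: le_Rintegral => //; exact: summable_norm.
Qed.

Lemma ae_eq_Rintegral f g : measurable_fun setT f -> measurable_fun setT g ->
  {ae mu, forall x, f x = g x} -> \int[mu]_x f x = \int[mu]_x g x.
Proof.
move=> mf mg fg; congr fine; apply: ae_eq_integral => //.
- exact/measurable_EFinP.
- exact/measurable_EFinP.
- by apply: filterS fg => x /= -> _.
Qed.

Lemma dominated_Rintegral (f_ : nat -> T -> R) f g :
  (forall n, measurable_fun setT (f_ n)) -> measurable_fun setT f ->
  {ae mu, forall x, f_ ^~ x @ \oo --> f x} -> summable_fun g ->
  (forall n x, `|f_ n x| <= g x) ->
  \int[mu]_x f_ n x @[n --> \oo] --> \int[mu]_x f x.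
Proof.
move=> mf_ mf ff sg fg.
have [|||/=|||sf _ h] := @dominated_convergence _ T R mu setT _
    (fun n => EFin \o f_ n) (EFin \o f) (EFin \o g) => //.
- by move=> n; exact/measurable_EFinP.
- exact/measurable_EFinP.
- by apply: filterS ff => x h _; apply: cvg_EFin => //; exact: nearW.
- by apply: aeW => x n _; rewrite lee_fin.
apply: fine_cvg; rewrite [X in _ --> X](_ : _ = \int[mu]_x (EFin \o f) x)%E //.
by rewrite fineK//; exact: integrable_fin_num.
Qed.

End real_integrals.

Lemma abse_fine_le (R : realType) (x : \bar R) : (`|(fine x)%:E| <= `|x|)%E.
Proof. by case: x => //=; rewrite ?normr0 ?leey. Qed.

Section real_fubini.
Context {d1 d2 : measure_display} {T1 : measurableType d1} {T2 : measurableType d2}.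
Context {R : realType}.
Variables (m1 : {sigma_finite_measure set T1 -> \bar R}).
Variables (m2 : {sigma_finite_measure set T2 -> \bar R}).

(** Since the real integral is a total function, its measurability in a parameter needs no
    integrability: it is a difference of two Tonelli integrals, sent to R by a measurable map. *)
Lemma measurable_Rintegral_r (f : T1 * T2 -> R) : measurable_fun setT f ->
  measurable_fun setT (fun x => \int[m2]_y f (x, y)).
Proof.
move=> mf; apply: measurableT_comp; first exact: fine_measurable.
under eq_fun do rewrite integralE.
have mEf : measurable_fun setT (EFin \o f) by exact/measurable_EFinP.
apply: emeasurable_funB.
- have h : measurable_fun setT (fubini_F m2 (EFin \o f)^\+%E).
    apply: measurable_fun_fubini_tonelli_F; first exact: measurable_funepos.
    by move=> x; exact: funepos_ge0.
  by apply: eq_measurable_fun h => x _; apply: eq_integral => y _; rewrite !funeposE.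
- have h : measurable_fun setT (fubini_F m2 (EFin \o f)^\-%E).
    apply: measurable_fun_fubini_tonelli_F; first exact: measurable_funeneg.
    by move=> x; exact: funeneg_ge0.
  by apply: eq_measurable_fun h => x _; apply: eq_integral => y _; rewrite !funenegE.
Qed.

Lemma measurable_Rintegral_l (f : T1 * T2 -> R) : measurable_fun setT f ->
  measurable_fun setT (fun y => \int[m1]_x f (x, y)).
Proof.
move=> mf; apply: measurableT_comp; first exact: fine_measurable.
under eq_fun do rewrite integralE.
have mEf : measurable_fun setT (EFin \o f) by exact/measurable_EFinP.
apply: emeasurable_funB.
- have h : measurable_fun setT (fubini_G m1 (EFin \o f)^\+%E).
    apply: measurable_fun_fubini_tonelli_G; first exact: measurable_funepos.
    by move=> x; exact: funepos_ge0.
  by apply: eq_measurable_fun h => x _; apply: eq_integral => y _; rewrite !funeposE.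
- have h : measurable_fun setT (fubini_G m1 (EFin \o f)^\-%E).
    apply: measurable_fun_fubini_tonelli_G; first exact: measurable_funeneg.
    by move=> x; exact: funeneg_ge0.
  by apply: eq_measurable_fun h => x _; apply: eq_integral => y _; rewrite !funenegE.
Qed.

(** The hypotheses are those met in practice: every slice is integrable, with an explicit
    integrable bound for its norm. *)
Lemma summable_prod (f : T1 * T2 -> R) (g : T1 -> R) : measurable_fun setT f ->
  (forall x, summable_fun m2 (fun y => f (x, y))) ->
  (forall x, \int[m2]_y `|f (x, y)| <= g x) -> summable_fun m1 g ->
  summable_fun (m1 \x m2)%E f.
Proof.
move=> mf sf fg sg; apply/integrable12ltyP; first exact/measurable_EFinP.
apply: le_lt_trans (summable_lt sg).
apply: ge0_le_integral => //=.
- by move=> x _; exact: integral_ge0.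
- apply: (measurable_fun_fubini_tonelli_F (m2 := m2) (fun z => `|(f z)%:E|%E)) => //.
  by apply: measurableT_comp => //; exact/measurable_EFinP.
- apply/measurable_EFinP/measurableT_comp => //; exact: (summable_meas sg).
- move=> x _; rewrite -EFin_Rintegral; last exact: summable_norm.
  by rewrite lee_fin (le_trans (fg x))// ler_norm.
Qed.

Lemma summable_prod_rev (f : T1 * T2 -> R) (g : T2 -> R) : measurable_fun setT f ->
  (forall y, summable_fun m1 (fun x => f (x, y))) ->
  (forall y, \int[m1]_x `|f (x, y)| <= g y) -> summable_fun m2 g ->
  summable_fun (m1 \x m2)%E f.
Proof.
move=> mf sf fg sg; apply/integrable21ltyP; first exact/measurable_EFinP.
apply: le_lt_trans (summable_lt sg).
apply: ge0_le_integral => //=.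
- by move=> x _; exact: integral_ge0.
- apply: (measurable_fun_fubini_tonelli_G (m1 := m1) (fun z => `|(f z)%:E|%E)) => //.
  by apply: measurableT_comp => //; exact/measurable_EFinP.
- apply/measurable_EFinP/measurableT_comp => //; exact: (summable_meas sg).
- move=> x _; rewrite -EFin_Rintegral; last exact: summable_norm.
  by rewrite lee_fin (le_trans (fg x))// ler_norm.
Qed.

Variable f : T1 * T2 -> R.
Hypothesis sf : summable_fun (m1 \x m2)%E f.

Let mf : measurable_fun setT f. Proof. exact: summable_meas sf. Qed.

Lemma summable_ae_r : {ae m1, forall x, summable_fun m2 (fun y => f (x, y))}.
Proof. exact: ae_integrable1 sf. Qed.

Lemma summable_ae_l : {ae m2, forall y, summable_fun m1 (fun x => f (x, y))}.
Proof. exact: ae_integrable2 sf. Qed.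

Let int1E : {ae m1, forall x,
  (\int[m2]_y f (x, y))%:E = fubini_F m2 (EFin \o f) x}.
Proof. by apply: filterS summable_ae_r => x h; rewrite EFin_Rintegral. Qed.

Let int2E : {ae m2, forall y,
  (\int[m1]_x f (x, y))%:E = fubini_G m1 (EFin \o f) y}.
Proof. by apply: filterS summable_ae_l => x h; rewrite EFin_Rintegral. Qed.

(** The inner real integral agrees with the extended one only for almost every x, but
    forgetting infinite values does not increase the absolute value. *)
Lemma summable_Rintegral_r : summable_fun m1 (fun x => \int[m2]_y f (x, y)).
Proof.
apply: summableP; first exact: (measurable_Rintegral_r mf).
have mEf : measurable_fun setT (EFin \o f) by exact/measurable_EFinP.
apply: le_lt_trans ((integrable12ltyP m1 m2 mEf).1 sf).
apply: ge0_le_integral => //=.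
- apply/measurable_EFinP; apply: measurableT_comp => //.
  exact: (measurable_Rintegral_r mf).
- apply: (measurable_fun_fubini_tonelli_F (m2 := m2) (fun z => `|(f z)%:E|%E)) => //.
  by apply: measurableT_comp.
- move=> x _; rewrite -abse_EFin; apply: le_trans (abse_fine_le _) _.
  apply: le_abse_integral => //.
  by apply: measurableT_comp => //; exact: measurableT_comp.
Qed.

Lemma summable_Rintegral_l : summable_fun m2 (fun y => \int[m1]_x f (x, y)).
Proof.
apply: summableP; first exact: (measurable_Rintegral_l mf).
have mEf : measurable_fun setT (EFin \o f) by exact/measurable_EFinP.
apply: le_lt_trans ((integrable21ltyP m1 m2 mEf).1 sf).
apply: ge0_le_integral => //=.
- apply/measurable_EFinP; apply: measurableT_comp => //.
  exact: (measurable_Rintegral_l mf).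
- apply: (measurable_fun_fubini_tonelli_G (m1 := m1) (fun z => `|(f z)%:E|%E)) => //.
  by apply: measurableT_comp.
- move=> x _; rewrite -abse_EFin; apply: le_trans (abse_fine_le _) _.
  apply: le_abse_integral => //.
  by apply: measurableT_comp => //; exact: measurableT_comp.
Qed.

Lemma Rfubini1 : \int[m1]_x \int[m2]_y f (x, y) = \int[(m1 \x m2)%E]_z f z.
Proof.
congr fine; rewrite -(integral12_prod_meas1 sf).
apply: ae_eq_integral => //.
- by apply/measurable_EFinP; exact: (measurable_Rintegral_r mf).
- by have /integrableP[] := integrable_fubini_F sf.
- by apply: filterS int1E => x /= <- _.
Qed.

Lemma Rfubini2 : \int[m2]_y \int[m1]_x f (x, y) = \int[(m1 \x m2)%E]_z f z.
Proof.
congr fine; rewrite -(integral21_prod_meas1 sf).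
apply: ae_eq_integral => //.
- by apply/measurable_EFinP; exact: (measurable_Rintegral_l mf).
- have mEf : measurable_fun setT (EFin \o f) by exact/measurable_EFinP.
  exact: (measurable_fubini_G sf).
- by apply: filterS int2E => x /= <- _.
Qed.

Lemma Rfubini : \int[m1]_x \int[m2]_y f (x, y) = \int[m2]_y \int[m1]_x f (x, y).
Proof. by rewrite Rfubini1 Rfubini2. Qed.

End real_fubini.

Section sigma_finite_product.
Context {d1 d2 : measure_display} {T1 : measurableType d1} {T2 : measurableType d2}.
Context {R : realType}.
Variables (m1 : {sigma_finite_measure set T1 -> \bar R}).
Variables (m2 : {sigma_finite_measure set T2 -> \bar R}).

(** A copy of the product measure that carries its sigma-finiteness, so that it can itself
    be a factor of a product. *)
Definition sigma_product : set (T1 * T2) -> \bar R := (m1 \x m2)%E.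

HB.instance Definition _ := Measure.copy sigma_product (m1 \x m2)%E.

Let sigma_product_sigma_finite : sigma_finite setT sigma_product.
Proof.
have /sigma_finiteP[F [TF ndF Foo]] := sigma_finiteT m1.
have /sigma_finiteP[G [TG ndG Goo]] := sigma_finiteT m2.
exists (fun n => F n `*` G n).
  apply/seteqP; split => // -[x y] _.
  have [n _ Fx] : (\bigcup_n F n) x by rewrite -TF.
  have [m _ Gy] : (\bigcup_n G n) y by rewrite -TG.
  exists (maxn n m) => //; split => /=.
    by move: x Fx; exact/subsetPset/ndF/leq_maxl.
  by move: y Gy; exact/subsetPset/ndG/leq_maxr.
move=> k; have [mF Fk] := Foo k; have [mG Gk] := Goo k.
split; first exact: measurableX.
by rewrite /sigma_product product_measure1E// lte_mul_pinfty// ge0_fin_numE.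
Qed.

HB.instance Definition _ := Measure_isSigmaFinite.Build _ _ _ sigma_product
  sigma_product_sigma_finite.

End sigma_finite_product.

(** * Affine changes of variables *)

Section change_of_variables.
Context {d : measure_display} {T : measurableType d} {R : realType}.
Variables (mu : {measure set T -> \bar R}) (phi : T -> T) (k : R).
Hypothesis mphi : measurable_fun setT phi.
Hypothesis k0 : 0 < k.
Hypothesis change : forall f : T -> \bar R, measurable_fun setT f ->
  (forall x, 0 <= f x)%E -> (k%:E * \int[mu]_x f (phi x) = \int[mu]_x f x)%E.

Lemma summable_change (f : T -> R) :
  summable_fun mu f -> summable_fun mu (fun x => f (phi x)).
Proof.
move=> sf; have mf := summable_meas sf.
apply: summableP; first exact: measurableT_comp.
have mEf : measurable_fun setT (fun x => `|f x|%:E).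
  by apply/measurable_EFinP; exact: measurableT_comp.
rewrite -(@lte_pmul2l _ k%:E) ?lte_fin// mulry gtr0_sg// mul1e.
by rewrite (change mEf)//; exact: summable_lt.
Qed.

Let fine_pmul (x : \bar R) : k * fine x = fine (k%:E * x)%E.
Proof.
case: x => [x| |] //=; first by rewrite gt0_muley ?lte_fin//= mulr0.
by rewrite gt0_muleNy ?lte_fin//= mulr0.
Qed.

Let muleB_pos (a b : \bar R) : (k%:E * (a - b) = k%:E * a - k%:E * b)%E.
Proof.
have [bf|bnf] := boolP (b \is a fin_num).
  by rewrite muleBr// fin_num_adde_defl// fin_numN.
have kE : (0 < k%:E)%E by rewrite lte_fin.
case: b bnf => [b| |] // _.
  rewrite gt0_muley//= !addeNy gt0_muleNy//.
rewrite gt0_muleNy//=.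
case: a => [a| |] /=; rewrite ?gt0_muley ?gt0_muleNy//.
Qed.

(** A substitution formula for nonnegative functions yields the one for real-valued
    functions, integrable or not: positive and negative parts are scaled by the same k. *)
Lemma Rintegral_change (f : T -> R) : measurable_fun setT f ->
  k * \int[mu]_x f (phi x) = \int[mu]_x f x.
Proof.
move=> mf; have mEf : measurable_fun setT (EFin \o f) by exact/measurable_EFinP.
rewrite /Rintegral fine_pmul; congr fine.
rewrite [X in (_ * X)%E]integralE [RHS]integralE muleB_pos.
have Ep := change (measurable_funepos mEf) (funepos_ge0 _).
have En := change (measurable_funeneg mEf) (funeneg_ge0 _).
congr (_ - _)%E.
- rewrite -Ep; congr (_ * _)%E; apply: eq_integral => x _; rewrite !funeposE; reflexivity.
- rewrite -En; congr (_ * _)%E; apply: eq_integral => x _; rewrite !funenegE; reflexivity.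
Qed.

End change_of_variables.

Section affine_line.
Context {R : realType}.
Notation mu := (@lebesgue_measure R).
Variables (c u : R).
Hypothesis u0 : u != 0.

Let phi (x : measurableTypeR R) : measurableTypeR R := c + u * x.

Let pushforward_measure (mphi : measurable_fun [set: measurableTypeR R] phi) :
    {measure set (measurableTypeR R) -> \bar R} :=
  measure_function_pushforward__canonical__measure_function_Measure mu mphi.

Let mphi : measurable_fun [set: measurableTypeR R] phi.
Proof. by apply: measurable_funD => //; apply: measurable_funM. Qed.

(** The scaled push-forward of the Lebesgue measure has the right value on half-open
    intervals, which characterizes the Lebesgue measure. *)
Lemma lebesgue_affine (f : R -> \bar R) : measurable_fun [set: R] f ->
  (forall x, 0 <= f x)%E ->
  ((`|u|)%:E * \int[mu]_x f (c + u * x)%R = \int[mu]_x f x)%E.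
Proof.
move=> mf f0.
have u0' : 0 < `|u| by rewrite normr_gt0.
have E := ge0_integral_pushforward mphi mu measurableT mf (fun y _ => f0 y).
have -> : (\int[mu]_x f (c + u * x)%R = \int[mu]_(x in phi @^-1` setT) (f \o phi) x)%E.
  by rewrite preimage_setT.
have := ge0_integral_mscale (pushforward_measure mphi) measurableT (NngNum (ltW u0')) mf (fun y _ => f0 y).
rewrite E /= => <-.
apply: eq_measure_integral => A mA _; apply/esym/lebesgue_measure_unique => // X [[a b] _ <-]/=.
  rewrite /mscale/= /pushforward/= lebesgue_measure_itv/= lte_fin.
  case: (ltgtP u 0) u0 => // us _.
  - have -> : phi @^-1` `]a, b]%classic = `[(b - c) / u, (a - c) / u[%classic.
      apply/seteqP; split => x; rewrite /phi/= !in_itv/= => /andP[h1 h2]; apply/andP.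
        by rewrite ler_ndivrMr// ltr_ndivlMr// (mulrC x); split; lra.
      by move: h1 h2; rewrite ler_ndivrMr// ltr_ndivlMr// (mulrC x) => h1 h2; split; lra.
    rewrite lebesgue_measure_itv/= lte_fin ltr_nM2r ?invr_lt0// ltrD2r.
    case: ifP => // ab; last by rewrite mule0.
    by rewrite -!EFinB -EFinM ltr0_norm//; congr EFin; field.
  - have -> : phi @^-1` `]a, b]%classic = `](a - c) / u, (b - c) / u]%classic.
      apply/seteqP; split => x; rewrite /phi/= !in_itv/= => /andP[h1 h2]; apply/andP.
        by rewrite ler_pdivlMr// ltr_pdivrMr// (mulrC x); split; lra.
      by move: h1 h2; rewrite ler_pdivlMr// ltr_pdivrMr// (mulrC x) => h1 h2; split; lra.
    rewrite lebesgue_measure_itv/= lte_fin ltr_pM2r ?invr_gt0// ltrD2r.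
    case: ifP => // ab; last by rewrite mule0.
    by rewrite -!EFinB -EFinM gtr0_norm//; congr EFin; field.
Qed.

End affine_line.

Section rV_integral.
Context {R : realType}.
Notation mu := (@lebesgue_measure R).

Let pushforward_consrV d : {measure set 'rV[R]_d.+1 -> \bar R} :=
  measure_function_pushforward__canonical__measure_function_Measure
    (mu \x rV_lebesgue d)%E (@measurable_consrV R d).

Lemma rV_lebesgueS d (A : set 'rV[R]_d.+1) :
  rV_lebesgue d.+1 A = pushforward (mu \x rV_lebesgue d)%E (@consrV R d) A.
Proof. by []. Qed.

Lemma integral_rVS d (f : 'rV[R]_d.+1 -> \bar R) : measurable_fun setT f ->
  (forall x, 0 <= f x)%E ->
  (\int[rV_lebesgue d.+1]_x f x =
   \int[mu]_a \int[rV_lebesgue d]_y f (consrV (a, y)))%E.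
Proof.
move=> mf f0.
have E := @ge0_integral_pushforward _ _ _ _ R (@consrV R d) (@measurable_consrV R d)
   (mu \x rV_lebesgue d)%E setT f measurableT mf (fun y _ => f0 y).
transitivity (\int[(mu \x rV_lebesgue d)%E]_x (f \o @consrV R d) x)%E.
  move: E; rewrite preimage_setT => <-.
  apply: (@eq_measure_integral _ _ _ setT (pushforward_consrV d) (rV_lebesgue d.+1) f) => A mA _.
  exact: rV_lebesgueS.
rewrite (fubini_tonelli1 (f \o @consrV R d))//; last by move=> x; exact: f0.
exact: (measurableT_comp mf (@measurable_consrV R d)).
Qed.

Lemma summable_rVS d (f : 'rV[R]_d.+1 -> R) : summable_fun (rV_lebesgue d.+1) f ->
  summable_fun (mu \x rV_lebesgue d)%E (f \o @consrV R d).
Proof.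
move=> sf; have mf := summable_meas sf.
have mfc : measurable_fun setT (f \o @consrV R d).
  exact: (measurableT_comp mf (@measurable_consrV R d)).
apply/integrable12ltyP; first exact/measurable_EFinP.
move: (summable_lt sf); rewrite integral_rVS//.
by apply/measurable_EFinP; exact: measurableT_comp.
Qed.

Lemma Rintegral_rVS d (f : 'rV[R]_d.+1 -> R) : summable_fun (rV_lebesgue d.+1) f ->
  \int[rV_lebesgue d.+1]_x f x = \int[mu]_a \int[rV_lebesgue d]_y f (consrV (a, y)).
Proof.
move=> sf.
rewrite (Rfubini1 (summable_rVS sf)).
have mf := summable_meas sf.
have mEf : measurable_fun setT (EFin \o f) by exact/measurable_EFinP.
have E := @integral_pushforward _ _ _ _ R (@consrV R d) (@measurable_consrV R d)
   (mu \x rV_lebesgue d)%E setT (EFin \o f) mEf (summable_rVS sf) measurableT.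
rewrite /Rintegral; congr fine; move: E; rewrite preimage_setT => <-.
apply: (@eq_measure_integral _ _ _ setT (pushforward_consrV d) (rV_lebesgue d.+1) (EFin \o f)) => A mA _.
exact: rV_lebesgueS.
Qed.

Lemma measurable_rV_affine d (c : 'rV[R]_d) (u : R) :
  measurable_fun setT (fun x : 'rV[R]_d => c + u *: x).
Proof.
apply: measurable_fun_rV => i; under eq_fun do rewrite !mxE.
by apply: measurable_funD => //; apply: measurable_funM => //; exact: measurable_coord.
Qed.

Lemma affine_consrV d (c : 'rV[R]_d.+1) (u : R) (a : R) (y : 'rV[R]_d) :
  c + u *: consrV (a, y) =
  consrV (c ord0 ord0 + u * a, (\row_i c ord0 (lift ord0 i)) + u *: y).
Proof.
apply/rowP => i; rewrite 2!mxE; have [j ->|->] := unliftP ord0 i.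
  by rewrite !consrVS !mxE.
by rewrite !consrV0.
Qed.

(** By induction on d, one coordinate at a time, each of them contributing a factor |u|. *)
Lemma rV_affine d (c : 'rV[R]_d) (u : R) (f : 'rV[R]_d -> \bar R) : u != 0 ->
  measurable_fun setT f -> (forall x, 0 <= f x)%E ->
  ((`|u| ^+ d)%:E * \int[rV_lebesgue d]_x f (c + u *: x)%R = \int[rV_lebesgue d]_x f x)%E.
Proof.
move=> u0; elim: d => [|d IHd] in c f *.
  move=> mf f0; rewrite expr0 mul1e; apply: eq_integral => x _; congr f.
  by apply/rowP => -[].
move=> mf f0.
have mfc : measurable_fun setT (f \o @consrV R d).
  exact: (measurableT_comp mf (@measurable_consrV R d)).
have mfa := measurableT_comp mf (measurable_rV_affine c u).
rewrite (integral_rVS mf f0) (integral_rVS mfa) => [|x]; last exact: f0.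
have mg : measurable_fun setT (fun a => \int[rV_lebesgue d]_y f (consrV (a, y)))%E.
  have := @measurable_fun_fubini_tonelli_F _ _ _ _ R (rV_lebesgue d) (f \o @consrV R d) mfc.
  by move/(_ (fun x => f0 (consrV x))).
rewrite -[RHS](lebesgue_affine (c ord0 ord0) u0 mg); last first.
  by move=> a; apply: integral_ge0 => y _; exact: f0.
rewrite exprS EFinM -muleA -ge0_integralZl//; last 2 first.
- have mfac := measurableT_comp mfa (@measurable_consrV R d).
  have := @measurable_fun_fubini_tonelli_F _ _ _ _ R (rV_lebesgue d) _ mfac.
  by move/(_ (fun x => f0 (c + u *: consrV x)%R)).
- by move=> a _; apply: integral_ge0 => y _; exact: f0.
congr (_ * _)%E; apply: eq_integral => a _.
rewrite -(IHd (\row_i c ord0 (lift ord0 i)) (fun y => f (consrV (c ord0 ord0 + u * a, y))))//.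
  by congr (_ * _)%E; apply: eq_integral => y _; rewrite /comp affine_consrV.
exact: (measurableT_comp mfc (pair1_measurable _)).
Qed.

Lemma summable_affine (c u : R) (f : R -> R) : u != 0 ->
  summable_fun mu f -> summable_fun mu (fun x => f (c + u * x)).
Proof.
move=> u0; apply: (@summable_change _ _ _ _ _ `|u|); rewrite ?normr_gt0//.
- by apply: measurable_funD => //; apply: measurable_funM.
- by move=> g mg g0; exact: lebesgue_affine.
Qed.

Lemma Rintegral_affine (c u : R) (f : R -> R) : u != 0 -> measurable_fun setT f ->
  `|u| * \int[mu]_x f (c + u * x) = \int[mu]_x f x.
Proof.
move=> u0 mf; apply: (@Rintegral_change _ _ R mu (fun x => c + u * x) `|u|) => //.
  by rewrite normr_gt0.
by move=> g mg g0; exact: lebesgue_affine.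
Qed.

Lemma summable_rV_affine d (c : 'rV[R]_d) (u : R) (f : 'rV[R]_d -> R) : u != 0 ->
  summable_fun (rV_lebesgue d) f -> summable_fun (rV_lebesgue d) (fun x => f (c + u *: x)).
Proof.
move=> u0; apply: (@summable_change _ _ _ _ _ (`|u| ^+ d)); rewrite ?exprn_gt0 ?normr_gt0//.
- exact: measurable_rV_affine.
- by move=> g mg g0; exact: rV_affine.
Qed.

Lemma Rintegral_rV_affine d (c : 'rV[R]_d) (u : R) (f : 'rV[R]_d -> R) : u != 0 ->
  measurable_fun setT f ->
  `|u| ^+ d * \int[rV_lebesgue d]_x f (c + u *: x) = \int[rV_lebesgue d]_x f x.
Proof.
move=> u0 mf.
apply: (@Rintegral_change _ _ R (rV_lebesgue d) (fun x => c + u *: x) (`|u| ^+ d)) => //.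
  by rewrite exprn_gt0// normr_gt0.
by move=> g mg g0; exact: rV_affine.
Qed.

End rV_integral.

(** * Derivatives and integrals on the line *)

Section pointwise_derivatives.
Context {R : realType}.
Implicit Types (f g : R -> R) (x a b : R).

(** The value of the derivative is kept explicit, so that the rules below can be chained by
    unification. *)
Definition der f x a := is_derive x (1 : R) f a.

Lemma der_eq f x a b : der f x a -> a = b -> der f x b.
Proof. by move=> h <-. Qed.

Lemma der_cst c x : der (fun=> c) x 0.
Proof. exact: is_derive_cst. Qed.

Lemma der_id x : der (fun y => y) x 1.
Proof. exact: is_derive_id. Qed.

Lemma derD f g x a b : der f x a -> der g x b -> der (fun y => f y + g y) x (a + b).
Proof. by move=> ? ?; exact: is_deriveD. Qed.

Lemma derN f x a : der f x a -> der (fun y => - f y) x (- a).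
Proof. by move=> ?; exact: is_deriveN. Qed.

Lemma derM f g x a b : der f x a -> der g x b ->
  der (fun y => f y * g y) x (f x * b + g x * a).
Proof. by move=> ? ?; exact: is_deriveM. Qed.

Lemma derX f n x a : der f x a -> der (fun y => f y ^+ n) x (n%:R * f x ^+ n.-1 * a).
Proof.
move=> h; rewrite (_ : (fun y => f y ^+ n) = f ^+ n); first exact: is_deriveX.
by apply/funext => y; rewrite exprfctE.
Qed.

Lemma der_comp g f x a b : der g (f x) a -> der f x b -> der (fun y => g (f y)) x (a * b).
Proof. by move=> ? ?; exact: is_derive1_comp. Qed.

Lemma derV f x a : f x != 0 -> der f x a -> der (fun y => (f y)^-1) x (- (f x) ^- 2 * a).
Proof. by move=> ? ?; exact: is_deriveV. Qed.

Lemma der_sin f x a : der f x a -> der (fun y => sin (f y)) x (cos (f x) * a).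
Proof. by move=> ?; exact: (der_comp (is_derive_sin _)). Qed.

Lemma der_cos f x a : der f x a -> der (fun y => cos (f y)) x (- sin (f x) * a).
Proof. by move=> ?; exact: (der_comp (is_derive_cos _)). Qed.

Lemma der_exp f x a : der f x a -> der (fun y => expR (f y)) x (expR (f x) * a).
Proof. by move=> ?; exact: (der_comp (is_derive_expR _)). Qed.

Lemma der_atan f x a : der f x a -> der (fun y => atan (f y)) x ((1 + f x ^+ 2)^-1 * a).
Proof. by move=> ?; exact: (der_comp (is_derive1_atan _)). Qed.

Lemma der_ln f x a : 0 < f x -> der f x a -> der (fun y => ln (f y)) x ((f x)^-1 * a).
Proof. by move=> ? ?; exact: (der_comp (is_derive1_ln _)). Qed.

Lemma der_cont f x a : der f x a -> {for x, continuous f}.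
Proof. by move=> [d _]; exact/differentiable_continuous/derivable1_diffP. Qed.

Lemma cont_der f : (forall x, exists a, der f x a) -> continuous f.
Proof. by move=> h x; have [a /der_cont] := h x. Qed.

Lemma cont_comp g f : continuous f -> continuous g -> continuous (fun y => g (f y)).
Proof. by move=> cf cg x; exact: (continuous_comp (cf x) (cg (f x))). Qed.

Lemma contM f g : continuous f -> continuous g -> continuous (fun y => f y * g y).
Proof. by move=> cf cg x; exact: (cvgM (cf x) (cg x)). Qed.

Lemma contD f g : continuous f -> continuous g -> continuous (fun y => f y + g y).
Proof. by move=> cf cg x; exact: (cvgD (cf x) (cg x)). Qed.

Lemma contB f g : continuous f -> continuous g -> continuous (fun y => f y - g y).
Proof. by move=> cf cg x; exact: (cvgB (cf x) (cg x)). Qed.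

Lemma cont_cst a : continuous (fun _ : R => a).
Proof. by move=> x; exact: cvg_cst. Qed.

End pointwise_derivatives.

Ltac der_step := first
  [ exact: der_cst | exact: der_id | apply: der_sin | apply: der_cos | apply: der_exp
  | apply: der_atan | apply: der_ln | apply: derN | apply: derX | apply: derV | apply: derM | apply: derD ].
(** Differentiates a closed expression: the derivative is built by the rules, and the goal
    left over says that it equals the announced one. *)
Ltac der_auto := apply: der_eq; [ repeat der_step | ].

Section line_integrals.
Context {R : realType}.
Notation mu := (@lebesgue_measure R).
Implicit Types (f F : R -> R).

Lemma cont_meas f : continuous f -> measurable_fun setT f.
Proof. exact: continuous_measurable_fun. Qed.

Lemma FTC_seg F f a b : a < b -> (forall x, der F x (f x)) -> continuous f ->
  \int[mu]_(x in `[a, b]) f x = F b - F a.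
Proof.
move=> ab dF cf.
have cF : continuous F by apply: cont_der => x; exists (f x); exact: dF.
have dFx x : derivable F x 1 by case: (dF x).
rewrite /Rintegral (continuous_FTC2 ab (F := F))//.
- exact: continuous_subspaceT.
- split; first by move=> x _; exact: dFx.
  + by apply: cvg_at_right_filter; exact: cF.
  + by apply: cvg_at_left_filter; exact: cF.
- by move=> x _; rewrite derive1E; case: (dF x).
Qed.

Lemma cvg_Rintegral_line f : summable_fun mu f ->
  \int[mu]_(x in `[- n%:R, n%:R]) f x @[n --> \oo] --> \int[mu]_x f x.
Proof.
move=> sf; have mf := summable_meas sf.
under eq_fun do rewrite Rintegral_mkcond.
apply: (@dominated_Rintegral _ _ _ mu
  (fun n => f \_ `[- n%:R, n%:R]) f (fun x => `|f x|)) => //.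
- move=> n; apply: (measurable_restrictT _ _).1; first exact: measurable_itv.
  exact: (measurable_funS measurableT _ mf).
- apply: aeW => x /=; apply/cvgrPdist_lt => e e0.
  exists (Num.bound `|x|) => // n /= xn.
  rewrite patchE mem_set ?subrr ?normr0//=.
  rewrite in_itv/= -ler_norml ltW// (lt_le_trans (archi_boundP _))//.
  by rewrite ler_nat.
- exact: summable_norm.
- by move=> n x; rewrite patchE; case: ifP => // _; rewrite normr0.
Qed.

(** Symmetric limits suffice because f is known to be integrable beforehand. *)
Lemma FTC_line F f L : summable_fun mu f -> (forall x, der F x (f x)) -> continuous f ->
  (F n%:R - F (- n%:R) @[n --> \oo] --> L) -> \int[mu]_x f x = L.
Proof.
move=> sf dF cf FL; apply: (cvg_unique _ (cvg_Rintegral_line sf)) => //.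
apply: cvg_trans FL; apply: near_eq_cvg; near=> n.
rewrite (FTC_seg _ dF)//.
have : (0 < n%:R :> R) by rewrite ltr0n; near: n; exact: nbhs_infty_gt.
by move=> ?; lra.
Unshelve. all: by end_near. Qed.

Lemma summable_cauchy : summable_fun mu (fun x : R => (1 + x ^+ 2)^-1).
Proof.
have c0 : continuous (fun x : R => (1 + x ^+ 2)^-1).
  apply: cont_der => x; eexists; der_auto; last by [].
  by rewrite gt_eqF// ltr_pwDl// sqr_ge0.
apply: summableP; first exact: cont_meas.
under eq_integral do rewrite ger0_norm ?invr_ge0 ?addr_ge0 ?sqr_ge0//.
rewrite ge0_symfun_integralT//.
- rewrite -set_itvcy integral0y_oneDsqr -EFinM ltry//.
- by move=> x; rewrite invr_ge0 addr_ge0 ?sqr_ge0.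
- by move=> x /=; rewrite sqrrN.
Qed.

Lemma integral_cauchy : \int[mu]_x (1 + x ^+ 2)^-1 = (pi : R).
Proof.
have c0 : continuous (fun x : R => (1 + x ^+ 2)^-1).
  apply: cont_der => x; eexists; der_auto; last by [].
  by rewrite gt_eqF// ltr_pwDl// sqr_ge0.
rewrite /Rintegral ge0_symfun_integralT//.
- by rewrite -set_itvcy integral0y_oneDsqr -EFinM/= mulrC divfK.
- by move=> x; rewrite invr_ge0 addr_ge0 ?sqr_ge0.
- by move=> x /=; rewrite sqrrN.
Qed.

End line_integrals.

(** * The Poisson kernel and its conjugate *)

(** From ln(x/y) <= x/y - 1 and its counterpart with x and y exchanged. *)
Lemma ln_diff_le (R : realType) (x y : R) : 0 < x -> 0 < y ->
  `|ln x - ln y| <= `|x - y| * (x^-1 + y^-1).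
Proof.
have H (a b : R) : 0 < a -> 0 < b -> ln a - ln b <= (a - b) * b^-1.
  move=> a0 b0; rewrite -ln_div ?posrE// mulrBl divff ?gt_eqF//.
  have := @ln_sublinear R (a / b); have := ltW.
  have := @expR_ge1Dx R (ln (a / b)); rewrite lnK ?posrE ?divr_gt0// => h _ _.
  by rewrite lerBrDl.
move=> x0 y0; have ix : 0 < x^-1 by rewrite invr_gt0.
have iy : 0 < y^-1 by rewrite invr_gt0.
have h1 := H _ _ x0 y0; have h2 := H _ _ y0 x0.
rewrite ler_norml mulrDr; have := ler_norm (x - y); have := ler_norm (y - x).
rewrite (distrC y x) => n1 n2; have n0 := normr_ge0 (x - y).
have : (x - y) * y^-1 <= `|x - y| * y^-1 by rewrite ler_wpM2r// ltW.
have : (y - x) * x^-1 <= `|x - y| * x^-1 by rewrite ler_wpM2r// ltW.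
have : 0 <= `|x - y| * x^-1 by rewrite mulr_ge0// ltW.
have : 0 <= `|x - y| * y^-1 by rewrite mulr_ge0// ltW.
by move=> *; apply/andP; split; lra.
Qed.

Section kernels.
Context {R : realType}.
Notation mu := (@lebesgue_measure R).
Implicit Types (a r t b : R).

Definition poisson a r : R := a / (a ^+ 2 + r ^+ 2).
Definition conj_poisson a r : R := r / (a ^+ 2 + r ^+ 2).
(** The derivative of [conj_poisson a]. *)
Definition dconj_poisson a r : R := (a ^+ 2 - r ^+ 2) / (a ^+ 2 + r ^+ 2) ^+ 2.
(** A primitive of [conj_poisson a]. *)
Definition hln a r : R := ln (a ^+ 2 + r ^+ 2) / 2.

Lemma den_gt0 a r : 0 < a -> 0 < a ^+ 2 + r ^+ 2.
Proof. by move=> a0; rewrite ltr_pwDl ?exprn_gt0// sqr_ge0. Qed.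

Lemma den_neq0 a r : 0 < a -> a ^+ 2 + r ^+ 2 != 0.
Proof. by move=> a0; rewrite gt_eqF// den_gt0. Qed.

Lemma poisson_ge0 a r : 0 < a -> 0 <= poisson a r.
Proof. by move=> a0; rewrite divr_ge0// ltW// den_gt0. Qed.

Lemma der_conj_poisson a r : 0 < a -> der (conj_poisson a) r (dconj_poisson a r).
Proof.
move=> a0; have d0 := den_neq0 r a0; rewrite /conj_poisson; der_auto => //.
by rewrite /dconj_poisson /=; field.
Qed.

Lemma der_hln a r : 0 < a -> der (hln a) r (conj_poisson a r).
Proof.
move=> a0; have d0 := den_neq0 r a0; rewrite /hln; der_auto; first exact: den_gt0.
by rewrite /conj_poisson /=; field.
Qed.

Lemma cont_dconj_poisson a : 0 < a -> continuous (dconj_poisson a).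
Proof.
move=> a0; apply: cont_der => r; eexists; rewrite /dconj_poisson; der_auto; last by [].
by rewrite expf_neq0// den_neq0.
Qed.

(** Exhibits the Poisson kernel as an affine image of the Cauchy density. *)
Lemma poissonE a r : 0 < a -> poisson a r = a^-1 * (1 + (0 + a^-1 * r) ^+ 2)^-1.
Proof.
move=> a0; have d0 := den_neq0 r a0; have an0 : a != 0 by rewrite gt_eqF.
by rewrite /poisson; field; rewrite an0 d0.
Qed.

Lemma summable_poisson a : 0 < a -> summable_fun mu (poisson a).
Proof.
move=> a0; have h : (fun r => a^-1 * (1 + (0 + a^-1 * r) ^+ 2)^-1) = poisson a.
  by apply/funext => r; rewrite poissonE.
rewrite -h; apply: summable_funZ; apply: (@summable_affine _ 0 a^-1 (fun r => (1 + r ^+ 2)^-1)).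
  by rewrite invr_eq0 gt_eqF.
exact: summable_cauchy.
Qed.

Lemma dconj_poisson_le a r : 0 < a -> `|dconj_poisson a r| <= a^-1 * poisson a r.
Proof.
move=> a0; rewrite /dconj_poisson /poisson mulKf ?gt_eqF//.
have d0 := den_gt0 r a0.
rewrite normrM normfV (ger0_norm (sqr_ge0 _)) ler_pdivrMr ?exprn_gt0//.
rewrite expr2 mulKf ?gt_eqF//.
have := sqr_ge0 a; have := sqr_ge0 r; rewrite ler_norml => *; apply/andP; split; lra.
Qed.

Lemma poisson_le a r : 0 < a -> poisson a r <= a^-1.
Proof.
move=> a0; rewrite /poisson ler_pdivrMr ?den_gt0//.
rewrite mulrDr expr2 mulKf ?gt_eqF// lerDl mulr_ge0 ?sqr_ge0// invr_ge0 ltW//.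
Qed.

End kernels.

Section hilbert_kernel.
Context {R : realType}.
Notation mu := (@lebesgue_measure R).
Variables (a b : R).
Hypothesis a0 : 0 < a.

(** The difference quotient (q_a(b + t) - q_a(b - t))/t, in a form that makes sense at
    t = 0. *)
Definition hilbert_kernel (t : R) : R :=
  2 * (a ^+ 2 + t ^+ 2 - b ^+ 2) /
  ((a ^+ 2 + (b + t) ^+ 2) * (a ^+ 2 + (b - t) ^+ 2)).

Lemma hilbert_kernelE t :
  conj_poisson a (b + t) - conj_poisson a (b - t) = t * hilbert_kernel t.
Proof.
have dp := den_neq0 (b + t) a0; have dm := den_neq0 (b - t) a0.
by rewrite /conj_poisson /hilbert_kernel; field; rewrite dp dm.
Qed.

Lemma cont_hilbert_kernel : continuous hilbert_kernel.
Proof.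
apply: cont_der => t; eexists; rewrite /hilbert_kernel; der_auto; last by [].
by rewrite mulf_neq0// den_neq0.
Qed.

Let B0 : 0 <= b ^+ 2 / a ^+ 2.
Proof. by rewrite divr_ge0 ?sqr_ge0. Qed.

(** Translating by b changes a^2 + t^2 by a bounded factor, so that the product of the two
    denominators of the kernel dominates (a^2 + t^2)^2. *)
Let peetre t : a ^+ 2 + t ^+ 2 <=
  (2 + 2 * (b ^+ 2 / a ^+ 2)) * (a ^+ 2 + (b + t) ^+ 2).
Proof.
have a2 : 0 < a ^+ 2 by rewrite exprn_gt0.
have an0 : a != 0 by rewrite gt_eqF.
have -> : (2 + 2 * (b ^+ 2 / a ^+ 2)) * (a ^+ 2 + (b + t) ^+ 2) =
  2 * a ^+ 2 + 2 * (b + t) ^+ 2 + 2 * b ^+ 2 + (2 * (b ^+ 2 / a ^+ 2)) * (b + t) ^+ 2.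
  by field.
have h : 0 <= (2 * (b ^+ 2 / a ^+ 2)) * (b + t) ^+ 2.
  by exact: (mulr_ge0 (mulr_ge0 (ler0n _ 2) B0) (sqr_ge0 _)).
have := sqr_ge0 (b + (b + t)); lra.
Qed.

Let peetreN t : a ^+ 2 + t ^+ 2 <=
  (2 + 2 * (b ^+ 2 / a ^+ 2)) * (a ^+ 2 + (b - t) ^+ 2).
Proof. by rewrite -(sqrrN t); exact: peetre. Qed.

Lemma hilbert_kernel_le t : `|hilbert_kernel t| <=
  2 * (1 + b ^+ 2 / a ^+ 2) * (2 + 2 * (b ^+ 2 / a ^+ 2)) ^+ 2 * a^-1 * poisson a t.
Proof.
set C := 2 + 2 * (b ^+ 2 / a ^+ 2).
have a2 : 0 < a ^+ 2 by rewrite exprn_gt0.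
have an0 : a != 0 by rewrite gt_eqF.
have dp := den_gt0 (b + t) a0; have dm := den_gt0 (b - t) a0; have dt := den_gt0 t a0.
have C0 : 0 < C by rewrite ltr_pwDl// (mulr_ge0 (ler0n _ 2) B0).
have hN : `|a ^+ 2 + t ^+ 2 - b ^+ 2| <= (1 + b ^+ 2 / a ^+ 2) * (a ^+ 2 + t ^+ 2).
  have -> : (1 + b ^+ 2 / a ^+ 2) * (a ^+ 2 + t ^+ 2) =
    a ^+ 2 + t ^+ 2 + b ^+ 2 + b ^+ 2 / a ^+ 2 * t ^+ 2 by field.
  have : 0 <= b ^+ 2 / a ^+ 2 * t ^+ 2 by exact: (mulr_ge0 B0 (sqr_ge0 _)).
  have := sqr_ge0 b; have := sqr_ge0 t; rewrite ler_norml => *; apply/andP; split; lra.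
have hD : (a ^+ 2 + t ^+ 2) ^+ 2 <=
    C ^+ 2 * ((a ^+ 2 + (b + t) ^+ 2) * (a ^+ 2 + (b - t) ^+ 2)).
  rewrite !expr2 mulrACA; exact: (ler_pM (ltW dt) (ltW dt) (peetre t) (peetreN t)).
rewrite /hilbert_kernel /poisson; move: hN hD dt (mulr_gt0 dp dm).
set D := (_ * (a ^+ 2 + (b - t) ^+ 2)); set S := a ^+ 2 + t ^+ 2; set K := 1 + _.
move=> hN hD S0 D0; have K0 : 0 <= K by rewrite addr_ge0.
rewrite (_ : _ * (a / S) = 2 * K * C ^+ 2 / S); last by field; rewrite an0 gt_eqF.
rewrite !normrM normfV (gtr0_norm D0) ger0_norm// ler_pdivrMr//.
rewrite (_ : 2 * K * _ / S * D = 2 * (K * (C ^+ 2 * D / S))); last by ring.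
rewrite ler_pM2l//; apply: le_trans hN _; rewrite ler_wpM2l//.
by rewrite ler_pdivlMr// -expr2.
Qed.

Lemma summable_hilbert_kernel : summable_fun mu hilbert_kernel.
Proof.
apply: (@le_summable _ _ R mu hilbert_kernel _ _ hilbert_kernel_le).
  exact: (cont_meas cont_hilbert_kernel).
by apply: summable_funZ; exact: summable_poisson.
Qed.

(** An explicit primitive of the kernel, found by partial fractions. *)
Let W (t : R) : R := (a ^+ 2 + b ^+ 2)^-1 *
  (a * (atan ((b + t) / a) - atan ((b - t) / a)) -
   b * (hln a (b + t) - hln a (b - t))).

Let derW t : der W t (hilbert_kernel t).
Proof.
have dp := den_neq0 (b + t) a0; have dm := den_neq0 (b - t) a0.
have db := den_neq0 b a0; have an0 : a != 0 by rewrite gt_eqF.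
have hp : der (fun t => hln a (b + t)) t (conj_poisson a (b + t) * 1).
  by apply: der_comp; [exact: der_hln|der_auto => //; rewrite add0r].
have hm : der (fun t => hln a (b - t)) t (conj_poisson a (b - t) * - 1).
  by apply: der_comp; [exact: der_hln|der_auto => //; rewrite add0r].
have e r : 1 + (r / a) ^+ 2 = (a ^+ 2 + r ^+ 2) / a ^+ 2 by field.
rewrite /W; apply: der_eq.
  apply: derM; first exact: der_cst.
  apply: derD; last first.
    apply: derN; apply: derM; first exact: der_cst.
    by apply: derD; [exact: hp|apply: derN; exact: hm].
  apply: derM; first exact: der_cst.
  by apply: derD; [apply: der_atan; der_auto => //|apply: derN; apply: der_atan; der_auto => //].
rewrite /= !e /conj_poisson /hilbert_kernel; field.
by rewrite dp dm db an0.
Qed.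

Let WN t : W (- t) = - W t.
Proof. by rewrite /W opprK; ring. Qed.

Let cvg_to_infty (c : R) : (c + n%:R) / a @[n --> \oo] --> +oo.
Proof.
apply/cvgryPge => M; near=> n; rewrite ler_pdivlMr// -lerBlDl.
by near: n; exact: nbhs_infty_ger.
Unshelve. all: by end_near. Qed.

Let cvg_hln : hln a (b + n%:R) - hln a (b - n%:R) @[n --> \oo] --> (0 : R).
Proof.
apply/cvgrPdist_le => e e0; near=> n.
have n0 : 0 < n%:R :> R by rewrite ltr0n; near: n; exact: nbhs_infty_gt.
have nb : 2 * `|b| <= n%:R by near: n; exact: nbhs_infty_ger.
(* both arguments of ln are at least n^2/4 and differ by 4 n b *)
have ne : 16 * `|b| / e <= n%:R by near: n; exact: nbhs_infty_ger.
have := den_gt0 (b + n%:R) a0; have := den_gt0 (b - n%:R) a0.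
have bnd (c : R) : n%:R / 2 <= `|c| -> n%:R ^+ 2 / 4 <= a ^+ 2 + c ^+ 2.
  move=> h; have : (n%:R / 2) ^+ 2 <= c ^+ 2.
    by rewrite -(real_normK (num_real c)) ler_pXn2r// nnegrE// divr_ge0.
  by rewrite expr_div_n; have := sqr_ge0 a; lra.
have /bnd : n%:R / 2 <= `|b + n%:R|.
  have := ler_norm (b + n%:R); have := ler_norm (- b); rewrite normrN; lra.
have /bnd : n%:R / 2 <= `|b - n%:R|.
  rewrite distrC; have := ler_norm (n%:R - b); have := ler_norm b; lra.
rewrite /hln; move: (ln_diff_le (x := a ^+ 2 + (b + n%:R) ^+ 2) (y := a ^+ 2 + (b - n%:R) ^+ 2)).
rewrite (_ : a ^+ 2 + (b + n%:R) ^+ 2 - (a ^+ 2 + (b - n%:R) ^+ 2) = 4 * n%:R * b); last by ring.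
set D := (a ^+ 2 + (b + _) ^+ 2); set E := (a ^+ 2 + (b - _) ^+ 2) => hl hE hD E0 D0.
rewrite sub0r normrN -mulrBl normrM (gtr0_norm (_ : 0 < 2^-1 :> R)) ?invr_gt0//.
have {}hl := hl D0 E0.
have iD : D^-1 <= 4 / n%:R ^+ 2 by rewrite -invf_div lef_pV2 ?posrE// divr_gt0 ?exprn_gt0.
have iE : E^-1 <= 4 / n%:R ^+ 2 by rewrite -invf_div lef_pV2 ?posrE// divr_gt0 ?exprn_gt0.
have : `|4 * n%:R * b| * (D^-1 + E^-1) <= `|4 * n%:R * b| * (8 / n%:R ^+ 2).
  by rewrite ler_wpM2l//; lra.
rewrite normrM (gtr0_norm (_ : 0 < 4 * n%:R)) ?mulr_gt0//.
rewrite (_ : 4 * n%:R * `|b| * (8 / n%:R ^+ 2) = 2 * (16 * `|b| / n%:R)); last first.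
  by field; rewrite gt_eqF.
have : 16 * `|b| / n%:R <= e by rewrite ler_pdivrMr// (mulrC e) -ler_pdivrMr//.
move: hl; rewrite normrM (gtr0_norm (_ : 0 < 4 * n%:R)) ?mulr_gt0//; lra.
Unshelve. all: by end_near. Qed.

Let cvg_W : W n%:R @[n --> \oo] --> pi * poisson a b.
Proof.
have -> : pi * poisson a b = (a ^+ 2 + b ^+ 2)^-1 *
    (a * (pi / 2 - - (pi / 2)) - b * 0) :> R.
  by rewrite /poisson; field; rewrite den_neq0.
apply: cvgM; first exact: cvg_cst.
apply: cvgB; last by apply: cvgM; [exact: cvg_cst|exact: cvg_hln].
apply: cvgM; first exact: cvg_cst.
apply: cvgB; first exact: cvg_comp (cvg_to_infty b) (@cvgy_atan R).
under eq_fun do rewrite -opprB mulNr atanN (addrC _ (- b)).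
by apply: cvgN; exact: cvg_comp (cvg_to_infty (- b)) (@cvgy_atan R).
Qed.

(** In W(n) the two logarithms cancel in the limit and the two arctangents add up to pi.
    Up to a constant factor the value is the Hilbert transform of q_a at b, which is why
    the Poisson kernel appears. *)
Lemma integral_hilbert_kernel : \int[mu]_t hilbert_kernel t = 2 * pi * poisson a b.
Proof.
apply: (FTC_line summable_hilbert_kernel derW cont_hilbert_kernel).
under eq_fun do rewrite WN opprK.
by rewrite -mulrA mulr_natl mulr2n; exact: cvgD cvg_W cvg_W.
Qed.

End hilbert_kernel.

(** * The transform of a profile *)

Section convolution_bound.
Context {R : realType}.
Notation mu := (@lebesgue_measure R).

Lemma Rintegral_shiftl (f : R -> R) (c : R) : measurable_fun setT f ->
  \int[mu]_x f (x + c) = \int[mu]_x f x.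
Proof.
move=> mf; have := @Rintegral_affine R c 1 f (oner_neq0 _) mf.
rewrite normr1 mul1r => <-; apply: eq_Rintegral => x _.
by rewrite mul1r addrC.
Qed.

Lemma summable_shiftl (f : R -> R) (c : R) : summable_fun mu f ->
  summable_fun mu (fun x => f (x + c)).
Proof.
move=> sf; have := @summable_affine R c 1 f (oner_neq0 _) sf.
by under eq_fun do rewrite mul1r addrC.
Qed.

Variables (g h : R -> R) (u : R).
Hypotheses (sg : summable_fun mu g) (sh : summable_fun mu h).

Let F (z : measurableTypeR R * measurableTypeR R) : R := g z.2 * h (z.1 - u * z.2).

Let mF : measurable_fun setT F.
Proof.
apply: measurable_funM.
  by apply: measurableT_comp => //; exact: (summable_meas sg).
apply: measurableT_comp; first exact: (summable_meas sh).
by apply: measurable_funB => //; apply: measurable_funM.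
Qed.

Lemma summable_convolution : summable_fun (mu \x mu)%E F.
Proof.
apply: (@summable_prod_rev _ _ _ _ R mu mu F (fun s => `|g s| * \int[mu]_x `|h x|)) => //.
- by move=> s; exact: (summable_funZ (g s) (summable_shiftl (- (u * s)) sh)).
- move=> s; have sh' := summable_norm (summable_shiftl (- (u * s)) sh).
  have -> : \int[mu]_b `|F (b, s)| = `|g s| * \int[mu]_b `|h (b - u * s)|.
    rewrite -RintegralZl//; apply: eq_Rintegral => b _; exact: normrM.
  rewrite ler_wpM2l//.
  rewrite (@Rintegral_shiftl (fun x => `|h x|) (- (u * s)))//.
  by apply: measurableT_comp => //; exact: (summable_meas sh).
- by under eq_fun do rewrite mulrC; apply: summable_funZ; exact: summable_norm.
Qed.

(** Young's inequality for L^1 functions, with the frequency u in the argument: the bound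
    does not depend on u, since for fixed s the variable b is only translated. *)
Lemma integral_convolution_le :
  \int[mu]_b `|\int[mu]_s (g s * h (b - u * s))| <=
  (\int[mu]_s `|g s|) * \int[mu]_s `|h s|.
Proof.
have sN := summable_norm summable_convolution.
have -> : (\int[mu]_s `|g s|) * \int[mu]_s `|h s| =
    \int[mu]_b \int[mu]_s `|F (b, s)|.
  rewrite (Rfubini sN) -RintegralZr//; last exact: summable_norm.
  apply: eq_Rintegral => s _; rewrite -RintegralZl//; last exact: summable_norm.
  rewrite -(@Rintegral_shiftl (fun x => `|g s| * `|h x|) (- (u * s))).
    by apply: eq_Rintegral => b _; rewrite normrM.
  by apply: measurable_funM => //; apply: measurableT_comp => //; exact: (summable_meas sh).
have sC := summable_Rintegral_r summable_convolution.
apply: le_trans (_ : \int[mu]_b `|\int[mu]_s F (b, s)| <= _) => //.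
have mN b : measurable_fun setT (fun s => F (b, s)).
  exact: (measurableT_comp mF (pair1_measurable b)).
rewrite -lee_fin !EFin_Rintegral//; last 2 first.
- exact: (summable_Rintegral_r sN).
- exact: summable_norm.
have h1 := summable_ae_r summable_convolution.
apply: ae_ge0_le_integral => //=.
- by apply/measurable_EFinP; apply: measurableT_comp => //; exact: (summable_meas sC).
- by move=> b _; rewrite lee_fin; apply: Rintegral_ge0.
- by apply/measurable_EFinP; exact: (summable_meas (summable_Rintegral_r sN)).
- by apply: filterS h1 => b sb _; rewrite lee_fin; exact: le_normr_Rintegral.
Qed.

End convolution_bound.

Section profile_kernel.
Context {R : realType}.
Notation mu := (@lebesgue_measure R).
Variables (a1 a2 : R).
Hypotheses (a10 : 0 < a1) (a20 : 0 < a2).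

(** Taking the difference of two scales makes the second primitive
    [profile_primitive2] integrable, since the two logarithms have the same growth. A single
    scale would not do. *)
Definition profile_kernel (r : R) : R := dconj_poisson a1 r - dconj_poisson a2 r.
Definition profile_primitive (r : R) : R := conj_poisson a1 r - conj_poisson a2 r.
Definition profile_primitive2 (r : R) : R := hln a1 r - hln a2 r.

Notation k := profile_kernel.
Notation Q := profile_primitive.
Notation Th := profile_primitive2.

Lemma der_profile_primitive r : der Q r (k r).
Proof. by apply: derD; [|apply: derN]; exact: der_conj_poisson. Qed.

Lemma der_profile_primitive2 r : der Th r (Q r).
Proof. by apply: derD; [|apply: derN]; exact: der_hln. Qed.

Lemma cont_profile_kernel : continuous k.
Proof. by move=> r; apply: cvgB; exact: cont_dconj_poisson. Qed.

Lemma cont_profile_primitive2 : continuous Th.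
Proof. by apply: cont_der => r; eexists; exact: der_profile_primitive2. Qed.

Lemma profile_kernelN r : k (- r) = k r.
Proof. by rewrite /k /dconj_poisson sqrrN. Qed.

Definition profile_kernel_bound : R := a1^-1 * a1^-1 + a2^-1 * a2^-1.

Lemma profile_kernel_le r : `|k r| <= profile_kernel_bound.
Proof.
apply: le_trans (ler_normB _ _) _; apply: lerD.
- apply: le_trans (dconj_poisson_le r a10) _.
  by rewrite ler_wpM2l ?invr_ge0 ?(ltW a10)// poisson_le.
- apply: le_trans (dconj_poisson_le r a20) _.
  by rewrite ler_wpM2l ?invr_ge0 ?(ltW a20)// poisson_le.
Qed.

Lemma summable_profile_kernel : summable_fun mu k.
Proof.
have h a : 0 < a -> summable_fun mu (dconj_poisson a).
  move=> a0; apply: (@le_summable _ _ R mu (dconj_poisson a) _ _ (fun r => dconj_poisson_le r a0)).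
    exact: (cont_meas (cont_dconj_poisson a0)).
  by apply: summable_funZ; exact: summable_poisson.
exact: (summable_funB (h _ a10) (h _ a20)).
Qed.

Lemma profile_primitive2_le r : `|Th r| <=
  `|a1 ^+ 2 - a2 ^+ 2| / 2 * (a1^-1 * poisson a1 r + a2^-1 * poisson a2 r).
Proof.
rewrite /Th /hln -mulrBl normrM (gtr0_norm (_ : 0 < 2^-1 :> R)) ?invr_gt0//.
rewrite mulrAC ler_pM2r ?invr_gt0//.
have := ln_diff_le (den_gt0 r a10) (den_gt0 r a20).
rewrite /poisson !mulKf ?gt_eqF// (_ : _ - (a2 ^+ 2 + _) = a1 ^+ 2 - a2 ^+ 2)//; ring.
Qed.

Definition profile_primitive2_bound : R :=
  `|a1 ^+ 2 - a2 ^+ 2| / 2 * (a1^-1 * a1^-1 + a2^-1 * a2^-1).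

Lemma profile_primitive2_le_bound r : `|Th r| <= profile_primitive2_bound.
Proof.
apply: le_trans (profile_primitive2_le r) _.
rewrite ler_wpM2l ?divr_ge0//; apply: lerD.
  by rewrite ler_wpM2l ?invr_ge0 ?(ltW a10)// poisson_le.
by rewrite ler_wpM2l ?invr_ge0 ?(ltW a20)// poisson_le.
Qed.

Lemma summable_profile_primitive2 : summable_fun mu Th.
Proof.
apply: (@le_summable _ _ R mu Th _ _ profile_primitive2_le).
  exact: (cont_meas cont_profile_primitive2).
apply: summable_funZ; apply: summable_funD; apply: summable_funZ; exact: summable_poisson.
Qed.

End profile_kernel.

Section compact_support.
Context {R : realType}.
Notation mu := (@lebesgue_measure R).
Variables (f : R -> R) (L B : R).
Hypotheses (mf : measurable_fun setT f) (L0 : 0 <= L).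
Hypotheses (f0 : forall s, L <= `|s| -> f s = 0) (fB : forall s, `|f s| <= B).

Let B0 : 0 <= B. Proof. exact: le_trans (fB 0). Qed.

Let sI : summable_fun mu (\1_`[- L, L] : R -> R).
Proof.
exact: (integrable_indic_itv (- L) L true false).
Qed.

Let fI s : `|f s| <= B * \1_`[- L, L] s.
Proof.
rewrite indicE; case: (boolP (s \in _)) => [_|]; first by rewrite mulr1.
rewrite notin_setE/= in_itv/= -ler_norml => /negP; rewrite -ltNge => /ltW h.
by rewrite f0// normr0 mulr0.
Qed.

Lemma summable_support : summable_fun mu f.
Proof. by apply: (@le_summable _ _ R mu f _ mf fI); exact: summable_funZ. Qed.

Lemma integral_support_le : \int[mu]_s `|f s| <= B * (2 * L).
Proof.
apply: le_trans (_ : \int[mu]_s (B * \1_`[- L, L] s) <= _).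
  apply: le_Rintegral => //; first exact: (summable_norm summable_support).
  exact: (summable_funZ B sI).
rewrite (RintegralZl _ _ sI)// ler_wpM2l//.
rewrite /Rintegral integral_indic//= setIT lebesgue_measure_itv/= lte_fin.
case: ifP => _ /=; last by rewrite mulr_ge0.
by rewrite opprK mulr_natl mulr2n.
Qed.

End compact_support.

Section profile_transform.
Context {R : realType}.
Notation mu := (@lebesgue_measure R).
Variables (a1 a2 : R).
Hypotheses (a10 : 0 < a1) (a20 : 0 < a2).
Notation k := (profile_kernel a1 a2).
Notation Q := (profile_primitive a1 a2).
Notation Th := (profile_primitive2 a1 a2).

(** A continuous ridgelet-type transform in which k analyses H at scale 1/u. *)
Definition profile_transform (H : R -> R) (u b : R) : R :=
  \int[mu]_s (H s * k (b - u * s)).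

Variables (H H1 H2 : R -> R) (L : R).
Hypotheses (dH : forall s, der H s (H1 s)) (dH1 : forall s, der H1 s (H2 s)).
Hypotheses (cH2 : continuous H2) (sH : summable_fun mu H) (sH2 : summable_fun mu H2).
Hypotheses (H0 : forall s, L <= `|s| -> H s = 0) (H10 : forall s, L <= `|s| -> H1 s = 0).

Notation A := (profile_transform H).

Let cH : continuous H.
Proof. by apply: cont_der => s; eexists; exact: dH. Qed.

Let mk : measurable_fun setT k.
Proof. exact: (cont_meas (cont_profile_kernel a10 a20)). Qed.

Let mTh : measurable_fun setT Th.
Proof. exact: (cont_meas (cont_profile_primitive2 a10 a20)). Qed.

Let measurable_translate (u b : R) : measurable_fun [set: R] (fun s : R => b - u * s).
Proof. by apply: measurable_funB => //; apply: measurable_funM. Qed.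

Let summable_mul (g h : R -> R) (C u b : R) : measurable_fun setT h ->
  (forall r, `|h r| <= C) -> summable_fun mu g ->
  summable_fun mu (fun s => g s * h (b - u * s)).
Proof.
move=> mh hC sg.
apply: (@le_summable _ _ R mu (fun s => g s * h (b - u * s)) (fun s => C * `|g s|)).
- apply: measurable_funM; first exact: (summable_meas sg).
  exact: (measurableT_comp mh (measurable_translate u b)).
- by move=> s; rewrite normrM mulrC ler_wpM2r.
- exact: (summable_funZ C (summable_norm sg)).
Qed.

Let sHk u b : summable_fun mu (fun s => H s * k (b - u * s)).
Proof. exact: summable_mul mk (profile_kernel_le a10 a20) sH. Qed.

Let sH2Th u b : summable_fun mu (fun s => H2 s * Th (b - u * s)).
Proof. exact: summable_mul mTh (profile_primitive2_le_bound a10 a20) sH2. Qed.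

(** Two integrations by parts in s. The boundary terms vanish because H and H' vanish
    outside of [-L, L]. *)
Lemma profile_transform_ibp u b :
  u ^+ 2 * A u b = \int[mu]_s (H2 s * Th (b - u * s)).
Proof.
have sZ := summable_funZ (u ^+ 2) (sHk u b).
suff E : \int[mu]_s (H2 s * Th (b - u * s) - u ^+ 2 * (H s * k (b - u * s))) = 0.
  move: E; rewrite (RintegralB measurableT (sH2Th u b) sZ) (RintegralZl _ measurableT (sHk u b)).
  by move/eqP; rewrite subr_eq0 => /eqP <-.
pose F s := H s * (u * Q (b - u * s)) + H1 s * Th (b - u * s).
have dl s : der (fun s => b - u * s) s (- u) by der_auto => //=; ring.
have dQ s : der (fun s => Q (b - u * s)) s (k (b - u * s) * - u).
  by apply: (der_comp (f := fun s => b - u * s)) => //; exact: der_profile_primitive.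
have dT s : der (fun s => Th (b - u * s)) s (Q (b - u * s) * - u).
  by apply: (der_comp (f := fun s => b - u * s)) => //; exact: der_profile_primitive2.
apply: (@FTC_line _ F).
- exact: (summable_funB (sH2Th u b) (summable_funZ (u ^+ 2) (sHk u b))).
- move=> s; rewrite /F; apply: der_eq.
    apply: derD; apply: derM; [exact: dH| |exact: dH1|exact: dT].
    by apply: derM; [exact: der_cst|exact: dQ].
  by rewrite /=; ring.
- have cl : continuous (fun s : R => b - u * s).
    by apply: cont_der => s; eexists; exact: dl.
  apply: contB; apply: contM => //; last (apply: contM => //).
  + exact: cont_comp cl (cont_profile_primitive2 a10 a20).
  + exact: cont_cst.
  + exact: cont_comp cl (cont_profile_kernel a10 a20).
- apply: cvg_near_cst; near=> n.
  have Ln : L <= n%:R by near: n; exact: nbhs_infty_ger.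
  by rewrite /F !H0 ?H10 ?normrN ?ger0_norm// !mul0r !addr0 subrr.
Unshelve. all: by end_near. Qed.

Definition transform_bound : R :=
  (\int[mu]_s `|H s|) * profile_kernel_bound a1 a2 +
  (\int[mu]_s `|H2 s|) * profile_primitive2_bound a1 a2.

Definition transform_mass : R :=
  (\int[mu]_s `|H s|) * (\int[mu]_s `|k s|) +
  (\int[mu]_s `|H2 s|) * (\int[mu]_s `|Th s|).

Let abs_le (g h : R -> R) C u b : measurable_fun setT h ->
  (forall r, `|h r| <= C) -> summable_fun mu g ->
  `|\int[mu]_s (g s * h (b - u * s))| <= (\int[mu]_s `|g s|) * C.
Proof.
move=> mh hC sg; rewrite mulrC -RintegralZl//; last exact: summable_norm.
apply: norm_Rintegral_le.
- exact: (summable_funZ C (summable_norm sg)).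
- exact: (summable_meas (summable_mul u b mh hC sg)).
- by move=> s; rewrite normrM mulrC ler_wpM2r.
Qed.

(** For small u the kernel itself is bounded; for large u the two integrations by parts
    give a factor u^-2. Adding the two estimates produces the weight 1 + u^2. *)
Lemma profile_transform_le u b : `|A u b| <= transform_bound * (1 + u ^+ 2)^-1.
Proof.
rewrite ler_pdivlMr ?ltr_pwDl ?sqr_ge0// mulrDr mulr1.
apply: lerD; first exact: abs_le mk (profile_kernel_le a10 a20) sH.
rewrite mulrC -(ger0_norm (sqr_ge0 u)) -normrM profile_transform_ibp.
exact: abs_le mTh (profile_primitive2_le_bound a10 a20) sH2.
Qed.

Lemma summable_profile_transform u : summable_fun mu (A u).
Proof.
exact: (summable_Rintegral_r (summable_convolution u sH (summable_profile_kernel a10 a20))).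
Qed.

Lemma integral_profile_transform_le u :
  \int[mu]_b `|A u b| <= transform_mass * (1 + u ^+ 2)^-1.
Proof.
rewrite ler_pdivlMr ?ltr_pwDl ?sqr_ge0// mulrDr mulr1.
apply: lerD.
  exact: (integral_convolution_le u sH (summable_profile_kernel a10 a20)).
rewrite mulrC -RintegralZl//; last exact: (summable_norm (summable_profile_transform u)).
apply: le_trans (integral_convolution_le u sH2 (summable_profile_primitive2 a10 a20)).
rewrite le_eqVlt; apply/orP; left; apply/eqP/eq_Rintegral => b _.
by rewrite -profile_transform_ibp normrM ger0_norm ?sqr_ge0.
Qed.

End profile_transform.

(** * The reproducing formula on the line *)

Section reproducing_formula.
Context {R : realType}.
Notation mu := (@lebesgue_measure R).
Variables (a1 a2 : R).
Hypotheses (a10 : 0 < a1) (a20 : 0 < a2).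
Notation k := (profile_kernel a1 a2).
Notation Q := (profile_primitive a1 a2).

Variables (H : R -> R) (B : R).
Hypotheses (cH : continuous H) (sH : summable_fun mu H).
Hypothesis HB : forall s, `|H s| <= B.

Notation A := (profile_transform a1 a2 H).

Let mk : measurable_fun setT k.
Proof. exact: (cont_meas (cont_profile_kernel a10 a20)). Qed.

Lemma measurable_profile_transform :
  measurable_fun setT (fun z : measurableTypeR R * measurableTypeR R => A z.1 z.2).
Proof.
apply: (measurable_Rintegral_r mu (f := fun w : (measurableTypeR R * measurableTypeR R) * measurableTypeR R =>
  H w.2 * k (w.1.2 - w.1.1 * w.2))).
apply: measurable_funM.
  by apply: measurableT_comp => //; exact: (cont_meas cH).
apply: measurableT_comp => //; apply: measurable_funB.
  by apply: measurableT_comp => //; exact: measurable_snd.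
by apply: measurable_funM => //; apply: measurableT_comp => //; exact: measurable_fst.
Qed.

Variables (C s0 b : R).
Hypothesis AC : forall u b, `|A u b| <= C * (1 + u ^+ 2)^-1.

Let g (u : R) := A u (u * s0 - b).

Let mg : measurable_fun setT (g : measurableTypeR R -> R).
Proof.
have h : measurable_fun setT (fun u : measurableTypeR R => (u, u * s0 - b) : measurableTypeR R * measurableTypeR R).
  by apply: measurable_fun_pair => //; apply: measurable_funB => //; apply: measurable_funM.
exact: (measurableT_comp measurable_profile_transform h).
Qed.

Let sg : summable_fun mu g.
Proof.
apply: (@le_summable _ _ R mu g _ mg (fun u => AC u (u * s0 - b))).
by apply: summable_funZ; exact: summable_cauchy.
Qed.

Let M (t : R) : R := hilbert_kernel a1 b t - hilbert_kernel a2 b t.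

Let sM : summable_fun mu M.
Proof.
exact: (summable_funB (summable_hilbert_kernel b a10) (summable_hilbert_kernel b a20)).
Qed.

Let mM : measurable_fun setT M. Proof. exact: (summable_meas sM). Qed.

Let gE u : g u = \int[mu]_s (H s * k (b + u * (s - s0))).
Proof.
apply: eq_Rintegral => s _; congr (_ * _).
by rewrite -profile_kernelN; congr k; ring.
Qed.

(** After integrating in u, the primitive of k at b + ny and b - ny gives the difference
    quotient that [hilbert_kernel] stands for. For y = 0 the integrand does not
    depend on u, and the closed form of that kernel still gives the value. *)
Let truncated_kernel (n : nat) (y : R) : (0 < n)%N ->
  \int[mu]_(u in `[- n%:R, n%:R]) k (b + u * y) = n%:R * M (n%:R * y).
Proof.
move=> n0; have nn : - n%:R < n%:R :> R by rewrite gtrN// ltr0n.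
have dl u : der (fun u => b + u * y) u y by der_auto => //=; ring.
have cl : continuous (fun u : R => b + u * y) by apply: cont_der => u; eexists; exact: dl.
have ck := cont_comp cl (cont_profile_kernel a10 a20).
have [y0|y0] := eqVneq y 0.
  have dF u : der (fun u => k b * u) u (k (b + u * y)).
    by rewrite y0 mulr0 addr0; der_auto; rewrite mulr1 mulr0 addr0.
  rewrite (FTC_seg nn dF ck) y0 /= mulr0.
  rewrite /M /hilbert_kernel /profile_kernel /dconj_poisson !addr0 !subr0.
  have d1 := den_neq0 b a10; have d2 := den_neq0 b a20.
  by field; rewrite d1 d2.
have dF u : der (fun u => Q (b + u * y) * y^-1) u (k (b + u * y)).
  apply: der_eq.
    apply: derM; last exact: der_cst.
    by apply: (der_comp (f := fun u => b + u * y)); [exact: der_profile_primitive|exact: dl].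
  by rewrite mulr0 add0r; field.
rewrite (FTC_seg nn dF ck).
rewrite /M /profile_primitive mulNr.
have h a (a0 : 0 < a) := hilbert_kernelE b a0 (n%:R * y).
have h1 := h _ a10; have h2 := h _ a20; move: h1 h2.
set q1 := conj_poisson a1 _; set q2 := conj_poisson a1 _; set q3 := conj_poisson a2 _.
set q4 := conj_poisson a2 _ => h1 h2.
rewrite (_ : (q1 - q3) * y^-1 - (q2 - q4) * y^-1 = (q1 - q2 - (q3 - q4)) * y^-1); last by ring.
by rewrite h1 h2; field.
Qed.

(** The integral over [-n, n] is a convolution of H with the dilated kernel n M(n .); the
    substitution s = s0 + t/n moves the dilation to H. *)
Let truncated (n : nat) : (0 < n)%N ->
  \int[mu]_(u in `[- n%:R, n%:R]) g u = \int[mu]_t (H (s0 + n%:R^-1 * t) * M t).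
Proof.
move=> n0; set I := `[- n%:R, n%:R]%classic.
have n0' : n%:R != 0 :> R by rewrite pnatr_eq0 -lt0n.
pose F (z : measurableTypeR R * measurableTypeR R) : R :=
  \1_I z.1 * (H z.2 * k (b + z.1 * (z.2 - s0))).
have mI : measurable I by exact: measurable_itv.
have mF : measurable_fun setT F.
  apply: measurable_funM; first by apply: measurableT_comp => //; exact: measurable_indic.
  apply: measurable_funM; first by apply: measurableT_comp => //; exact: (cont_meas cH).
  apply: measurableT_comp => //; apply: measurable_funD => //.
  by apply: measurable_funM => //; apply: measurable_funB.
have sI : summable_fun mu (\1_I : R -> R) := integrable_indic_itv (- n%:R) n%:R true false.
pose K := profile_kernel_bound a1 a2.
have Fle z : `|F z| <= \1_I z.1 * (K * `|H z.2|).
  rewrite /F normrM ger0_norm ?indic_ge0// ler_wpM2l ?indic_ge0// normrM mulrC.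
  by rewrite ler_wpM2r// profile_kernel_le.
have sK : summable_fun mu (fun s => K * `|H s|) := summable_funZ K (summable_norm sH).
have sFu u : summable_fun mu (fun s => F (u, s)).
  apply: (@le_summable _ _ R mu _ (fun s => \1_I u * (K * `|H s|))).
  - exact: (measurableT_comp mF (pair1_measurable u)).
  - by move=> s; exact: Fle (u, s).
  - exact: summable_funZ.
have sF : summable_fun (mu \x mu)%E F.
  apply: (@summable_prod _ _ _ _ R mu mu F (fun u => \1_I u * (K * \int[mu]_s `|H s|))) => //.
  - move=> u; rewrite -(RintegralZl _ measurableT (summable_norm sH)).
    rewrite -(RintegralZl _ measurableT sK); apply: le_Rintegral => //.
    + exact: (summable_norm (sFu u)).
    + exact: (summable_funZ (\1_I u) sK).
  - rewrite (_ : (fun u => _) = (fun u => (K * \int[mu]_s `|H s|) * \1_I u)).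
      exact: (summable_funZ _ sI).
    by apply/funext => u; rewrite mulrC.
have sHk u : summable_fun mu (fun s => H s * k (b + u * (s - s0))).
  apply: (@le_summable _ _ R mu _ (fun s => K * `|H s|)) => //.
  - apply: measurable_funM; first exact: (cont_meas cH).
    apply: measurableT_comp => //; apply: measurable_funD => //.
    by apply: measurable_funM => //; apply: measurable_funB.
  - by move=> s; rewrite normrM mulrC ler_wpM2r// profile_kernel_le.
transitivity (\int[mu]_u \int[mu]_s F (u, s)).
  rewrite Rintegral_mkcond; apply: eq_Rintegral => u _.
  transitivity (\1_I u * g u); last by rewrite gE -(RintegralZl _ measurableT (sHk u)).
  by rewrite patchE indicE; case: ifP => _; rewrite ?mul1r ?mul0r.
rewrite (Rfubini sF).
have mG : measurable_fun setT (fun s => \int[mu]_u F (u, s)).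
  exact: (measurable_Rintegral_l mu mF).
rewrite -(@Rintegral_affine R s0 n%:R^-1 _ _ mG) ?invr_eq0//.
have n0'' : 0 < n%:R^-1 :> R by rewrite invr_gt0 ltr0n.
rewrite gtr0_norm// -RintegralZl//; last first.
  exact: (@summable_affine _ s0 n%:R^-1 _ (invr_neq0 n0') (summable_Rintegral_l sF)).
apply: eq_Rintegral => t _.
set s := s0 + n%:R^-1 * t.
have -> : \int[mu]_u F (u, s) = H s * \int[mu]_(u in I) k (b + u * (s - s0)).
  rewrite [in RHS]Rintegral_mkcond -RintegralZl//; last first.
    have ck : continuous (fun u : R => k (b + u * (s - s0))).
      apply: (cont_comp (f := fun u => b + u * (s - s0))).
        by apply: contD; [exact: cont_cst|apply: contM; [by move=> x; exact: cvg_id|exact: cont_cst]].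
      exact: (cont_profile_kernel a10 a20).
    apply: (@le_summable _ _ R mu _ (fun u => K * \1_I u)).
    - apply: (measurable_restrictT _ _).1 => //.
      exact: (measurable_funS measurableT _ (cont_meas ck)).
    - move=> u; rewrite patchE indicE; case: ifP => _; last by rewrite normr0 mulr0.
      by rewrite mulr1 profile_kernel_le.
    - exact: summable_funZ.
  apply: eq_Rintegral => u _; rewrite /F patchE indicE /=.
  by case: ifP => _; rewrite ?mul1r ?mul0r ?mulr0.
rewrite truncated_kernel//.
have -> : n%:R * (s - s0) = t by rewrite /s; field.
by field.
Qed.

(** As n grows, H(s0 + t/n) tends to H(s0), and only the mass of M remains. The decay
    hypothesis on A makes the improper integral over u an absolutely convergent one. *)
Lemma integral_profile_transform :
  \int[mu]_u A u (u * s0 - b) = 2 * pi * (poisson a1 b - poisson a2 b) * H s0.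
Proof.
have h1 := cvg_Rintegral_line sg.
have h2 : \int[mu]_t (H (s0 + n%:R^-1 * t) * M t) @[n --> \oo] --> \int[mu]_t (H s0 * M t).
  apply: (@dominated_Rintegral _ _ R mu (fun n t => H (s0 + n%:R^-1 * t) * M t)
    (fun t => H s0 * M t) (fun t => B * `|M t|)).
  - move=> n; apply: measurable_funM => //.
    apply: measurableT_comp; first exact: (cont_meas cH).
    by apply: measurable_funD => //; apply: measurable_funM.
  - exact: measurable_funM.
  - apply: aeW => t /=; apply: cvgM; last exact: cvg_cst.
    have h : s0 + n%:R^-1 * t @[n --> \oo] --> s0.
      rewrite -[X in _ --> X]addr0 -(mul0r t); apply: cvgD; first exact: cvg_cst.
      apply: cvgM; last exact: cvg_cst.
      apply/(@gtr0_cvgV0 _ _ _ _ (fun n : nat => n%:R : R)); last exact: cvgr_idn.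
      by near=> n; rewrite ltr0n; near: n; exact: nbhs_infty_gt.
    by apply: continuous_cvg; [exact: cH|exact: h].
  - exact: (summable_funZ B (summable_norm sM)).
  - by move=> n t; rewrite normrM ler_wpM2r.
have h3 : \int[mu]_(u in `[- n%:R, n%:R]) g u @[n --> \oo] --> \int[mu]_t (H s0 * M t).
  apply: cvg_trans h2; apply: near_eq_cvg; near=> n.
  by rewrite truncated//; near: n; exact: nbhs_infty_gt.
rewrite -[LHS]/(\int[mu]_u g u) (cvg_unique _ h1 h3)//.
rewrite RintegralZl// RintegralB//; last 2 first.
- exact: summable_hilbert_kernel.
- exact: summable_hilbert_kernel.
by rewrite !integral_hilbert_kernel//; ring.
Unshelve. all: by end_near. Qed.

End reproducing_formula.

Section poisson_nonconstant.
Context {R : realType}.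
Notation mu := (@lebesgue_measure R).

Lemma integral_poisson (a : R) : 0 < a -> \int[mu]_r poisson a r = pi.
Proof.
move=> a0; have an0 : a^-1 != 0 by rewrite invr_neq0// gt_eqF.
have := @Rintegral_affine R 0 a^-1 (fun r => (1 + r ^+ 2)^-1) an0
  (summable_meas summable_cauchy).
rewrite integral_cauchy => <-; rewrite gtr0_norm ?invr_gt0//.
rewrite -RintegralZl//; last exact: (@summable_affine R 0 a^-1 _ an0 summable_cauchy).
by apply: eq_Rintegral => r _; rewrite poissonE.
Qed.

(** At height a the Poisson kernel varies on the scale a, whence the factor 1/a. *)
Lemma poisson_shift_le (a h t : R) : 0 < a ->
  `|poisson a (t + h) - poisson a t| <= `|h| * (1 + `|h| / a) / a * poisson a (t + h).
Proof.
move=> a0; have an0 : a != 0 by rewrite gt_eqF.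
have dt := den_gt0 t a0; have dh := den_gt0 (t + h) a0.
have -> : poisson a (t + h) - poisson a t =
    - h * (a * (2 * t + h)) / ((a ^+ 2 + (t + h) ^+ 2) * (a ^+ 2 + t ^+ 2)).
  by rewrite /poisson; field; rewrite !gt_eqF.
have hle : `|a * (2 * t + h)| <= (1 + `|h| / a) * (a ^+ 2 + t ^+ 2).
  rewrite (_ : a * (2 * t + h) = a * (2 * t) + a * h); last by ring.
  rewrite (_ : (1 + `|h| / a) * _ = (a ^+ 2 + t ^+ 2) + `|h| / a * (a ^+ 2 + t ^+ 2)); last by ring.
  apply: le_trans (ler_normD _ _) _; apply: lerD.
    rewrite ler_norml; have := sqr_ge0 (a - t); have := sqr_ge0 (a + t) => h1 h2.
    by apply/andP; split; lra.
  rewrite normrM gtr0_norm// (_ : `|h| / a * _ = a * `|h| + `|h| / a * t ^+ 2); last by field.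
  by rewrite lerDl mulr_ge0 ?sqr_ge0 ?divr_ge0// ltW.
rewrite 2!normrM normrN normfV (gtr0_norm (mulr_gt0 dh dt)) ler_pdivrMr ?mulr_gt0//.
rewrite /poisson (_ : _ * (_ * _) = `|h| * ((1 + `|h| / a) * (a ^+ 2 + t ^+ 2))); last first.
  by field; rewrite an0 gt_eqF.
by rewrite ler_wpM2l.
Qed.

Variables (f : R -> R) (M : R).
Hypotheses (cf : continuous f) (fM : forall x, `|f x| <= M).

Let mf : measurable_fun setT f. Proof. exact: cont_meas. Qed.

(** The Poisson extension of f at height a, up to the factor pi. *)
Let U (a y : R) := \int[mu]_r (f (r + y) * poisson a r).

Let sU a y : 0 < a -> summable_fun mu (fun r => f (r + y) * poisson a r).
Proof.
move=> a0; apply: (@summable_funM _ _ R mu (poisson a) (fun r => f (r + y)) M) => //.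
- by apply: (measurableT_comp mf); apply: measurable_funD.
- exact: summable_poisson.
Qed.

Let U_dilate a y : 0 < a -> U a y = \int[mu]_r (f (a * r + y) * (1 + r ^+ 2)^-1).
Proof.
move=> a0; have an0 : a != 0 by rewrite gt_eqF.
rewrite /U -(@Rintegral_affine R 0 a _ an0 (summable_meas (sU y a0))) gtr0_norm//.
rewrite -RintegralZl//; last exact: (@summable_affine R 0 a _ an0 (sU y a0)).
apply: eq_Rintegral => r _; rewrite add0r mulrCA; congr (_ * _).
have dr := den_neq0 (a * r) a0; have d1 : 1 + r ^+ 2 != 0.
  by rewrite gt_eqF// ltr_pwDl// sqr_ge0.
rewrite /poisson; field; rewrite d1 /=.
by move: dr; rewrite exprMn.
Qed.

(** After the dilation r -> a r, f(a r + y) tends to f(y). *)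
Let U_small y : U (n.+1%:R^-1) y @[n --> \oo] --> f y * pi.
Proof.
under eq_fun do rewrite U_dilate ?invr_gt0//.
have -> : f y * pi = \int[mu]_r (f y * (1 + r ^+ 2)^-1).
  by rewrite (RintegralZl _ measurableT summable_cauchy) integral_cauchy.
have sc := @summable_cauchy R.
apply: (@dominated_Rintegral _ _ R mu (fun n r => f (n.+1%:R^-1 * r + y) * (1 + r ^+ 2)^-1)
  (fun r => f y * (1 + r ^+ 2)^-1) (fun r => M * (1 + r ^+ 2)^-1)).
- move=> n; apply: measurable_funM; last exact: (summable_meas sc).
  by apply: (measurableT_comp mf); apply: measurable_funD => //; apply: measurable_funM.
- by apply: measurable_funM => //; exact: (summable_meas sc).
- apply: aeW => r /=; apply: cvgM; last exact: cvg_cst.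
  apply: continuous_cvg; first exact: cf.
  rewrite -[X in _ --> X]add0r; apply: cvgD; last exact: cvg_cst.
  rewrite -(mul0r r); apply: cvgM; last exact: cvg_cst.
  exact: cvg_harmonic.
- exact: summable_funZ.
- move=> n r; rewrite normrM [X in _ * X]ger0_norm ?invr_ge0 ?addr_ge0 ?sqr_ge0//.
  by rewrite ler_wpM2r// invr_ge0 addr_ge0 ?sqr_ge0.
Qed.

(** The horizontal oscillation of the Poisson extension at height a is O(1/a). *)
Let U_large a y z : 1 <= a -> `|U a y - U a z| <= M * (`|z - y| * (1 + `|z - y|) / a * pi).
Proof.
move=> a1; have a0 : 0 < a by exact: lt_le_trans a1.
have M0 : 0 <= M by exact: le_trans (fM 0).
set h := z - y.
have sp := @summable_poisson R a a0.
have e y' : U a y' = \int[mu]_r (f r * poisson a (r - y')).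
  rewrite /U -(@Rintegral_shiftl _ (fun r => f r * poisson a (r - y')) y').
    by apply: eq_Rintegral => r _; rewrite addrK.
  apply: measurable_funM => //; apply: (measurableT_comp (summable_meas sp)).
  exact: measurable_funB.
have s' y' : summable_fun mu (fun r => f r * poisson a (r - y')).
  by apply: (@summable_funM _ _ R mu (fun r => poisson a (r - y')) f M) => //; exact: (summable_shiftl (- y') sp).
rewrite !e -(RintegralB measurableT (s' y) (s' z)).
set C := `|h| * (1 + `|h|) / a.
have sC : summable_fun mu (fun r => M * (C * poisson a (r - y))).
  by apply: summable_funZ; apply: summable_funZ; exact: (summable_shiftl (- y) sp).
apply: le_trans (norm_Rintegral_le sC (summable_meas (summable_funB (s' y) (s' z))) _) _.
  move=> r /=; rewrite -mulrBr normrM ler_pM//.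
  have := @poisson_shift_le a h (r - z) a0; rewrite (_ : r - z + h = r - y); last by rewrite /h; ring.
  move=> /le_trans; apply; rewrite ler_wpM2r ?poisson_ge0// /C.
  rewrite ler_wpM2r ?invr_ge0 ?(ltW a0)// ler_wpM2l// lerD2l ler_pdivrMr//.
  by rewrite ler_peMr.
have sp' := summable_shiftl (- y) sp.
rewrite (RintegralZl _ measurableT (summable_funZ C sp')) (RintegralZl _ measurableT sp').
by rewrite (Rintegral_shiftl (- y) (summable_meas sp)) integral_poisson.
Qed.

(** If all these integrals vanished, the Poisson extension would be the same at every
    height. Its limit at height 0 is f, and its oscillation tends to 0 at great height, so f
    would be constant. *)
Lemma poisson_separates : (exists x y, f x != f y) -> exists a1 a2 y : R,
  [/\ 0 < a1, 0 < a2 & \int[mu]_r (f (r + y) * (poisson a1 r - poisson a2 r)) != 0].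
Proof.
move=> [x [z fxz]]; apply: contrapT => /forallNP h.
have Ueq a y : 0 < a -> U a y = U 1 y.
  move=> a0; have /forallNP/(_ 1)/forallNP/(_ y) := h a.
  move=> hN; apply: contrapT => UN; apply: hN; split => //.
  apply/eqP; under eq_Rintegral do rewrite mulrBr.
  by rewrite (RintegralB measurableT (sU y a0) (sU y ltr01)) => /eqP; rewrite subr_eq0 => /eqP.
have fE y : f y * pi = U 1 y.
  have hc : U (n.+1%:R^-1) y @[n --> \oo] --> U 1 y.
    rewrite (_ : (fun n => U (n.+1%:R^-1) y) = fun=> U 1 y); first exact: cvg_cst.
    by apply/funext => n; rewrite Ueq// invr_gt0.
  exact: (cvg_unique _ (@U_small y) hc).
set K := M * (`|z - x| * (1 + `|z - x|) * pi).
have hK a : 1 <= a -> `|f x - f z| * pi <= K / a.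
  move=> a1; have a0 : 0 < a by exact: lt_le_trans a1.
  have := @U_large a x z a1; rewrite !Ueq// -!fE -mulrBl normrM (gtr0_norm (pi_gt0 R)).
  by move=> /le_trans; apply; rewrite /K; lra.
have d0 : 0 < `|f x - f z| * pi by rewrite mulr_gt0 ?pi_gt0// normr_gt0 subr_eq0.
have K0 : 0 <= K by have := hK 1 (lexx _); rewrite divr1; apply: le_trans; exact: ltW.
move: d0 hK; set D := _ * pi => d0 hK.
have q0 : 0 <= K / D by rewrite divr_ge0// ltW.
(* a height at which the bound K / a is already smaller than D *)
have := hK (1 + K / D); rewrite lerDl q0 => /(_ isT).
rewrite ler_pdivlMr ?ltr_pwDl// mulrDr mulr1 mulrCA divff ?gt_eqF// mulr1; lra.
Qed.

End poisson_nonconstant.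

Section ridge_reproduction.
Context {R : realType}.
Notation mu := (@lebesgue_measure R).
Variables (a1 a2 : R).
Hypotheses (a10 : 0 < a1) (a20 : 0 < a2).
Variables (H f : R -> R) (B M C C' : R).
Hypotheses (cH : continuous H) (sH : summable_fun mu H).
Hypothesis HB : forall s, `|H s| <= B.
Hypotheses (mf : measurable_fun setT f) (fM : forall x, `|f x| <= M).

Notation A := (profile_transform a1 a2 H).
Hypothesis AC : forall u b, `|A u b| <= C * (1 + u ^+ 2)^-1.
Hypothesis sA : forall u, summable_fun mu (A u).
Hypothesis AC' : forall u, \int[mu]_b `|A u b| <= C' * (1 + u ^+ 2)^-1.

Variable s0 : R.

Let F (z : measurableTypeR R * measurableTypeR R) : R := f z.2 * A z.1 (z.1 * s0 - z.2).

Let mF : measurable_fun setT F.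
Proof.
apply: measurable_funM; first exact: (measurableT_comp mf).
have h : measurable_fun setT (fun z : measurableTypeR R * measurableTypeR R =>
    (z.1, z.1 * s0 - z.2) : measurableTypeR R * measurableTypeR R).
  by apply: measurable_fun_pair => //; apply: measurable_funB => //; apply: measurable_funM.
exact: (measurableT_comp (measurable_profile_transform a10 a20 cH) h).
Qed.

Let sA' u : summable_fun mu (fun b => A u (u * s0 - b)).
Proof.
have := @summable_affine R (u * s0) (-1) _ (_ : -1 != 0) (sA u).
by rewrite oppr_eq0 oner_eq0 => /(_ isT); under eq_fun do rewrite mulN1r.
Qed.

Let sFu u : summable_fun mu (fun b => F (u, b)).
Proof. exact: (@summable_funM _ _ R mu (fun b => A u (u * s0 - b)) f M). Qed.

Let sF : summable_fun (mu \x mu)%E F.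
Proof.
apply: (@summable_prod _ _ _ _ R mu mu F (fun u => M * (C' * (1 + u ^+ 2)^-1))) => //.
- move=> u; apply: le_trans (_ : M * \int[mu]_b `|A u (u * s0 - b)| <= _).
    rewrite -(RintegralZl _ measurableT (summable_norm (sA' u))).
    apply: le_Rintegral => //.
    + exact: (summable_norm (sFu u)).
    + exact: (summable_funZ M (summable_norm (sA' u))).
    + by move=> b _; rewrite normrM ler_wpM2r.
  have M0 : 0 <= M by exact: le_trans (fM 0).
  rewrite ler_wpM2l//; apply: le_trans (AC' u).
  have mA : measurable_fun setT (fun b => `|A u b|).
    by apply: measurableT_comp => //; exact: (summable_meas (sA u)).
  have nz : -1 != 0 :> R by rewrite oppr_eq0 oner_eq0.
  rewrite -(@Rintegral_affine R (u * s0) (-1) _ nz mA) normrN normr1 mul1r.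
  rewrite le_eqVlt; apply/orP; left; apply/eqP/eq_Rintegral => b _.
  by rewrite mulN1r.
- by apply: summable_funZ; apply: summable_funZ; exact: summable_cauchy.
Qed.

(** Substituting b by b - u s0 and exchanging the integrals leaves f(b) times the
    reproducing formula. *)
Lemma ridge_reproduction :
  \int[mu]_u \int[mu]_b (f (u * s0 + b) * A u (- b)) =
  2 * pi * \int[mu]_b (f b * (poisson a1 b - poisson a2 b)) * H s0.
Proof.
transitivity (\int[mu]_u \int[mu]_b F (u, b)).
  apply: eq_Rintegral => u _.
  rewrite -(Rintegral_shiftl (u * s0) (summable_meas (sFu u))).
  apply: eq_Rintegral => b _; rewrite /F /= (addrC b); congr (_ * A _ _).
  by ring.
rewrite (Rfubini sF).
have sp : summable_fun mu (fun b => f b * (poisson a1 b - poisson a2 b)).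
  apply: (@summable_funM _ _ R mu (fun b => poisson a1 b - poisson a2 b) f M) => //.
  exact: (summable_funB (summable_poisson a10) (summable_poisson a20)).
rewrite -(RintegralZl _ measurableT sp) -RintegralZr//; last exact: (summable_funZ _ sp).
apply: eq_Rintegral => b _.
rewrite -[LHS]/(\int[mu]_u (f b * A u (u * s0 - b))).
have sAb : summable_fun mu (fun u => A u (u * s0 - b)).
  apply: (@le_summable _ _ R mu _ (fun u => C * (1 + u ^+ 2)^-1)).
  - have h : measurable_fun setT (fun u : measurableTypeR R =>
        (u, u * s0 - b) : measurableTypeR R * measurableTypeR R).
      by apply: measurable_fun_pair => //; apply: measurable_funB => //; apply: measurable_funM.
    exact: (measurableT_comp (measurable_profile_transform a10 a20 cH) h).
  - by move=> u; exact: AC.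
  - by apply: summable_funZ; exact: summable_cauchy.
rewrite (RintegralZl _ measurableT sAb).
rewrite (integral_profile_transform a10 a20 cH sH HB s0 b AC); ring.
Qed.

End ridge_reproduction.

(** * Truncated waves *)

Section cutoff.
Context {R : realType}.
Notation mu := (@lebesgue_measure R).
Implicit Types (t s : R).

Definition pos_part t : R := Num.max t 0.

Lemma pos_part_ge0 t : 0 <= pos_part t.
Proof. by rewrite /pos_part le_max lexx orbT. Qed.

Lemma pos_part_pos t : 0 <= t -> pos_part t = t.
Proof. by move=> t0; rewrite /pos_part max_l. Qed.

Lemma pos_part_neg t : t <= 0 -> pos_part t = 0.
Proof. by move=> t0; rewrite /pos_part max_r. Qed.

Lemma pos_part_le_norm t : pos_part t <= `|t|.
Proof. by rewrite /pos_part ge_max normr_ge0 ler_norm. Qed.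

Lemma cont_pos_part : continuous pos_part.
Proof. by move=> t; apply: continuous_max; [exact: cvg_id|exact: cvg_cst]. Qed.

(** At the origin the difference quotient is at most |h| for |h| <= 1, since the exponent is
    at least 2. *)
Lemma der_pos_partX n t :
  der (fun t => pos_part t ^+ n.+2) t (n.+2%:R * pos_part t ^+ n.+1).
Proof.
case: (ltgtP t 0) => [t0|t0|->].
- rewrite (pos_part_neg (ltW t0)) expr0n/= mulr0.
  apply: (@near_eq_is_derive R R R (fun=> 0)).
  near=> x; rewrite pos_part_neg ?expr0n//.
  by apply/ltW; near: x; exact: lt_nbhsl.
- rewrite (pos_part_pos (ltW t0)).
  apply: (@near_eq_is_derive R R R (fun x => x ^+ n.+2)); last first.
    by apply: der_eq; [exact/derX/der_id|rewrite mulr1].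
  near=> x; rewrite pos_part_pos//.
  by apply/ltW; near: x; exact: lt_nbhsr.
- rewrite (pos_part_neg (lexx _)) expr0n/= mulr0.
  have h : (fun h : R => h^-1 *: (((fun t => pos_part t ^+ n.+2) \o shift 0) (h *: 1) -
      pos_part 0 ^+ n.+2)) @ 0^' --> (0 : R).
    rewrite (pos_part_neg (lexx _)) expr0n/=.
    apply/cvgrPdist_le => e e0; near=> h.
    have h0 : h != 0 by near: h; exact: nbhs_dnbhs_neq.
    have he : `|h| <= e by near: h; apply: dnbhs0_le.
    have h1 : `|h| <= 1 by near: h; apply: dnbhs0_le.
    rewrite /= addr0 subr0 sub0r normrN /GRing.scale/= mulr1 normrM normfV.
    rewrite ler_pdivrMl ?normr_gt0// normrX (ger0_norm (pos_part_ge0 _)).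
    apply: le_trans (_ : `|h| ^+ n.+2 <= _).
      by rewrite ler_pXn2r ?nnegrE ?pos_part_ge0 ?pos_part_le_norm.
    rewrite exprS ler_wpM2l//; apply: le_trans he.
    by rewrite exprS ler_piMr// exprn_ile1.
  split; first by apply/cvg_ex; exists 0.
  exact: cvg_lim h.
Unshelve. all: by end_near. Qed.

Lemma bounded_support (f : R -> R) (L : R) : 0 <= L -> continuous f ->
  (forall s, L <= `|s| -> f s = 0) -> exists B, forall s, `|f s| <= B.
Proof.
move=> L0 cf f0.
have cn : {within `[- L, L], continuous (fun s => `|f s|)}.
  by apply: continuous_subspaceT => s; apply: continuous_comp; [exact: cf|exact: norm_continuous].
have LL : - L <= L by lra.
have [c _ hc] := EVT_max LL cn; exists `|f c| => s.
have [sL|Ls] := leP `|s| L; first by apply: hc; rewrite in_itv/= -ler_norml.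
by rewrite f0 ?normr0// ltW.
Qed.

(** Two derivatives suffice here, so the cutoff can be piecewise polynomial: the cube of
    the positive part is of class C^2, and w = 1 - (t - 1)_+^3 - (-t - 1)_+^3 equals 1 on
    [-1, 1] and is nonpositive for |t| >= 2, so that the cube of its positive part is a
    cutoff. *)
Lemma exists_cutoff : exists (chi chi1 chi2 : R -> R) (B : R),
  [/\ (forall t, der chi t (chi1 t)) /\ (forall t, der chi1 t (chi2 t)),
      continuous chi2,
      forall t, `|t| <= 1 -> chi t = 1,
      forall t, 2 <= `|t| -> [/\ chi t = 0, chi1 t = 0 & chi2 t = 0] &
      forall t, [/\ `|chi t| <= B, `|chi1 t| <= B & `|chi2 t| <= B]].
Proof.
(* w, w1, w2 and c0, c1, c2 are successive derivatives *)
pose P := @pos_part.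
pose w t := 1 - P (t - 1) ^+ 3 - P (- t - 1) ^+ 3.
pose w1 t := - (3 * P (t - 1) ^+ 2) + 3 * P (- t - 1) ^+ 2.
pose w2 t := - (6 * P (t - 1)) - 6 * P (- t - 1).
pose c0 t := P (w t) ^+ 3.
pose c1 t := 3 * P (w t) ^+ 2 * w1 t.
pose c2 t := 6 * P (w t) * w1 t * w1 t + 3 * P (w t) ^+ 2 * w2 t.
have dm t : der (fun t => t - 1) t 1 by der_auto; rewrite addr0.
have dp t : der (fun t => - t - 1) t (- 1) by der_auto; rewrite addr0.
have d3 t : der (fun t => P t ^+ 3) t (3 * P t ^+ 2) by exact: der_pos_partX.
have d2 t : der (fun t => P t ^+ 2) t (2 * P t).
  by apply: der_eq; [exact: der_pos_partX|rewrite expr1].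
have dw t : der w t (w1 t).
  rewrite /w /w1; apply: der_eq.
    apply: derD; last by apply: derN; apply: (der_comp (d3 _)); exact: dp.
    apply: derD; first exact: der_cst.
    by apply: derN; apply: (der_comp (d3 _)); exact: dm.
  by ring.
have dw1 t : der w1 t (w2 t).
  rewrite /w1 /w2; apply: der_eq.
    apply: derD.
      apply: derN; apply: derM; first exact: der_cst.
      by apply: (der_comp (d2 _)); exact: dm.
    apply: derM; first exact: der_cst.
    by apply: (der_comp (d2 _)); exact: dp.
  by rewrite /=; ring.
have dc0 t : der c0 t (c1 t) by apply: (der_comp (d3 _)); exact: dw.
have dc1 t : der c1 t (c2 t).
  rewrite /c1 /c2; apply: der_eq.
    apply: derM; last exact: dw1.
    by apply: derM; [exact: der_cst|apply: (der_comp (d2 _)); exact: dw].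
  by rewrite /=; ring.
have cw : continuous w by apply: cont_der => t; eexists; exact: dw.
have cw1 : continuous w1 by apply: cont_der => t; eexists; exact: dw1.
have cid : continuous (fun t : R => t) by move=> t; exact: cvg_id.
have cl : continuous (fun t : R => t - 1) by apply: cont_der => t; eexists; exact: dm.
have cr : continuous (fun t : R => - t - 1) by apply: cont_der => t; eexists; exact: dp.
have cP g : continuous g -> continuous (fun t => P (g t)).
  by move=> cg; exact: cont_comp cg cont_pos_part.
have cc2 : continuous c2.
  have cPw := cP _ cw.
  have cst6 := @cont_cst R 6.
  have cw2 : continuous w2.
    apply: contB; last exact: (contM cst6 (cP _ cr)).
    by move=> t; apply: cvgN; exact: (contM cst6 (cP _ cl)).
  have cPw2 : continuous (fun t => P (w t) ^+ 2) by exact: (contM cPw cPw).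
  have c32 := contM (@cont_cst R 3) cPw2.
  exact: (contD (contM (contM (contM cst6 cPw) cw1) cw1) (contM c32 cw2)).
have wN t : 2 <= `|t| -> w t <= 0.
  rewrite ler_normr /w => /orP[t2|t2].
    have : 1 <= P (t - 1) ^+ 3 by rewrite exprn_ege1// /P pos_part_pos; lra.
    have : 0 <= P (- t - 1) ^+ 3 by rewrite exprn_ge0// pos_part_ge0.
    lra.
  have : 1 <= P (- t - 1) ^+ 3 by rewrite exprn_ege1// /P pos_part_pos; lra.
  have : 0 <= P (t - 1) ^+ 3 by rewrite exprn_ge0// pos_part_ge0.
  lra.
have z t : 2 <= `|t| -> [/\ c0 t = 0, c1 t = 0 & c2 t = 0].
  move=> /wN wt; rewrite /c0 /c1 /c2 /P (pos_part_neg wt) !expr0n/=.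
  by rewrite !mulr0 !mul0r addr0.
have cc1 : continuous c1 by apply: cont_der => t; eexists; exact: dc1.
have cc0 : continuous c0 by apply: cont_der => t; eexists; exact: dc0.
have [B0 hB0] := bounded_support (ler0n _ 2) cc0 (fun t h => let: And3 e _ _ := z t h in e).
have [B1 hB1] := bounded_support (ler0n _ 2) cc1 (fun t h => let: And3 _ e _ := z t h in e).
have [B2 hB2] := bounded_support (ler0n _ 2) cc2 (fun t h => let: And3 _ _ e := z t h in e).
exists c0, c1, c2, (`|B0| + `|B1| + `|B2|); split => //.
- move=> t; rewrite ler_norml => /andP[t1 t2]; rewrite /c0 /w /P.
  rewrite (@pos_part_neg (t - 1)); last lra.
  rewrite (@pos_part_neg (- t - 1)); last lra.
  by rewrite expr0n/= !subr0 pos_part_pos// expr1n.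
- move=> t; have := hB0 t; have := hB1 t; have := hB2 t.
  have := ler_norm B0; have := ler_norm B1; have := ler_norm B2.
  have := normr_ge0 B0; have := normr_ge0 B1; have := normr_ge0 B2.
  by move=> *; split; lra.
Qed.

End cutoff.

Section truncated_wave.
Context {R : realType}.
Notation mu := (@lebesgue_measure R).
Variables (chi chi1 chi2 : R -> R) (B : R).
Hypotheses (dchi : forall t, der chi t (chi1 t)) (dchi1 : forall t, der chi1 t (chi2 t)).
Hypothesis cchi2 : continuous chi2.
Hypothesis chi0 : forall t, 2 <= `|t| -> [/\ chi t = 0, chi1 t = 0 & chi2 t = 0].
Hypothesis chiB : forall t, [/\ `|chi t| <= B, `|chi1 t| <= B & `|chi2 t| <= B].

Definition wave (r p q s : R) : R := chi (s / r) * (p * cos s + q * sin s).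

Variables (r p q : R).
Hypothesis r1 : 1 <= r.

Let H := wave r p q.
(** The wave without cutoff and its derivative; the second derivative is - T. *)
Let T (s : R) := p * cos s + q * sin s.
Let T1 (s : R) := q * cos s - p * sin s.
Let H1 (s : R) := chi1 (s / r) / r * T s + chi (s / r) * T1 s.
Let H2 (s : R) := chi2 (s / r) / r ^+ 2 * T s + 2 * (chi1 (s / r) / r) * T1 s - chi (s / r) * T s.

Let r0 : 0 < r. Proof. exact: lt_le_trans r1. Qed.

Let dT s : der T s (T1 s).
Proof. by rewrite /T /T1; der_auto => /=; ring. Qed.

Let dT1 s : der T1 s (- T s).
Proof. by rewrite /T /T1; der_auto => /=; ring. Qed.

Let dscale s : der (fun s => s / r) s r^-1.
Proof. by der_auto; rewrite mulr0 add0r mulr1. Qed.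

Let dH s : der H s (H1 s).
Proof.
rewrite /H /H1; apply: der_eq.
  by apply: derM; [apply: (der_comp (dchi _)); exact: dscale|exact: dT].
by rewrite /= /T /T1; ring.
Qed.

Let dH1 s : der H1 s (H2 s).
Proof.
rewrite /H1 /H2; apply: der_eq.
  apply: derD.
    apply: derM; last exact: dT.
    by apply: derM; [apply: (der_comp (dchi1 _)); exact: dscale|exact: der_cst].
  by apply: derM; [apply: (der_comp (dchi _)); exact: dscale|exact: dT1].
by rewrite /= /T /T1; field; rewrite gt_eqF.
Qed.

Let cH2 : continuous H2.
Proof.
have cs : continuous (fun s : R => s / r) by apply: cont_der => s; eexists; exact: dscale.
have c1 : continuous chi1 by apply: cont_der => s; eexists; exact: dchi1.
have c0 : continuous chi by apply: cont_der => s; eexists; exact: dchi.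
have cT : continuous T by apply: cont_der => s; eexists; exact: dT.
have cT1 : continuous T1 by apply: cont_der => s; eexists; exact: dT1.
apply: contB; last by apply: contM => //; exact: cont_comp cs c0.
apply: contD.
  apply: contM => //; apply: contM; last exact: cont_cst.
  exact: cont_comp cs cchi2.
apply: contM => //; apply: contM; first exact: cont_cst.
by apply: contM; [exact: cont_comp cs c1|exact: cont_cst].
Qed.

Let far s : 2 * r <= `|s| -> 2 <= `|s / r|.
Proof. by move=> h; rewrite normrM normfV (gtr0_norm r0) ler_pdivlMr. Qed.

Let Hfar s : 2 * r <= `|s| -> H s = 0.
Proof. by move=> /far/chi0[h _ _]; rewrite /H /wave h mul0r. Qed.

Let H1far s : 2 * r <= `|s| -> H1 s = 0.
Proof. by move=> /far/chi0[h h1 _]; rewrite /H1 h h1 !mul0r addr0. Qed.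

Let H2far s : 2 * r <= `|s| -> H2 s = 0.
Proof. by move=> /far/chi0[h h1 h2]; rewrite /H2 h h1 h2 !(mul0r, mulr0) addr0 subr0. Qed.

Let D := `|p| + `|q|.

Let B0 : 0 <= B. Proof. by have [h _ _] := chiB 0; exact: le_trans h. Qed.

Let norm_cos (s : R) : `|cos s| <= 1.
Proof. by rewrite ler_norml cos_le1 cos_geN1. Qed.

Let norm_sin (s : R) : `|sin s| <= 1.
Proof. by rewrite ler_norml sin_le1 sin_geN1. Qed.

Let TD s : `|T s| <= D.
Proof.
by apply: le_trans (ler_normD _ _) _; apply: lerD; rewrite normrM ler_piMr.
Qed.

Let T1D s : `|T1 s| <= D.
Proof.
by apply: le_trans (ler_normB _ _) _; rewrite /D addrC; apply: lerD; rewrite normrM ler_piMr.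
Qed.

Let div_le (x y : R) : 1 <= y -> `|x| <= B -> `|x / y| <= B.
Proof.
move=> y1 xB; have y0 : 0 < y by exact: lt_le_trans y1.
rewrite normrM normfV (gtr0_norm y0); apply: le_trans xB.
by rewrite ler_piMr// invf_le1.
Qed.

Lemma wave_le s : `|wave r p q s| <= B * D.
Proof.
by have [h _ _] := chiB (s / r); rewrite normrM; apply: ler_pM => //; exact: TD.
Qed.

Let H2_le s : `|H2 s| <= 4 * (B * D).
Proof.
have [h h1 h2] := chiB (s / r).
have r2 : 1 <= r ^+ 2 by exact: exprn_ege1.
have e1 : `|chi2 (s / r) / r ^+ 2 * T s| <= B * D by rewrite normrM; apply: ler_pM => //; exact: div_le.
have e2 : `|2 * (chi1 (s / r) / r) * T1 s| <= 2 * (B * D).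
  by rewrite -mulrA normrM ger0_norm// ler_pM2l// normrM; apply: ler_pM => //; exact: div_le.
have e3 : `|chi (s / r) * T s| <= B * D by rewrite normrM; apply: ler_pM.
have := ler_normB (chi2 (s / r) / r ^+ 2 * T s + 2 * (chi1 (s / r) / r) * T1 s) (chi (s / r) * T s).
have := ler_normD (chi2 (s / r) / r ^+ 2 * T s) (2 * (chi1 (s / r) / r) * T1 s).
by rewrite -/(H2 s); lra.
Qed.

Lemma cont_wave : continuous (wave r p q).
Proof. by apply: cont_der => s; eexists; exact: dH. Qed.

Let L0 : 0 <= 2 * r. Proof. by rewrite mulr_ge0// ltW. Qed.

Lemma summable_wave : summable_fun mu (wave r p q).
Proof. exact: (summable_support (cont_meas cont_wave) Hfar wave_le). Qed.

Let sH2 : summable_fun mu H2.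
Proof. exact: (summable_support (cont_meas cH2) H2far H2_le). Qed.

Variables (a1 a2 : R).
Hypotheses (a10 : 0 < a1) (a20 : 0 < a2).
Notation A := (profile_transform a1 a2 (wave r p q)).

Lemma wave_transform_le : exists C, forall u b, `|A u b| <= C * (1 + u ^+ 2)^-1.
Proof.
by eexists => u b; exact: (profile_transform_le a10 a20 dH dH1 cH2 summable_wave sH2 Hfar H1far).
Qed.

Lemma summable_wave_transform u : summable_fun mu (A u).
Proof. exact: (summable_profile_transform a10 a20 summable_wave u). Qed.

(** The bound is linear in r and in |p| + |q|: the support has length at most 4 r, and the
    derivatives of the cutoff, rescaled by r >= 1, stay bounded. This is where the weight
    1 + |w|_1 on the amplitudes comes from. *)
Lemma integral_wave_transform_le u : \int[mu]_b `|A u b| <=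
  (4 * B * \int[mu]_s `|profile_kernel a1 a2 s| +
   16 * B * \int[mu]_s `|profile_primitive2 a1 a2 s|) * (r * D) * (1 + u ^+ 2)^-1.
Proof.
apply: le_trans (integral_profile_transform_le a10 a20 dH dH1 cH2 summable_wave sH2 Hfar H1far u) _.
rewrite ler_wpM2r ?invr_ge0 ?addr_ge0 ?sqr_ge0// /transform_mass mulrDl.
have k0 : 0 <= \int[mu]_s `|profile_kernel a1 a2 s| by exact: Rintegral_ge0.
have t0 : 0 <= \int[mu]_s `|profile_primitive2 a1 a2 s| by exact: Rintegral_ge0.
have h1 := integral_support_le (cont_meas cont_wave) L0 Hfar wave_le.
have h2 := integral_support_le (cont_meas cH2) L0 H2far H2_le.
apply: lerD.
  apply: le_trans (ler_wpM2r k0 h1) _.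
  by rewrite (_ : B * D * (2 * (2 * r)) * _ = 4 * B * (\int[mu]_s `|profile_kernel a1 a2 s|) * (r * D)); last by ring.
apply: le_trans (ler_wpM2r t0 h2) _.
by rewrite (_ : 4 * (B * D) * (2 * (2 * r)) * _ = 16 * B * (\int[mu]_s `|profile_primitive2 a1 a2 s|) * (r * D)); last by ring.
Qed.

End truncated_wave.

(** * Superposition of ridge functions *)

Section measurability.
Context {R : realType}.

(** The inverse is discontinuous at 0 only; writing it with real powers avoids a case
    distinction. *)
Lemma measurable_inv : measurable_fun setT (fun x : R => x^-1).
Proof.
have -> : (fun x : R => x^-1) = fun x => x * (`|x| `^ (-1)) ^+ 2.
  apply/funext => x; rewrite powR_inv1// exprVn real_normK ?num_real//.
  by have [->|x0] := eqVneq x 0; [rewrite invr0 mul0r|field].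
apply: measurable_funM => //; apply: measurable_funX.
apply: (@measurableT_comp _ _ _ _ _ _ (@powR R ^~ (-1)) _ (fun x : R => `|x|)).
  exact: measurable_powR.
exact: measurableT_comp.
Qed.

Lemma measurable_l1norm d : measurable_fun setT (@l1norm R d).
Proof.
by apply: measurable_sum => i; apply: measurableT_comp => //; exact: measurable_coord.
Qed.

Lemma measurable_dotrV d (x : 'rV[R]_d) : measurable_fun setT (fun w => dotrV w x).
Proof.
by apply: measurable_sum => i; apply: measurable_funM => //; exact: measurable_coord.
Qed.

Lemma l1norm_ge0 d (w : 'rV[R]_d) : 0 <= l1norm w.
Proof. by apply: sumr_ge0. Qed.

Lemma dotrVZ d (u : R) (w x : 'rV[R]_d) : dotrV (u *: w) x = u * dotrV w x.
Proof. by rewrite /dotrV mulr_sumr; apply: eq_bigr => i _; rewrite mxE mulrA. Qed.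

Lemma trig_le (p q t : R) : `|p * cos t + q * sin t| <= `|p| + `|q|.
Proof.
apply: le_trans (ler_normD _ _) _; rewrite !normrM lerD// ler_piMr// ler_norml.
  by rewrite cos_le1 cos_geN1.
by rewrite sin_le1 sin_geN1.
Qed.

End measurability.

Section superposition.
Context {R : realType}.
Notation mu := (@lebesgue_measure R).
Notation T := (measurableTypeR R).
Variables (d : nat) (d0 : (0 < d)%N).
Notation X := 'rV[R]_d.
Notation nu := (rV_lebesgue d).

Variables (chi chi1 chi2 : R -> R) (B : R).
Hypotheses (dchi : forall t, der chi t (chi1 t)) (dchi1 : forall t, der chi1 t (chi2 t)).
Hypothesis cchi2 : continuous chi2.
Hypothesis chi_one : forall t, `|t| <= 1 -> chi t = 1.
Hypothesis chi0 : forall t, 2 <= `|t| -> [/\ chi t = 0, chi1 t = 0 & chi2 t = 0].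
Hypothesis chiB : forall t, [/\ `|chi t| <= B, `|chi1 t| <= B & `|chi2 t| <= B].

Variables (a1 a2 : R).
Hypotheses (a10 : 0 < a1) (a20 : 0 < a2).

Variables (P Q : X -> R) (rho : R).
Hypotheses (mP : measurable_fun setT P) (mQ : measurable_fun setT Q) (rho0 : 0 <= rho).
Hypothesis sPQ : summable_fun nu (fun w => (1 + rho * l1norm w) * (`|P w| + `|Q w|)).

(** The cutoff radius: large enough for the cutoff to be 1 at s = w.x. *)
Let Rad (w : X) := 1 + rho * l1norm w.

Let Rad_ge1 w : 1 <= Rad w.
Proof. by rewrite lerDl mulr_ge0// l1norm_ge0. Qed.

Let G w := Rad w * (`|P w| + `|Q w|).

Let At (w : X) (u b : R) := profile_transform a1 a2 (wave chi (Rad w) (P w) (Q w)) u b.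

Let cchi : continuous chi. Proof. by apply: cont_der => t; eexists; exact: dchi. Qed.

Let mAt : measurable_fun setT (fun z : (X * T) * T => At z.1.1 z.1.2 z.2).
Proof.
apply: (measurable_Rintegral_r mu (f := fun y : ((X * T) * T) * T =>
  wave chi (Rad y.1.1.1) (P y.1.1.1) (Q y.1.1.1) y.2 *
  profile_kernel a1 a2 (y.1.2 - y.1.1.2 * y.2))).
have mw : measurable_fun setT (fun y : ((X * T) * T) * T => y.1.1.1).
  by apply: measurableT_comp => //; apply: measurableT_comp.
have mu' : measurable_fun setT (fun y : ((X * T) * T) * T => y.1.1.2).
  by apply: measurableT_comp => //; apply: measurableT_comp.
have mb : measurable_fun setT (fun y : ((X * T) * T) * T => y.1.2).
  by apply: measurableT_comp.
have ms : measurable_fun setT (fun y : ((X * T) * T) * T => y.2) by exact: measurable_snd.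
apply: measurable_funM; last first.
  apply: measurableT_comp; first exact: (cont_meas (cont_profile_kernel a10 a20)).
  by apply: measurable_funB => //; apply: measurable_funM.
apply: measurable_funM.
  apply: (measurableT_comp (cont_meas cchi)); apply: measurable_funM => //.
  apply: (measurableT_comp (@measurable_inv R)).
  apply: measurable_funD => //; apply: measurable_funM => //.
  exact: (measurableT_comp (@measurable_l1norm R d) mw).
apply: measurable_funD; apply: measurable_funM.
- exact: (measurableT_comp mP mw).
- by apply: (measurableT_comp _ ms); apply: cont_meas; exact: continuous_cos.
- exact: (measurableT_comp mQ mw).
- by apply: (measurableT_comp _ ms); apply: cont_meas; exact: continuous_sin.
Qed.

Let K := 4 * B * \int[mu]_s `|profile_kernel a1 a2 s| +
         16 * B * \int[mu]_s `|profile_primitive2 a1 a2 s|.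

Let sAt w u : summable_fun mu (At w u).
Proof. exact: (summable_wave_transform dchi chi0 chiB (P w) (Q w) (Rad_ge1 w) a10 a20 u). Qed.

Let sAtN w u : summable_fun mu (fun b => At w u (- b)).
Proof.
have nz : -1 != 0 :> R by rewrite oppr_eq0 oner_eq0.
have := @summable_affine R 0 (-1) _ nz (sAt w u).
by under eq_fun do rewrite add0r mulN1r.
Qed.

Let AtN_le w u : \int[mu]_b `|At w u (- b)| <= K * G w * (1 + u ^+ 2)^-1.
Proof.
apply: le_trans (integral_wave_transform_le dchi dchi1 cchi2 chi0 chiB (P w) (Q w)
  (Rad_ge1 w) a10 a20 u).
have nz : -1 != 0 :> R by rewrite oppr_eq0 oner_eq0.
have mA : measurable_fun setT (fun b => `|At w u b|).
  by apply: measurableT_comp => //; exact: (summable_meas (sAt w u)).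
rewrite -(@Rintegral_affine R 0 (-1) _ nz mA) normrN normr1 mul1r.
rewrite le_eqVlt; apply/orP; left; apply/eqP/eq_Rintegral => b _.
by rewrite add0r mulN1r.
Qed.

(** The integrand of the density after the substitution w -> w/u; its factor |u|^-d is the
    Jacobian. *)
Let Phi (z : (X * T) * T) : R :=
  `|z.2|^-1 ^+ d * At (z.2^-1 *: z.1.1) z.2 (- z.1.2).

Let mPhi : measurable_fun setT Phi.
Proof.
apply: measurable_funM.
  apply: measurable_funX; apply: (measurableT_comp (@measurable_inv R)).
  exact: measurableT_comp.
have h : measurable_fun setT (fun z : (X * T) * T =>
    ((z.2^-1 *: z.1.1, z.2), - z.1.2) : (X * T) * T).
  apply: measurable_fun_pair; last first.
    by apply: measurableT_comp => //; exact: measurableT_comp.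
  apply: measurable_fun_pair => //; apply: measurable_fun_rV => i.
  under eq_fun do rewrite mxE; apply: measurable_funM.
    exact: (measurableT_comp (@measurable_inv R)).
  apply: (measurableT_comp (@measurable_coord R d i)).
  exact: measurableT_comp.
exact: (measurableT_comp mAt h).
Qed.

(** At u = 0 the substitution is meaningless, and the convention 0^-1 = 0 makes the
    integrand vanish, as d > 0. *)
Let Phi0 w b : Phi ((w, b), 0) = 0.
Proof. by rewrite /Phi /= normr0 invr0 expr0n eqn0Ngt d0 mul0r. Qed.

Notation numu := (sigma_product nu mu).

(** Undoing the substitution, the mass of the slice is at most the integral over w of the
    norm of the wave transform. *)
Let sPhi_slice u : summable_fun numu (fun z => Phi (z, u)) /\
  \int[numu]_z `|Phi (z, u)| <= K * (\int[nu]_w G w) * (1 + u ^+ 2)^-1.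
Proof.
have K0 : 0 <= K.
  have Bge0 : 0 <= B by have [h _ _] := chiB 0; exact: le_trans h.
  by apply: addr_ge0; apply: mulr_ge0; rewrite ?mulr_ge0//; exact: Rintegral_ge0.
have G0 w : 0 <= G w.
  by apply: mulr_ge0; [exact: le_trans ler01 (Rad_ge1 w)|exact: addr_ge0].
have c0 : 0 <= (1 + u ^+ 2)^-1 by rewrite invr_ge0 addr_ge0 ?sqr_ge0.
have [->|u0] := eqVneq u 0.
  split.
    have -> : (fun z => Phi (z, 0)) = fun=> 0 by apply/funext => -[w b]; exact: Phi0.
    exact: (integrable0 numu setT).
  have -> : \int[numu]_z `|Phi (z, 0)| = 0; last first.
    by apply: mulr_ge0 => //; apply: mulr_ge0 => //; exact: Rintegral_ge0.
  transitivity (\int[numu]_(z in setT) (0 : R)).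
    by apply: eq_Rintegral => -[w b] _; rewrite Phi0 normr0.
  by rewrite (Rintegral_cst _ measurableT) mul0r.
have iu0 : u^-1 != 0 by rewrite invr_eq0.
pose c := `|u|^-1 ^+ d.
have cge0 : 0 <= c by rewrite exprn_ge0 ?invr_ge0.
pose g w := c * (K * G (u^-1 *: w) * (1 + u ^+ 2)^-1).
have sGu : summable_fun nu (fun w => G (u^-1 *: w)).
  have := summable_rV_affine 0 iu0 sPQ.
  by under eq_fun do rewrite add0r.
have gE w : g w = K * (1 + u ^+ 2)^-1 * c * G (u^-1 *: w) by rewrite /g; ring.
have sg : summable_fun nu g.
  by rewrite (funext gE); exact: summable_funZ.
have mPhiu : measurable_fun setT (fun z : X * T => Phi (z, u)).
  exact: (measurableT_comp mPhi (pair2_measurable u)).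
have sw w : summable_fun mu (fun b => Phi ((w, b), u)).
  exact: (summable_funZ c (sAtN (u^-1 *: w) u)).
have bw w : \int[mu]_b `|Phi ((w, b), u)| <= g w.
  have -> : \int[mu]_b `|Phi ((w, b), u)| = c * \int[mu]_b `|At (u^-1 *: w) u (- b)|.
    rewrite -(RintegralZl _ measurableT (summable_norm (sAtN (u^-1 *: w) u))).
    by apply: eq_Rintegral => b _; rewrite normrM [X in X * _]ger0_norm.
  by rewrite ler_wpM2l.
have sz : summable_fun numu (fun z => Phi (z, u)).
  exact: (@summable_prod _ _ _ _ R nu mu (fun z => Phi (z, u)) g mPhiu sw bw sg).
split => //.
rewrite -(Rfubini1 (summable_norm sz)).
apply: le_trans (_ : \int[nu]_w g w <= _).
  by apply: le_Rintegral => //; exact: (summable_Rintegral_r (summable_norm sz)).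
rewrite (funext gE) (RintegralZl _ measurableT sGu).
have := Rintegral_rV_affine 0 iu0 (summable_meas sPQ).
under eq_Rintegral do rewrite add0r.
rewrite normfV -/c => <-.
by rewrite le_eqVlt; apply/orP; left; apply/eqP; rewrite /G /Rad; ring.
Qed.

Let sPhi : summable_fun (numu \x mu)%E Phi.
Proof.
have sg : summable_fun mu (fun u => K * (\int[nu]_w G w) * (1 + u ^+ 2)^-1).
  by apply: summable_funZ; exact: summable_cauchy.
have s1 u := (sPhi_slice u).1; have s2 u := (sPhi_slice u).2.
exact: (@summable_prod_rev _ _ _ _ R numu mu Phi _ mPhi s1 s2 sg).
Qed.

(** The weight with which the ridge function b |-> f(w.x + b) enters, after the frequency
    scale u has been integrated out. *)
Definition ridge_density (w : X) (b : R) : R := \int[mu]_u Phi ((w, b), u).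

Lemma measurable_ridge_density w : measurable_fun setT (ridge_density w : T -> R).
Proof.
exact: (measurableT_comp (measurable_Rintegral_r mu mPhi) (pair1_measurable w)).
Qed.

Let sDensity : summable_fun numu (fun z => ridge_density z.1 z.2).
Proof.
have := summable_Rintegral_r sPhi; congr (summable_fun numu _).
Qed.

Variables (f : R -> R) (M : R).
Hypotheses (cf : continuous f) (fM : forall t, `|f t| <= M).
Variable x : X.
Hypothesis xrho : forall w : X, `|dotrV w x| <= rho * l1norm w.

Let mfx : measurable_fun setT (fun z : X * T => f (dotrV z.1 x + z.2)).
Proof.
apply: (measurableT_comp (cont_meas cf)); apply: measurable_funD => //.
exact: (measurableT_comp (measurable_dotrV x) measurable_fst).
Qed.

Let sfDensity : summable_fun numu (fun z => f (dotrV z.1 x + z.2) * ridge_density z.1 z.2).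
Proof. exact: (@summable_funM _ _ R numu _ (fun z => f (dotrV z.1 x + z.2)) M). Qed.

Let Fx (z : (X * T) * T) := f (dotrV z.1.1 x + z.1.2) * Phi z.

Let sFx : summable_fun (numu \x mu)%E Fx.
Proof.
apply: (@summable_funM _ _ R (numu \x mu)%E Phi (fun z => f (dotrV z.1.1 x + z.1.2)) M) => //.
exact: (measurableT_comp mfx measurable_fst).
Qed.

(** For almost every (w, b) the factor f(w.x + b), which does not depend on u, can be taken
    out of the integral defining the density. *)
Let density_Fx : \int[numu]_z (f (dotrV z.1 x + z.2) * ridge_density z.1 z.2) =
  \int[mu]_u \int[numu]_z Fx (z, u).
Proof.
rewrite -(Rfubini sFx); apply: ae_eq_Rintegral.
- exact: (summable_meas sfDensity).
- exact: (summable_meas (summable_Rintegral_r sFx)).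
- apply: filterS (summable_ae_r sPhi) => -[w b] sz.
  apply/esym; exact: (RintegralZl (f (dotrV w x + b)) measurableT sz).
Qed.

(** The integrand of the reproducing formula for the wave of frequency w, at s0 = w.x. *)
Let Y (z : X * T) : R := \int[mu]_b (f (z.2 * dotrV z.1 x + b) * At z.1 z.2 (- b)).

Let sfAtN w u c : summable_fun mu (fun b => f (c + b) * At w u (- b)).
Proof.
apply: (@summable_funM _ _ R mu _ (fun b => f (c + b)) M) => //.
by apply: (measurableT_comp (cont_meas cf)); apply: measurable_funD.
Qed.

Let mY : measurable_fun setT Y.
Proof.
apply: (measurable_Rintegral_r mu (f := fun y : (X * T) * T =>
  f (y.1.2 * dotrV y.1.1 x + y.2) * At y.1.1 y.1.2 (- y.2))).
have mw : measurable_fun setT (fun y : (X * T) * T => y.1.1) by apply: measurableT_comp.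
have mu' : measurable_fun setT (fun y : (X * T) * T => y.1.2) by apply: measurableT_comp.
apply: measurable_funM.
  apply: (measurableT_comp (cont_meas cf)); apply: measurable_funD => //.
  apply: measurable_funM => //.
  exact: (measurableT_comp (measurable_dotrV x) mw).
have h : measurable_fun setT (fun z : (X * T) * T => (z.1, - z.2) : (X * T) * T).
  by apply: measurable_fun_pair => //; apply: measurableT_comp.
exact: (measurableT_comp mAt h).
Qed.

Let Y_le w u : `|Y (w, u)| <= M * (K * G w * (1 + u ^+ 2)^-1).
Proof.
have M0 : 0 <= M by exact: le_trans (fM 0).
have sN := summable_norm (sAtN w u).
apply: le_trans (_ : M * \int[mu]_b `|At w u (- b)| <= _); last by rewrite ler_wpM2l.
rewrite -(RintegralZl _ measurableT sN).
apply: norm_Rintegral_le; first exact: (summable_funZ M sN).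
  exact: (summable_meas (sfAtN w u (u * dotrV w x))).
by move=> b; rewrite normrM ler_wpM2r.
Qed.

Let sYu u : summable_fun nu (fun w => Y (w, u)).
Proof.
apply: (@le_summable _ _ R nu _ (fun w => M * K * (1 + u ^+ 2)^-1 * G w)).
- exact: (measurableT_comp mY (pair2_measurable u)).
- by move=> w; apply: le_trans (Y_le w u) _; rewrite le_eqVlt; apply/orP; left; apply/eqP; ring.
- exact: summable_funZ.
Qed.

Let sY : summable_fun (nu \x mu)%E Y.
Proof.
have sc := @summable_cauchy R.
have s1 w : summable_fun mu (fun u => M * K * G w * (1 + u ^+ 2)^-1) by exact: summable_funZ.
have Yb w u : `|Y (w, u)| <= M * K * G w * (1 + u ^+ 2)^-1.
  by apply: le_trans (Y_le w u) _; rewrite le_eqVlt; apply/orP; left; apply/eqP; ring.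
have mYw w : measurable_fun setT (fun u => Y (w, u)).
  exact: (measurableT_comp mY (pair1_measurable w)).
have sYw w : summable_fun mu (fun u => Y (w, u)) by exact: (le_summable (mYw w) (Yb w)).
apply: (@summable_prod _ _ _ _ R nu mu Y (fun w => M * K * pi * G w)) => //.
  move=> w; apply: le_trans (_ : \int[mu]_u (M * K * G w * (1 + u ^+ 2)^-1) <= _).
    by apply: le_Rintegral; [by []|exact: (summable_norm (sYw w))|exact: s1|move=> u _; exact: Yb].
  rewrite (RintegralZl _ measurableT sc) integral_cauchy.
  by rewrite le_eqVlt; apply/orP; left; apply/eqP; ring.
exact: summable_funZ.
Qed.

Let Fx_Y u : u != 0 -> \int[numu]_z Fx (z, u) = \int[nu]_w Y (w, u).
Proof.
move=> u0; have iu0 : u^-1 != 0 by rewrite invr_eq0.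
have sFu : summable_fun numu (fun z => Fx (z, u)).
  apply: (@summable_funM _ _ R numu (fun z => Phi (z, u)) (fun z => f (dotrV z.1 x + z.2)) M) => //.
  exact: (sPhi_slice u).1.
rewrite -(Rfubini1 sFu).
have mYu : measurable_fun setT (fun w => Y (w, u)) by exact: (summable_meas (sYu u)).
rewrite -(Rintegral_rV_affine 0 iu0 mYu) normfV.
have sYu' := @summable_rV_affine R d 0 u^-1 _ iu0 (sYu u).
rewrite -(RintegralZl _ measurableT sYu'); apply: eq_Rintegral => w _.
have e : dotrV (u^-1 *: w) x * u = dotrV w x by rewrite dotrVZ mulrC mulrA divff// mul1r.
rewrite add0r /Y /= -(RintegralZl _ measurableT (sfAtN _ _ _)); apply: eq_Rintegral => b _.
by rewrite /Fx /Phi /= -e (mulrC _ u) mulrCA.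
Qed.

(** The reproducing formula at s0 = w.x, where the cutoff equals 1. *)
Let Y_wave w : \int[mu]_u Y (w, u) =
  2 * pi * \int[mu]_b (f b * (poisson a1 b - poisson a2 b)) *
  (P w * cos (dotrV w x) + Q w * sin (dotrV w x)).
Proof.
have [C AC] := wave_transform_le dchi dchi1 cchi2 chi0 chiB (P w) (Q w) (Rad_ge1 w) a10 a20.
have cw := @cont_wave R chi chi1 dchi (Rad w) (P w) (Q w).
have sw := summable_wave dchi chi0 chiB (P w) (Q w) (Rad_ge1 w).
have AC' := integral_wave_transform_le dchi dchi1 cchi2 chi0 chiB (P w) (Q w) (Rad_ge1 w) a10 a20.
rewrite -[LHS]/(\int[mu]_u \int[mu]_b (f (u * dotrV w x + b) * At w u (- b))).
rewrite (ridge_reproduction a10 a20 cw sw (wave_le chiB (Rad w) (P w) (Q w))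
  (cont_meas cf) fM AC (sAt w) AC' (dotrV w x)).
congr (_ * _); rewrite /wave chi_one ?mul1r//.
have r0 : 0 < Rad w by exact: lt_le_trans (Rad_ge1 w).
rewrite normrM normfV (gtr0_norm r0) ler_pdivrMr// mul1r.
by apply: le_trans (xrho w) _; rewrite lerDr.
Qed.

Lemma summable_trig : summable_fun nu (fun w => P w * cos (dotrV w x) + Q w * sin (dotrV w x)).
Proof.
apply: (@le_summable _ _ R nu _ G) => //.
- apply: measurable_funD; apply: measurable_funM => //.
    by apply: (measurableT_comp _ (measurable_dotrV x)); apply: cont_meas; exact: continuous_cos.
  by apply: (measurableT_comp _ (measurable_dotrV x)); apply: cont_meas; exact: continuous_sin.
- move=> w; apply: le_trans (trig_le _ _ _) _.
  by rewrite /G ler_peMl// addr_ge0.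
Qed.

(** Fubini in (w, b, u), then the substitution w -> u w for fixed u, turn the left-hand side
    into the integral over w of the reproducing formulas for the single frequencies. The
    slice u = 0 is negligible. *)
Lemma ridge_superposition :
  [/\ {ae nu, forall w, summable_fun mu (fun b => f (dotrV w x + b) * ridge_density w b)},
      summable_fun nu (fun w => \int[mu]_b (f (dotrV w x + b) * ridge_density w b)) &
      \int[nu]_w \int[mu]_b (f (dotrV w x + b) * ridge_density w b) =
      2 * pi * \int[mu]_b (f b * (poisson a1 b - poisson a2 b)) *
      \int[nu]_w (P w * cos (dotrV w x) + Q w * sin (dotrV w x))].
Proof.
split.
- exact: (summable_ae_r sfDensity).
- exact: (summable_Rintegral_r sfDensity).
rewrite (Rfubini1 sfDensity) -[LHS]/(\int[numu]_z (f (dotrV z.1 x + z.2) * ridge_density z.1 z.2)).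
rewrite density_Fx.
transitivity (\int[mu]_u \int[nu]_w Y (w, u)).
  apply: ae_eq_Rintegral.
  - exact: (summable_meas (summable_Rintegral_l sFx)).
  - exact: (summable_meas (summable_Rintegral_l sY)).
  - exists [set 0]; split; [exact: measurable_set1|exact: lebesgue_measure_set1|].
    by move=> u /= h; apply: contrapT => u0; apply: h; apply: Fx_Y; exact/eqP.
rewrite -(Rfubini sY) -(RintegralZl _ measurableT summable_trig).
by apply: eq_Rintegral => w _; exact: Y_wave.
Qed.

End superposition.

(** The amplitudes are divided by the constant of the reproducing formula, which is nonzero
    for the translate g of f; the translation is then absorbed in b. The function beta is
    the same for all x. *)
Lemma ridge_representation (R : realType) (d : nat) (f : R -> R) (M : R)
    (P Q : 'rV[R]_d -> R) (rho : R) : (0 < d)%N ->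
  continuous f -> (forall t, `|f t| <= M) -> (exists s t, f s != f t) ->
  measurable_fun setT P -> measurable_fun setT Q -> 0 <= rho ->
  summable_fun (rV_lebesgue d) (fun w => (1 + rho * l1norm w) * (`|P w| + `|Q w|)) ->
  exists beta : 'rV[R]_d -> R -> R, forall x : 'rV[R]_d,
    (forall w, `|dotrV w x| <= rho * l1norm w) ->
  [/\ {ae rV_lebesgue d, forall w,
        summable_fun (@lebesgue_measure R) (fun b => f (dotrV w x + b) * beta w b)},
      summable_fun (rV_lebesgue d)
        (fun w => \int[@lebesgue_measure R]_b (f (dotrV w x + b) * beta w b)) &
      \int[rV_lebesgue d]_w \int[@lebesgue_measure R]_b (f (dotrV w x + b) * beta w b) =
      \int[rV_lebesgue d]_w (P w * cos (dotrV w x) + Q w * sin (dotrV w x))].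
Proof.
move=> d0 cf fM fnc mP mQ rho0 sPQ.
have [a1 [a2 [y [a10 a20 c0]]]] := poisson_separates cf fM fnc.
have [chi [chi1 [chi2 [B [[dchi dchi1] cchi2 chi_one chi0 chiB]]]]] := @exists_cutoff R.
pose g t := f (t + y).
have cg : continuous g.
  by apply: (cont_comp (f := fun t => t + y)) => //; apply: contD; [move=> t; exact: cvg_id|exact: cont_cst].
pose c := 2 * pi * \int[@lebesgue_measure R]_b (g b * (poisson a1 b - poisson a2 b)).
have cn0 : c != 0 by rewrite !mulf_neq0// gt_eqF// pi_gt0.
(* the constant of the reproducing formula is absorbed in the amplitudes *)
pose P' w := c^-1 * P w; pose Q' w := c^-1 * Q w.
have mP' : measurable_fun setT P' by exact: measurable_funM.
have mQ' : measurable_fun setT Q' by exact: measurable_funM.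
have sPQ' : summable_fun (rV_lebesgue d) (fun w => (1 + rho * l1norm w) * (`|P' w| + `|Q' w|)).
  rewrite (_ : (fun w => _) = fun w => `|c^-1| * ((1 + rho * l1norm w) * (`|P w| + `|Q w|))).
    exact: summable_funZ.
  by apply/funext => w; rewrite /P' /Q' !normrM -mulrDr mulrCA.
pose D := ridge_density chi a1 a2 P' Q' rho.
exists (fun w b => D w (b - y)) => x xrho.
have [h1 h2 h3] := ridge_superposition d0 dchi dchi1 cchi2 chi_one chi0 chiB a10 a20 mP' mQ' rho0
  sPQ' cg (fun t => fM (t + y)) xrho.
have e w b : f (dotrV w x + b) * D w (b - y) = g (dotrV w x + (b - y)) * D w (b - y).
  by rewrite /g addrA subrK.
have E w : \int[@lebesgue_measure R]_b (f (dotrV w x + b) * D w (b - y)) =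
    \int[@lebesgue_measure R]_b (g (dotrV w x + b) * D w b).
  have mD : measurable_fun setT (D w : measurableTypeR R -> R).
    exact: (measurable_ridge_density dchi a10 a20 rho mP' mQ').
  have mgD : measurable_fun setT (fun b : R => g (dotrV w x + b) * D w b).
    apply: measurable_funM => //.
    by apply: (measurableT_comp (cont_meas cg)); apply: measurable_funD.
  rewrite -(Rintegral_shiftl (- y) mgD); apply: eq_Rintegral => b _; exact: e.
split.
- apply: filterS h1 => w s; rewrite (funext (e w)).
  exact: (summable_shiftl (- y) s).
- by rewrite (funext E).
- rewrite (eq_Rintegral _ (fun w _ => E w)) h3 -/c.
  rewrite -(RintegralZl _ measurableT (summable_trig mP' mQ' rho0 sPQ' x)).
  apply: eq_Rintegral => w _; rewrite /P' /Q' -/c.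
  by field.
Qed.

(** * Gaussian integrals *)

Section derivative_under_integral.
Context {R : realType} {d : measure_display} {T : measurableType d}.
Variable nu : {measure set T -> \bar R}.

(** Differentiation under the integral sign with a global dominating function. *)
Lemma der_under_integral (f df : R -> T -> R) (g : T -> R) (z : R) :
  (forall z y, der (f ^~ y) z (df z y)) -> (forall z, summable_fun nu (f z)) ->
  summable_fun nu g -> (forall z y, `|df z y| <= g y) ->
  der (fun z => \int[nu]_y f z y) z (\int[nu]_y df z y).
Proof.
move=> dfE sf sg dfg.
have e x y : partial1of2 f x y = df x y.
  by rewrite partial1of2E; case: (dfE x y).
have g0 y : 0 <= g y by exact: le_trans (dfg z y).
have za : `]z - 1, z + 1[%classic z by rewrite /= in_itv/=; apply/andP; split; lra.
have fx x : `]z - 1, z + 1[%classic x -> nu.-integrable setT (EFin \o f x) by move=> _; exact: sf.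
have dx x y : `]z - 1, z + 1[%classic x -> setT y -> derivable (f ^~ y) x 1.
  by move=> _ _; case: (dfE x y).
have bx x y : `]z - 1, z + 1[%classic x -> setT y -> `|partial1of2 f x y| <= g y.
  by move=> _ _; rewrite e.
have h1 := derivable_under_integral measurableT za fx dx g0 sg bx.
have h2 := differentiation_under_integral measurableT za fx dx g0 sg bx.
split; first exact: h1.
rewrite -derive1E h2; apply: eq_Rintegral => y _; exact: e.
Qed.

End derivative_under_integral.

Section gaussian_line.
Context {R : realType}.
Notation mu := (@lebesgue_measure R).

Lemma summable_gauss (t : R) : 0 < t -> summable_fun mu (fun x => expR (- (t * x) ^+ 2)).
Proof.
move=> t0; have tn0 : t != 0 by rewrite gt_eqF.
have := @summable_affine R 0 t _ tn0 integrableT_gauss.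
by under eq_fun do rewrite add0r.
Qed.

(** The moment |x| exp(-x^2) is dominated by a wider Gaussian, since |x| <= 1 + x^2/2. *)
Let moment_le (x : R) : `|x| * expR (- x ^+ 2) <= expR (- ((Num.sqrt 2)^-1 * x) ^+ 2).
Proof.
rewrite exprMn exprVn sqr_sqrtr// -ler_pdivlMr ?expR_gt0// -expRN -expRD.
rewrite (_ : - _ + - - x ^+ 2 = x ^+ 2 / 2); last by field.
apply: le_trans (expR_ge1Dx _); rewrite ler_norml.
by have := sqr_ge0 (x - 1); have := sqr_ge0 (x + 1) => *; apply/andP; split; lra.
Qed.

Let mom (x : R) : R := `|x| * expR (- x ^+ 2).

Let smom : summable_fun mu mom.
Proof.
have c0 : 0 < (Num.sqrt 2)^-1 :> R by rewrite invr_gt0 sqrtr_gt0.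
have mg : measurable_fun setT (fun x : R => expR (- x ^+ 2)).
  exact: (summable_meas integrableT_gauss).
apply: (@le_summable _ _ R mu mom _ _ _ (summable_gauss c0)).
  by apply: measurable_funM => //; exact: measurableT_comp.
by move=> x; rewrite ger0_norm ?moment_le// mulr_ge0 ?expR_ge0.
Qed.

Let g (z x : R) := expR (- x ^+ 2) * cos (z * x).
Let dg (z x : R) := - (x * expR (- x ^+ 2) * sin (z * x)).

Let cg z : continuous (g z).
Proof. by apply: cont_der => x; eexists; rewrite /g; der_auto. Qed.

Let sg z : summable_fun mu (g z).
Proof.
have h x : `|g z x| <= expR (- x ^+ 2).
  rewrite /g normrM ger0_norm ?expR_ge0// ler_piMr ?expR_ge0//.
  by rewrite ler_norml cos_le1 cos_geN1.
exact: (@le_summable _ _ R mu (g z) _ (cont_meas (@cg z)) h integrableT_gauss).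
Qed.

Let cdg z : continuous (dg z).
Proof. by apply: cont_der => x; eexists; rewrite /dg; der_auto. Qed.

Let dg_le z x : `|dg z x| <= mom x.
Proof.
rewrite /dg normrN 2!normrM (ger0_norm (expR_ge0 _)) /mom ler_piMr ?mulr_ge0 ?expR_ge0//.
by rewrite ler_norml sin_le1 sin_geN1.
Qed.

Let sdg z : summable_fun mu (dg z).
Proof. exact: (@le_summable _ _ R mu (dg z) _ (cont_meas (@cdg z)) (@dg_le z) smom). Qed.

Let F (z : R) := \int[mu]_x g z x.

Let dF z : der F z (\int[mu]_x dg z x).
Proof.
apply: (@der_under_integral _ _ _ mu g dg mom) => // y x.
by rewrite /g /dg; der_auto => /=; ring.
Qed.

(** Integrating by parts, the derivative of the Gaussian being - 2 x exp(-x^2). *)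
Let ibp z : \int[mu]_x dg z x = - (z / 2) * F z.
Proof.
have h : \int[mu]_x (2 * dg z x + z * g z x) = 0.
  apply: (@FTC_line _ (fun x => expR (- x ^+ 2) * sin (z * x))).
  - exact: (summable_funD (summable_funZ 2 (sdg z)) (summable_funZ z (sg z))).
  - by move=> x; der_auto => /=; rewrite /g /dg; ring.
  - exact: (contD (contM (@cont_cst R 2) (@cdg z)) (contM (@cont_cst R z) (@cg z))).
  - have nn (m : nat) : (m <= m ^ 2)%N by case: m => // m; rewrite expnS expn1 leq_pmull.
    pose h (n : nat) : R := expR (- n%:R ^+ 2) * sin (z * n%:R).
    rewrite (_ : (fun n : nat => _) = (fun n => h n + h n)); last first.
      by apply/funext => n; rewrite sqrrN mulrN sinN mulrN opprK.
    suff h0 : h n @[n --> \oo] --> 0 by rewrite -[X in _ --> X]addr0; exact: cvgD.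
    apply: (@squeeze_cvgr _ _ _ _ (fun n : nat => - (n.+1%:R^-1)) (fun n : nat => n.+1%:R^-1)).
    + near=> n; rewrite -ler_norml normrM (ger0_norm (expR_ge0 _)).
      apply: le_trans (_ : expR (- n%:R ^+ 2) <= _).
        by rewrite ler_piMr ?expR_ge0// ler_norml sin_le1 sin_geN1.
      rewrite expRN lef_pV2 ?posrE ?expR_gt0//; apply: le_trans (expR_ge1Dx _).
      by rewrite -natr1 addrC lerD2l -natrX ler_nat nn.
    + by rewrite -oppr0; apply: cvgN; exact: cvg_harmonic.
    + exact: cvg_harmonic.
move: h; rewrite (RintegralD measurableT (summable_funZ 2 (sdg z)) (summable_funZ z (sg z))).
rewrite (RintegralZl _ measurableT (sdg z)) (RintegralZl _ measurableT (sg z)) -/(F z); lra.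
Unshelve. all: by end_near. Qed.

(** The integral, as a function F of z, satisfies F' = - (z/2) F. *)
Lemma gauss_cos (z : R) :
  \int[mu]_x (expR (- x ^+ 2) * cos (z * x)) = Num.sqrt pi * expR (- z ^+ 2 / 4).
Proof.
have d0 y : der (fun z => F z * expR (z ^+ 2 / 4)) y 0.
  apply: der_eq.
    apply: derM; first exact: dF.
    by der_auto.
  by rewrite /= ibp; field.
have /= := is_derive_0_is_cst z 0 d0.
rewrite expr0n/= mul0r expR0 mulr1 /F.
have -> : \int[mu]_x g 0 x = Num.sqrt pi.
  rewrite /Rintegral; under eq_integral do rewrite /g mul0r cos0 mulr1.
  by rewrite integralT_gauss.
by move=> <-; rewrite -mulrA -expRD mulNr subrr expR0 mulr1.
Qed.

Lemma gauss_sin (z : R) : \int[mu]_x (expR (- x ^+ 2) * sin (z * x)) = 0.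
Proof.
have m : measurable_fun setT (fun x : R => expR (- x ^+ 2) * sin (z * x)).
  by apply: cont_meas; apply: cont_der => x; eexists; der_auto.
have nz : -1 != 0 :> R by rewrite oppr_eq0 oner_eq0.
have sm : summable_fun mu (fun x : R => expR (- x ^+ 2) * sin (z * x)).
  have h (x : R) : `|expR (- x ^+ 2) * sin (z * x)| <= expR (- x ^+ 2).
    rewrite normrM ger0_norm ?expR_ge0// ler_piMr ?expR_ge0//.
    by rewrite ler_norml sin_le1 sin_geN1.
  exact: (@le_summable _ _ R mu _ _ m h integrableT_gauss).
have := @Rintegral_affine R 0 (-1) _ nz m; rewrite normrN normr1 mul1r.
rewrite (@eq_Rintegral _ _ _ mu setT (fun x => -1 * (expR (- x ^+ 2) * sin (z * x)))); last first.
  by move=> x _; rewrite /= !add0r !mulN1r sqrrN mulrN sinN mulrN.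
rewrite (RintegralZl _ measurableT sm); lra.
Qed.

End gaussian_line.

Section gaussian_space.
Context {R : realType}.
Notation mu := (@lebesgue_measure R).

(** The converse of [summable_rVS]. *)
Lemma prod_summable_rVS d (f : 'rV[R]_d.+1 -> R) : measurable_fun setT f ->
  summable_fun (mu \x rV_lebesgue d)%E (f \o @consrV R d) ->
  summable_fun (rV_lebesgue d.+1) f.
Proof.
move=> mf sf; apply: summableP => //.
rewrite integral_rVS//; last by apply/measurable_EFinP; exact: measurableT_comp.
have mfc : measurable_fun setT (EFin \o (f \o @consrV R d)).
  by apply/measurable_EFinP; exact: (summable_meas sf).
exact: (integrable12ltyP mu (rV_lebesgue d) mfc).1.
Qed.

Lemma dotrV_consrV d (p : measurableTypeR R * 'rV[R]_d) (z : 'rV[R]_d.+1) :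
  dotrV (consrV p) z = p.1 * z ord0 ord0 + dotrV p.2 (\row_i z ord0 (lift ord0 i)).
Proof.
rewrite /dotrV big_ord_recl consrV0; congr (_ + _); apply: eq_bigr => i _.
by rewrite consrVS mxE.
Qed.

Lemma dotrV_consrV2 d (p : measurableTypeR R * 'rV[R]_d) :
  dotrV (consrV p) (consrV p) = p.1 ^+ 2 + dotrV p.2 p.2.
Proof.
rewrite dotrV_consrV consrV0 expr2; congr (_ + dotrV _ _).
by apply/rowP => i; rewrite mxE consrVS.
Qed.

Definition gauss d (t : R) (w : 'rV[R]_d) : R := expR (- (t ^+ 2 * dotrV w w)).

Lemma measurable_sqdot d : measurable_fun setT (fun w : 'rV[R]_d => dotrV w w).
Proof.
by apply: measurable_sum => i; apply: measurable_funM => //; exact: measurable_coord.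
Qed.

Lemma measurable_gauss d t : measurable_fun setT (@gauss d t).
Proof.
apply: measurableT_comp => //; apply: measurableT_comp => //.
by apply: measurable_funM => //; exact: measurable_sqdot.
Qed.

Lemma gauss_ge0 d t w : 0 <= @gauss d t w. Proof. exact: expR_ge0. Qed.

Lemma sqdot_ge0 d (w : 'rV[R]_d) : 0 <= dotrV w w.
Proof. by apply: sumr_ge0 => i _; exact: sqr_ge0. Qed.

Lemma gauss_le1 d t w : @gauss d t w <= 1.
Proof. by rewrite -expR0 ler_expR oppr_le0 mulr_ge0 ?sqr_ge0 ?sqdot_ge0. Qed.

Lemma gauss_consrV d t (p : measurableTypeR R * 'rV[R]_d) :
  gauss t (consrV p) = expR (- (t * p.1) ^+ 2) * gauss t p.2.
Proof. by rewrite /gauss dotrV_consrV2 -expRD; congr expR; ring. Qed.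

Section width.
Variable t : R.
Hypothesis t0 : 0 < t.

Let meas_cos d (z : 'rV[R]_d) (th : R) :
  measurable_fun setT (fun w : 'rV[R]_d => gauss t w * cos (dotrV w z + th)).
Proof.
apply: measurable_funM; first exact: measurable_gauss.
apply: (measurableT_comp (cont_meas (@continuous_cos R))).
by apply: measurable_funD => //; exact: measurable_dotrV.
Qed.

Lemma summable_gauss_rV d : summable_fun (rV_lebesgue d) (@gauss d t).
Proof.
elim: d => [|d IHd].
  apply: summableP; first exact: measurable_gauss.
  have E : measurable_fun [set: 'rV[R]_0] (fun x => `|gauss t x|%:E).
    by apply/measurable_EFinP; apply: measurableT_comp => //; exact: measurable_gauss.
  rewrite /= integral_dirac//= diracE mem_set// mul1e ltry//.
have mg : measurable_fun setT (fun x : R => expR (- (t * x) ^+ 2)).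
  exact: summable_meas (summable_gauss t0).
apply: prod_summable_rVS; first exact: measurable_gauss.
rewrite (_ : _ \o _ = fun p : measurableTypeR R * 'rV[R]_d => expR (- (t * p.1) ^+ 2) * gauss t p.2); last first.
  by apply/funext => p; exact: gauss_consrV.
apply: (@summable_prod _ _ _ _ R mu (rV_lebesgue d) _
  (fun x => expR (- (t * x) ^+ 2) * \int[rV_lebesgue d]_y gauss t y)).
- apply: measurable_funM; first exact: (measurableT_comp mg).
  exact: (measurableT_comp (measurable_gauss t)).
- by move=> x; exact: (summable_funZ (expR (- (t * x) ^+ 2)) IHd).
- move=> x; rewrite -(RintegralZl _ measurableT IHd) le_eqVlt; apply/orP; left; apply/eqP.
  by apply: eq_Rintegral => y _; rewrite ger0_norm// mulr_ge0 ?expR_ge0.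
- under eq_fun do rewrite mulrC; apply: summable_funZ; exact: summable_gauss.
Qed.

Lemma summable_gauss_cos d (z : 'rV[R]_d) (th : R) :
  summable_fun (rV_lebesgue d) (fun w => gauss t w * cos (dotrV w z + th)).
Proof.
have h (w : 'rV[R]_d) : `|gauss t w * cos (dotrV w z + th)| <= gauss t w.
  rewrite normrM ger0_norm ?gauss_ge0// ler_piMr ?gauss_ge0//.
  by rewrite ler_norml cos_le1 cos_geN1.
exact: (le_summable (@meas_cos d z th) h (summable_gauss_rV d)).
Qed.

Let gauss_line (z th : R) :
  \int[mu]_x (expR (- (t * x) ^+ 2) * cos (x * z + th)) =
  Num.sqrt pi / t * expR (- (z ^+ 2 / (4 * t ^+ 2))) * cos th.
Proof.
have tn0 : t != 0 by rewrite gt_eqF.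
pose f (x : R) := expR (- x ^+ 2) * cos ((z / t) * x).
pose g (x : R) := expR (- x ^+ 2) * sin ((z / t) * x).
have cf : continuous f by apply: cont_der => x; eexists; rewrite /f; der_auto.
have cg : continuous g by apply: cont_der => x; eexists; rewrite /g; der_auto.
have fg x : `|f x| <= expR (- x ^+ 2).
  rewrite /f normrM ger0_norm ?expR_ge0// ler_piMr ?expR_ge0//.
  by rewrite ler_norml cos_le1 cos_geN1.
have gg x : `|g x| <= expR (- x ^+ 2).
  rewrite /g normrM ger0_norm ?expR_ge0// ler_piMr ?expR_ge0//.
  by rewrite ler_norml sin_le1 sin_geN1.
have sf : summable_fun mu f := @le_summable _ _ R mu _ _ (cont_meas cf) fg integrableT_gauss.
have sg : summable_fun mu g := @le_summable _ _ R mu _ _ (cont_meas cg) gg integrableT_gauss.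
have sf' : summable_fun mu (fun x => cos th * f (0 + t * x)).
  exact/summable_funZ/(@summable_affine R 0 t f tn0 sf).
have sg' : summable_fun mu (fun x => sin th * g (0 + t * x)).
  exact/summable_funZ/(@summable_affine R 0 t g tn0 sg).
have ef := @Rintegral_affine R 0 t f tn0 (cont_meas cf).
have eg := @Rintegral_affine R 0 t g tn0 (cont_meas cg).
transitivity (\int[mu]_x (cos th * f (0 + t * x) - sin th * g (0 + t * x))).
  apply: eq_Rintegral => x _; rewrite /f /g !add0r cosD.
  by rewrite (_ : z / t * (t * x) = x * z); [ring|field].
rewrite (RintegralB measurableT sf' sg').
rewrite (RintegralZl _ measurableT (@summable_affine R 0 t f tn0 sf)).
rewrite (RintegralZl _ measurableT (@summable_affine R 0 t g tn0 sg)).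
move: ef eg; rewrite gauss_cos gauss_sin (gtr0_norm t0) => ef eg.
have -> : \int[mu]_x g (0 + t * x) = 0.
  by apply: (mulfI tn0); rewrite eg mulr0.
have -> : \int[mu]_x f (0 + t * x) = Num.sqrt pi * expR (- (z / t) ^+ 2 / 4) / t.
  by apply: (mulfI tn0); rewrite ef; field.
rewrite mulr0 subr0 (_ : - (z / t) ^+ 2 / 4 = - (z ^+ 2 / (4 * t ^+ 2))); last by field.
by ring.
Qed.

(** The Gaussian factors over the coordinates; carrying the phase th along makes the
    induction on d go through with cosines alone, each coordinate shifting the phase of the
    next ones. *)
Lemma gauss_transform d (z : 'rV[R]_d) (th : R) :
  \int[rV_lebesgue d]_w (gauss t w * cos (dotrV w z + th)) =
  (Num.sqrt pi / t) ^+ d * gauss (2 * t)^-1 z * cos th.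
Proof.
have tn0 : t != 0 by rewrite gt_eqF.
elim: d => [|d IHd] in z th *.
  rewrite /Rintegral /= integral_dirac//=; last first.
    by apply/measurable_EFinP; exact: meas_cos.
  by rewrite indicT mul1r expr0 mul1r /gauss /dotrV !big_ord0 !mulr0 add0r.
rewrite (Rintegral_rVS (summable_gauss_cos z th)).
set z' := (\row_i z ord0 (lift ord0 i)).
transitivity (\int[mu]_x ((Num.sqrt pi / t) ^+ d * gauss (2 * t)^-1 z' *
    (expR (- (t * x) ^+ 2) * cos (x * z ord0 ord0 + th)))).
  apply: eq_Rintegral => x _.
  transitivity (\int[rV_lebesgue d]_w (expR (- (t * x) ^+ 2) *
      (gauss t w * cos (dotrV w z' + (x * z ord0 ord0 + th))))).
    apply: eq_Rintegral => w _; rewrite gauss_consrV dotrV_consrV /= -/z' mulrA.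
    by congr (_ * cos _); ring.
  rewrite (RintegralZl _ measurableT (@summable_gauss_cos d z' _)) IHd; ring.
have s1 : summable_fun mu (fun x => expR (- (t * x) ^+ 2) * cos (x * z ord0 ord0 + th)).
  have h (x : R) : `|expR (- (t * x) ^+ 2) * cos (x * z ord0 ord0 + th)| <= expR (- (t * x) ^+ 2).
    rewrite normrM ger0_norm ?expR_ge0// ler_piMr ?expR_ge0//.
    by rewrite ler_norml cos_le1 cos_geN1.
  apply: (@le_summable _ _ R mu _ _ _ h (summable_gauss t0)).
  by apply: cont_meas; apply: cont_der => x; eexists; der_auto.
rewrite (RintegralZl _ measurableT s1) gauss_line.
have -> : gauss (2 * t)^-1 z = expR (- (z ord0 ord0 ^+ 2 / (4 * t ^+ 2))) * gauss (2 * t)^-1 z'.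
  rewrite /gauss -expRD; congr expR; rewrite /dotrV big_ord_recl.
  rewrite (eq_bigr (fun i => z' ord0 i * z' ord0 i)); last by move=> i _; rewrite mxE.
  by field.
by rewrite (exprS (Num.sqrt pi / t)); move: (_ ^+ d) => A; ring.
Qed.

Lemma gauss_mass d : \int[rV_lebesgue d]_w gauss t w = (Num.sqrt pi / t) ^+ d.
Proof.
have := @gauss_transform d 0 0; rewrite cos0 mulr1.
have -> : gauss (2 * t)^-1 (0 : 'rV[R]_d) = 1.
  rewrite /gauss /dotrV big1 ?mulr0 ?oppr0 ?expR0// => i _; by rewrite mxE mulr0.
rewrite mulr1 => <-; apply: eq_Rintegral => w _.
rewrite /dotrV big1 ?add0r ?cos0 ?mulr1// => i _; by rewrite mxE mulr0.
Qed.

End width.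

End gaussian_space.

(** * Fourier inversion *)

(** From the term of degree d + 1 of the exponential series. *)
Lemma gauss_decay (R : realType) (d : nat) (c : R) : 0 < c ->
  exists2 C : R, 0 <= C & forall n : nat, n.+1%:R ^+ d * expR (- (c * n.+1%:R ^+ 2)) <= C / n.+1%:R.
Proof.
move=> c0; exists (d.+1`!%:R / c ^+ d.+1).
  by rewrite divr_ge0 ?exprn_ge0// ltW.
move=> n; set m : R := n.+1%:R.
have m0 : 0 < m by rewrite ltr0n.
have m1 : 1 <= m by rewrite ler1n.
have x0 : 0 <= c * m ^+ 2 by rewrite mulr_ge0 ?sqr_ge0// ltW.
have f0 : 0 < d.+1`!%:R :> R by rewrite ltr0n fact_gt0.
rewrite expRN ler_pdivlMr// mulrAC -exprSr ler_pdivrMr ?expR_gt0//.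
have c1 : 0 < c ^+ d.+1 by rewrite exprn_gt0.
apply: le_trans (_ : d.+1`!%:R / c ^+ d.+1 * ((c * m ^+ 2) ^+ d.+1 / d.+1`!%:R) <= _).
  have E (A B F : R) : A != 0 -> F != 0 -> F / A * (A * B / F) = B.
    by move=> A0 F0; field; rewrite ?A0 ?F0.
  rewrite (exprMn d.+1 c) -exprM E ?gt_eqF//.
  by apply: ler_weXn2l => //; rewrite leq_pmull.
apply: ler_wpM2l; first by rewrite divr_ge0 ?ltW.
by apply: le_trans (expR_ge1Dxn d x0); rewrite lerDr.
Qed.

Section inversion.
Context {R : realType} (d : nat).
Notation nu := (@rV_lebesgue R d).
Implicit Types (x y z w : 'rV[R]_d).

Lemma dotrVBr w x y : dotrV w (x - y) = dotrV w x - dotrV w y.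
Proof. by rewrite /dotrV -sumrB; apply: eq_bigr => i _; rewrite !mxE mulrBr. Qed.

Lemma measurable_dotrV2 :
  measurable_fun setT (fun p : 'rV[R]_d * 'rV[R]_d => dotrV p.1 p.2).
Proof.
apply: measurable_sum => i; apply: measurable_funM.
  exact: (measurableT_comp (measurable_coord i)).
exact: (measurableT_comp (measurable_coord i)).
Qed.

(** The integrand is replaced by its truncation to [-g, g], which agrees with it almost
    everywhere. *)
Lemma le_ae_Rintegral (f g : 'rV[R]_d -> R) : measurable_fun setT f -> summable_fun nu g ->
  (forall y, 0 <= g y) ->
  {ae nu, forall y, `|f y| <= g y} -> `|\int[nu]_y f y| <= \int[nu]_y g y.
Proof.
move=> mf sg g0 fg; have mg := summable_meas sg.
pose h y := Num.max (- g y) (Num.min (f y) (g y)).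
have mh : measurable_fun setT h.
  by apply: measurable_maxr; [exact: measurableT_comp|exact: measurable_minr].
have -> : \int[nu]_y f y = \int[nu]_y h y.
  apply: ae_eq_Rintegral => //; apply: filterS fg => y; rewrite ler_norml => /andP[a b].
  by rewrite /h (min_l b) max_r.
apply: norm_Rintegral_le => // y; rewrite /h ler_norml le_max lexx/= ge_max.
by rewrite ge_min lexx orbT andbT; have := g0 y; lra.
Qed.

Section at_continuity_point.
Variable v : 'rV[R]_d -> R.
Hypothesis sv : summable_fun nu v.
Let P w := \int[nu]_y (v y * cos (dotrV w y)).
Let Q w := \int[nu]_y (v y * sin (dotrV w y)).
Hypothesis sP : summable_fun nu P.
Hypothesis sQ : summable_fun nu Q.
Variables (x : 'rV[R]_d) (vx : R).
Hypothesis v_at_x : forall eta : R, 0 < eta -> exists2 delta : R, 0 < delta &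
  {ae nu, forall y, (forall i, `|y ord0 i - x ord0 i| < delta) -> `|v y - vx| <= eta}.

Let mv : measurable_fun setT v. Proof. exact: summable_meas sv. Qed.

(** The Fourier transform of the Gaussian weight of parameter t, centred at x. *)
Let kernel (t : R) y : R := (Num.sqrt pi / t) ^+ d * gauss (2 * t)^-1 (y - x).

Let mcosd (th : R) w : measurable_fun setT (fun y => cos (dotrV w y + th)).
Proof.
apply: (measurableT_comp (cont_meas (@continuous_cos R))); apply: measurable_funD => //.
have := measurableT_comp measurable_dotrV2 (pair1_measurable w); exact.
Qed.

Let msind w : measurable_fun setT (fun y => sin (dotrV w y)).
Proof.
apply: (measurableT_comp (cont_meas (@continuous_sin R))).
have := measurableT_comp measurable_dotrV2 (pair1_measurable w); exact.
Qed.

Let scos w : summable_fun nu (fun y => v y * cos (dotrV w y)).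
Proof.
under eq_fun do rewrite mulrC; apply: (@summable_funM _ _ _ _ _ _ 1) => //.
  by have := mcosd 0 w; under eq_fun do rewrite addr0.
by move=> y; rewrite ler_norml cos_le1 cos_geN1.
Qed.

Let ssin w : summable_fun nu (fun y => v y * sin (dotrV w y)).
Proof.
under eq_fun do rewrite mulrC; apply: (@summable_funM _ _ _ _ _ _ 1) => //.
by move=> y; rewrite ler_norml sin_le1 sin_geN1.
Qed.

(** Exchanging the two integrals, with cos(w.y) cos(w.x) + sin(w.y) sin(w.x) equal to
    cos(w.(y - x)). *)
Let smoothed (t : R) : 0 < t ->
  \int[nu]_w (gauss t w * (P w * cos (dotrV w x) + Q w * sin (dotrV w x))) =
  \int[nu]_y (v y * kernel t y).
Proof.
move=> t0.
pose F (p : 'rV[R]_d * 'rV[R]_d) := gauss t p.1 * (v p.2 * cos (dotrV p.1 p.2 - dotrV p.1 x)).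
have mF : measurable_fun setT F.
  apply: measurable_funM; first exact: (measurableT_comp (measurable_gauss t)).
  apply: measurable_funM; first exact: (measurableT_comp mv).
  apply: (measurableT_comp (cont_meas (@continuous_cos R))); apply: measurable_funB.
    exact: measurable_dotrV2.
  exact: (measurableT_comp (measurable_dotrV x)).
have sc w : summable_fun nu (fun y => v y * cos (dotrV w y - dotrV w x)).
  under eq_fun do rewrite mulrC; apply: (@summable_funM _ _ _ _ _ _ 1) => //.
  by move=> y; rewrite ler_norml cos_le1 cos_geN1.
have sF : summable_fun (nu \x nu)%E F.
  apply: (@summable_prod _ _ _ _ R nu nu F (fun w => gauss t w * \int[nu]_y `|v y|)) => //.
  - by move=> w; exact: (summable_funZ (gauss t w) (sc w)).
  - move=> w; rewrite -(RintegralZl _ measurableT (summable_norm sv)).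
    apply: le_Rintegral => //.
    + exact: (summable_norm (summable_funZ (gauss t w) (sc w))).
    + exact: (summable_funZ _ (summable_norm sv)).
    move=> y _; rewrite /F/= normrM ger0_norm ?gauss_ge0// ler_wpM2l ?gauss_ge0//.
    by rewrite normrM ler_piMr// ler_norml cos_le1 cos_geN1.
  - under eq_fun do rewrite mulrC; apply: summable_funZ; exact: summable_gauss_rV.
transitivity (\int[nu]_w \int[nu]_y F (w, y)).
  apply: eq_Rintegral => w _; rewrite /F/= (RintegralZl _ measurableT (sc w)).
  congr (_ * _).
  transitivity (\int[nu]_y (cos (dotrV w x) * (v y * cos (dotrV w y)) +
                            sin (dotrV w x) * (v y * sin (dotrV w y)))).
    rewrite (RintegralD measurableT (summable_funZ _ (scos w)) (summable_funZ _ (ssin w))).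
    rewrite (RintegralZl _ measurableT (scos w)) (RintegralZl _ measurableT (ssin w)).
    by rewrite /P /Q; ring.
  by apply: eq_Rintegral => y _; rewrite cosB; ring.
rewrite (Rfubini sF); apply: eq_Rintegral => y _; rewrite /F/=.
transitivity (\int[nu]_w (v y * (gauss t w * cos (dotrV w (y - x) + 0)))).
  by apply: eq_Rintegral => w _; rewrite addr0 dotrVBr; ring.
rewrite (RintegralZl _ measurableT (@summable_gauss_cos R t t0 d (y - x) 0)).
by rewrite gauss_transform// cos0 mulr1.
Qed.

Let sgauss_shift (t : R) : 0 < t -> summable_fun nu (fun y => gauss t (y - x)).
Proof.
move=> t0; have := @summable_rV_affine R d (- x) 1 _ (oner_neq0 R) (summable_gauss_rV t0 d).
by under eq_fun do rewrite scale1r addrC.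
Qed.

Let gauss_shift_mass (t : R) : 0 < t ->
  \int[nu]_y gauss t (y - x) = (Num.sqrt pi / t) ^+ d.
Proof.
move=> t0; rewrite -(gauss_mass t0).
rewrite -(@Rintegral_rV_affine R d (- x) 1 _ (oner_neq0 R) (measurable_gauss t)).
rewrite normr1 expr1n mul1r; apply: eq_Rintegral => y _.
by rewrite scale1r addrC.
Qed.

Let t_ (n : nat) : R := n.+1%:R^-1.

Let t_gt0 n : 0 < t_ n. Proof. by rewrite invr_gt0 ltr0n. Qed.

Let smoothed_cvg :
  \int[nu]_w (gauss (t_ n) w * (P w * cos (dotrV w x) + Q w * sin (dotrV w x))) @[n --> \oo] -->
  \int[nu]_w (P w * cos (dotrV w x) + Q w * sin (dotrV w x)).
Proof.
have mc : measurable_fun setT (fun w => cos (dotrV w x)).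
  by apply: (measurableT_comp (cont_meas (@continuous_cos R))); exact: measurable_dotrV.
have ms : measurable_fun setT (fun w => sin (dotrV w x)).
  by apply: (measurableT_comp (cont_meas (@continuous_sin R))); exact: measurable_dotrV.
have m0 : measurable_fun setT (fun w => P w * cos (dotrV w x) + Q w * sin (dotrV w x)).
  by apply: measurable_funD; apply: measurable_funM => //; [exact: (summable_meas sP)|exact: (summable_meas sQ)].
apply: (@dominated_Rintegral _ _ R nu _ _ (fun w => `|P w| + `|Q w|)) => //.
- by move=> n; apply: measurable_funM => //; exact: measurable_gauss.
- apply: aeW => w; rewrite -[X in _ --> X]mul1r; apply: cvgM; last exact: cvg_cst.
  have h1 : t_ n @[n --> \oo] --> 0 by exact: cvg_harmonic.
  have h2 : - (t_ n ^+ 2 * dotrV w w) @[n --> \oo] --> - (0 * 0 * dotrV w w).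
    by apply: cvgN; apply: cvgM; [exact: (cvgM h1 h1)|exact: cvg_cst].
  rewrite !mul0r oppr0 in h2; rewrite -[X in _ --> X]expR0.
  exact: (cvg_comp _ _ h2 (@continuous_expR R 0)).
- exact: (summable_funD (summable_norm sP) (summable_norm sQ)).
- move=> n w; rewrite normrM ger0_norm ?gauss_ge0//.
  apply: le_trans (_ : `|P w * cos (dotrV w x) + Q w * sin (dotrV w x)| <= _).
    by rewrite ler_piMl ?gauss_le1.
  exact: trig_le.
Qed.

Let sqrt_pi2 : Num.sqrt pi * Num.sqrt pi = pi :> R.
Proof. by rewrite -expr2 sqr_sqrtr// pi_ge0. Qed.

Let skernel t : 0 < t -> summable_fun nu (kernel t).
Proof.
move=> t0; apply: summable_funZ; apply: sgauss_shift.
by rewrite invr_gt0 mulr_gt0.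
Qed.

Let kernel_mass t : 0 < t -> \int[nu]_y kernel t y = (2 * pi) ^+ d.
Proof.
move=> t0; have s0 : 0 < (2 * t)^-1 by rewrite invr_gt0 mulr_gt0.
rewrite (RintegralZl _ measurableT (sgauss_shift s0)) (gauss_shift_mass s0).
rewrite -exprMn; congr (_ ^+ d); rewrite -[in RHS]sqrt_pi2; field.
by rewrite gt_eqF.
Qed.

Let kernel_ge0 t y : 0 < t -> 0 <= kernel t y.
Proof.
by move=> t0; rewrite mulr_ge0 ?gauss_ge0// exprn_ge0// divr_ge0 ?sqrtr_ge0// ltW.
Qed.

(** The kernels form an approximate identity. Near x, v is within eta of vx. Far from x the
    kernel is uniformly small, which controls the contribution of v, and is also a small
    multiple of a Gaussian of larger width, which controls the contribution of the constant
    vx. *)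
Let approx_identity (eta : R) : 0 < eta -> exists B : R, forall n,
  `|\int[nu]_y (v y * kernel (t_ n) y) - (2 * pi) ^+ d * vx| <= eta * (2 * pi) ^+ d + B / n.+1%:R.
Proof.
move=> eta0; have [delta delta0 near_x] := v_at_x eta0.
have c1 : 0 < delta ^+ 2 / 4 by rewrite divr_gt0 ?exprn_gt0.
have c2 : 0 < delta ^+ 2 / 8 by rewrite divr_gt0 ?exprn_gt0.
have [C1 C10 hC1] := @gauss_decay R d _ c1.
have [C2 C20 hC2] := @gauss_decay R 0 _ c2.
exists ((Num.sqrt pi) ^+ d * C1 * (\int[nu]_y `|v y|) + `|vx| * C2 * (Num.sqrt 8 * pi) ^+ d) => n.
have t0 := t_gt0 n; set t := t_ n in t0 *; set m : R := n.+1%:R.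
have m0 : 0 < m by rewrite ltr0n.
have tE : t^-1 = m by rewrite /t /t_ invrK.
have s80 : 0 < Num.sqrt 8 :> R by rewrite sqrtr_gt0.
have s88 : Num.sqrt 8 ^+ 2 = 8 :> R by rewrite sqr_sqrtr.
(* the Gaussian of parameter s is the square root of the one of parameter 1/(2t) *)
pose s := (Num.sqrt 8 * t)^-1.
have s0 : 0 < s by rewrite invr_gt0 mulr_gt0.
pose a1 := (Num.sqrt pi / t) ^+ d * expR (- (delta ^+ 2 / 4 * m ^+ 2)).
pose a2 := expR (- (delta ^+ 2 / 8 * m ^+ 2)).
pose tail y := (Num.sqrt pi / t) ^+ d * gauss s (y - x).
have p0 : 0 <= (Num.sqrt pi / t) ^+ d.
  by rewrite exprn_ge0// divr_ge0 ?sqrtr_ge0// ltW.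
have tail0 y : 0 <= tail y by rewrite mulr_ge0 ?gauss_ge0.
have stail : summable_fun nu tail by apply: summable_funZ; exact: sgauss_shift.
have tail_mass : \int[nu]_y tail y = (Num.sqrt 8 * pi) ^+ d.
  rewrite (RintegralZl _ measurableT (sgauss_shift s0)) (gauss_shift_mass s0).
  rewrite -exprMn; congr (_ ^+ d); rewrite /s -[in RHS]sqrt_pi2; field.
  by rewrite !gt_eqF.
have a10 : 0 <= a1 by rewrite mulr_ge0 ?expR_ge0.
have a20 : 0 <= a2 by exact: expR_ge0.
pose G y := eta * kernel t y + (a1 * `|v y| + (`|vx| * a2) * tail y).
have sk := skernel t0.
have svk : summable_fun nu (fun y => v y * kernel t y).
  under eq_fun do rewrite mulrC.
  apply: (@summable_funM _ _ _ _ _ _ ((Num.sqrt pi / t) ^+ d)) => //.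
    exact: (summable_meas sk).
  by move=> y; rewrite ger0_norm ?kernel_ge0// ler_piMr ?gauss_le1.
have sG1 : summable_fun nu (fun y => a1 * `|v y|) by exact/summable_funZ/summable_norm.
have sG2 : summable_fun nu (fun y => (`|vx| * a2) * tail y) by exact/summable_funZ.
have sG12 := summable_funD sG1 sG2.
have sG : summable_fun nu G by exact: (summable_funD (summable_funZ eta sk) sG12).
have -> : \int[nu]_y (v y * kernel t y) - (2 * pi) ^+ d * vx =
    \int[nu]_y (v y * kernel t y - vx * kernel t y).
  rewrite (RintegralB measurableT svk (summable_funZ vx sk)).
  by rewrite (RintegralZl _ measurableT sk) kernel_mass// (mulrC vx).
apply: le_trans (_ : \int[nu]_y G y <= _).
  apply: le_ae_Rintegral => //.
  - exact: (summable_meas (summable_funB svk (summable_funZ vx sk))).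
  - move=> y; apply: addr_ge0; first exact: (mulr_ge0 (ltW eta0) (kernel_ge0 y t0)).
    apply: addr_ge0; first exact: mulr_ge0.
    by apply: mulr_ge0 => //; exact: mulr_ge0.
  apply: filterS near_x => y hy; rewrite -mulrBl normrM (ger0_norm (kernel_ge0 _ t0)).
  have [/forallP near_y|] := boolP [forall i, `|y ord0 i - x ord0 i| < delta].
    apply: ler_wpDr.
      apply: addr_ge0; first exact: mulr_ge0.
      by apply: mulr_ge0 => //; exact: mulr_ge0.
    by rewrite ler_wpM2r ?kernel_ge0 ?hy.
  rewrite negb_forall => /existsP[i]; rewrite -leNgt => far.
  have N0 : delta ^+ 2 <= dotrV (y - x) (y - x).
    rewrite /dotrV (bigD1 i)//= !mxE -expr2 -[(_ - _) ^+ 2]real_normK ?num_real//.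
    rewrite ler_wpDr ?sumr_ge0// => [j _|]; first exact: sqr_ge0.
    by rewrite ler_sqr ?nnegrE ?(ltW delta0).
  have k1 : kernel t y <= a1.
    rewrite /kernel /a1 ler_wpM2l// ler_expR lerN2 -tE.
    rewrite (_ : _ / 4 * _ = (2 * t)^-1 ^+ 2 * delta ^+ 2); last by field; rewrite gt_eqF.
    by rewrite ler_wpM2l ?sqr_ge0.
  have k2 : kernel t y <= a2 * tail y.
    rewrite /kernel /a2 /tail mulrCA ler_wpM2l// -expRD ler_expR -tE -opprD lerN2.
    have -> : s ^+ 2 = (8 * t ^+ 2)^-1 by rewrite /s exprVn exprMn s88.
    apply: le_trans (_ : (8 * t ^+ 2)^-1 * dotrV (y - x) (y - x) + (8 * t ^+ 2)^-1 * dotrV (y - x) (y - x) <= _).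
      rewrite lerD2r (_ : _ / 8 * _ = (8 * t ^+ 2)^-1 * delta ^+ 2); last by field; rewrite gt_eqF.
      by rewrite ler_wpM2l// invr_ge0 mulr_ge0 ?sqr_ge0.
    by rewrite le_eqVlt; apply/orP; left; apply/eqP; field; rewrite gt_eqF.
  apply: le_trans (_ : (`|v y| + `|vx|) * kernel t y <= _).
    by rewrite ler_wpM2r ?kernel_ge0 ?ler_normB.
  rewrite mulrDl; apply: ler_wpDl; first by rewrite mulr_ge0 ?kernel_ge0// ltW.
  by rewrite lerD//; [rewrite mulrC ler_wpM2r|rewrite -mulrA ler_wpM2l].
rewrite (RintegralD measurableT (summable_funZ eta sk) sG12) (RintegralD measurableT sG1 sG2).
rewrite (RintegralZl _ measurableT sk) (RintegralZl _ measurableT (summable_norm sv)).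
rewrite (RintegralZl _ measurableT stail) tail_mass kernel_mass// lerD2l mulrDl.
have I0 : 0 <= \int[nu]_y `|v y| by apply: Rintegral_ge0.
have p8 : 0 <= (Num.sqrt 8 * pi) ^+ d :> R by rewrite exprn_ge0// mulr_ge0 ?pi_ge0 ?ltW.
apply: lerD.
  rewrite [leRHS]mulrAC; apply: ler_wpM2r; first exact: I0.
  rewrite /a1 exprMn tE -[leRHS]mulrA -[leLHS]mulrA; apply: ler_wpM2l; last exact: hC1.
  by rewrite exprn_ge0 ?sqrtr_ge0.
rewrite [leRHS]mulrAC; apply: ler_wpM2r; first exact: p8.
rewrite -mulrA; apply: ler_wpM2l => //.
by have := hC2 n; rewrite expr0 mul1r.
Qed.

(** The smoothed integrals converge both to the integral without weight, by domination, and
    to (2 pi)^d vx. *)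
Lemma fourier_inversion :
  \int[nu]_w (P w * cos (dotrV w x) + Q w * sin (dotrV w x)) = (2 * pi) ^+ d * vx.
Proof.
set L := LHS.
have pd : 0 < (2 * pi) ^+ d :> R by rewrite exprn_gt0// mulr_gt0 ?pi_gt0.
have bound (eta : R) : 0 < eta -> `|L - (2 * pi) ^+ d * vx| <= eta * (2 * pi) ^+ d.
  move=> eta0; have [B hB] := approx_identity eta0.
  have l1 : `|\int[nu]_y (v y * kernel (t_ n) y) - (2 * pi) ^+ d * vx| @[n --> \oo] -->
      `|L - (2 * pi) ^+ d * vx|.
    apply: cvg_norm; apply: cvgB; last exact: cvg_cst.
    under eq_fun do rewrite -(smoothed (t_gt0 _)); exact: smoothed_cvg.
  have l2 : eta * (2 * pi) ^+ d + B / n.+1%:R @[n --> \oo] --> eta * (2 * pi) ^+ d + B * 0.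
    by apply: cvgD; [exact: cvg_cst|apply: cvgM; [exact: cvg_cst|exact: cvg_harmonic]].
  rewrite mulr0 addr0 in l2.
  by apply: (ler_cvg_to l1 l2); exact: nearW.
apply/eqP; rewrite -subr_eq0 -normr_le0; apply/ler_addgt0Pr => e e0; rewrite add0r.
have := bound (e / (2 * pi) ^+ d) (divr_gt0 e0 pd).
by rewrite divfK ?gt_eqF.
Qed.

End at_continuity_point.
End inversion.

(** * Derivatives of trigonometric integrals *)

Section trigonometric_integrals.
Context {R : realType} {d : nat}.
Notation nu := (@rV_lebesgue R d).
Implicit Types (P Q : 'rV[R]_d -> R) (x w : 'rV[R]_d).

Lemma is_derive_line (f : 'rV[R]_d -> R) x (u : 'rV[R]_d) (a : R) :
  der (fun h => f (h *: u + x)) 0 a -> is_derive x u f a.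
Proof.
move=> [h1 h2]; split; first exact: (derivable1P f x u).2 h1.
rewrite -h2 /derive; set g1 := fun h => _; set g2 := fun h => h^-1 *: _.
suff -> : g1 = g2 by [].
by apply/funext => h; rewrite /g1 /g2 /= addr0 scale0r add0r [_%:A]mulr1.
Qed.

Definition trig_integral P Q x := \int[nu]_w (P w * cos (dotrV w x) + Q w * sin (dotrV w x)).

Let mcos x : measurable_fun setT (fun w => cos (dotrV w x)).
Proof.
by apply: (measurableT_comp (cont_meas (@continuous_cos R))); exact: measurable_dotrV.
Qed.

Let msin x : measurable_fun setT (fun w => sin (dotrV w x)).
Proof.
by apply: (measurableT_comp (cont_meas (@continuous_sin R))); exact: measurable_dotrV.
Qed.

Lemma summable_trig_integrand P Q x : measurable_fun setT P -> measurable_fun setT Q ->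
  summable_fun nu (fun w => `|P w| + `|Q w|) ->
  summable_fun nu (fun w => P w * cos (dotrV w x) + Q w * sin (dotrV w x)).
Proof.
move=> mP mQ; apply: le_summable => [|w]; last exact: trig_le.
by apply: measurable_funD; apply: measurable_funM.
Qed.

Lemma dotrV_line w x (i : 'I_d) h :
  dotrV w (h *: delta_mx ord0 i + x) = h * w ord0 i + dotrV w x.
Proof.
rewrite /dotrV (eq_bigr (fun j => h * (w ord0 j * (j == i)%:R) + w ord0 j * x ord0 j)).
  rewrite big_split/= -mulr_sumr (bigD1 i)//= eqxx mulr1 big1 ?addr0// => j /negPf->.
  by rewrite mulr0.
by move=> j _; rewrite !mxE/=; ring.
Qed.

(** Along the line x + h e_i the phase is w.x + h w_i. *)
Lemma trig_integral_partial P Q x i : measurable_fun setT P -> measurable_fun setT Q ->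
  summable_fun nu (fun w => `|P w| + `|Q w|) ->
  summable_fun nu (fun w => `|w ord0 i| * (`|P w| + `|Q w|)) ->
  is_derive x (delta_mx ord0 i) (trig_integral P Q)
    (trig_integral (fun w => w ord0 i * Q w) (fun w => - (w ord0 i * P w)) x).
Proof.
move=> mP mQ s0 s1; apply: is_derive_line.
pose df h w := (w ord0 i * Q w) * cos (dotrV w (h *: delta_mx ord0 i + x)) +
  (- (w ord0 i * P w)) * sin (dotrV w (h *: delta_mx ord0 i + x)).
have -> : trig_integral (fun w => w ord0 i * Q w) (fun w => - (w ord0 i * P w)) x =
    \int[nu]_w df 0 w.
  by apply: eq_Rintegral => w _; rewrite /df scale0r add0r.
apply: (@der_under_integral _ _ _ nu (fun h w =>
  P w * cos (dotrV w (h *: delta_mx ord0 i + x)) +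
  Q w * sin (dotrV w (h *: delta_mx ord0 i + x))) df _ 0 _ _ s1).
- move=> z w; rewrite /df; under eq_fun do rewrite dotrV_line.
  by rewrite dotrV_line; der_auto => /=; ring.
- by move=> z; exact: summable_trig_integrand.
- move=> z w; apply: le_trans (trig_le _ _ _) _; rewrite normrN !normrM; lra.
Qed.

(** Differentiation in direction i sends (P, Q) to (w_i Q, - w_i P). *)
Fixpoint amplitudes (l : seq 'I_d) P Q : ('rV[R]_d -> R) * ('rV[R]_d -> R) :=
  if l is i :: l' then let a := amplitudes l' P Q in
    (fun w => w ord0 i * a.2 w, fun w => - (w ord0 i * a.1 w))
  else (P, Q).

Lemma measurable_amplitudes l P Q : measurable_fun setT P -> measurable_fun setT Q ->
  measurable_fun setT (amplitudes l P Q).1 /\ measurable_fun setT (amplitudes l P Q).2.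
Proof.
move=> mP mQ; elim: l => [//|i l [m1 m2]] /=; split.
  by apply: measurable_funM => //; exact: measurable_coord.
apply: measurableT_comp => //.
by apply: measurable_funM => //; exact: measurable_coord.
Qed.

Lemma coord_le_l1norm w i : `|w ord0 i| <= l1norm w.
Proof. by rewrite /l1norm (bigD1 i)//= lerDl sumr_ge0. Qed.

Lemma amplitudes_le l P Q w :
  `|(amplitudes l P Q).1 w| + `|(amplitudes l P Q).2 w| <=
  (1 + l1norm w) ^+ size l * (`|P w| + `|Q w|).
Proof.
elim: l => [|i l IH] /=; first by rewrite expr0 mul1r.
rewrite normrN !normrM -mulrDr exprS -mulrA addrC.
have := coord_le_l1norm w i; have := l1norm_ge0 w => h0 h1.
apply: ler_pM => //.
by apply: le_trans h1 _; rewrite lerDr.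
Qed.

Lemma weight_le n P Q : measurable_fun setT P -> measurable_fun setT Q ->
  summable_fun nu (fun w => (1 + l1norm w) ^+ n.+1 * (`|P w| + `|Q w|)) ->
  summable_fun nu (fun w => (1 + l1norm w) ^+ n * (`|P w| + `|Q w|)).
Proof.
move=> mP mQ; apply: le_summable.
  apply: measurable_funM; last by apply: measurable_funD; exact: measurableT_comp.
  by apply: measurable_funX; apply: measurable_funD => //; exact: measurable_l1norm.
move=> w; have := l1norm_ge0 w => h0.
rewrite ger0_norm ?mulr_ge0 ?exprn_ge0 ?addr_ge0// ler_wpM2r ?addr_ge0//.
by rewrite ler_weXn2l// lerDl.
Qed.

(** By induction on l. Each partial derivative is computed from an identity valid on the
    open set Omega, hence near x. *)
Lemma partials_trig_integral (Omega : set 'rV[R]_d) (v : 'rV[R]_d -> R) P Q l :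
  open Omega -> measurable_fun setT P -> measurable_fun setT Q ->
  summable_fun nu (fun w => (1 + l1norm w) ^+ size l * (`|P w| + `|Q w|)) ->
  (forall x, Omega x -> v x = trig_integral P Q x) ->
  forall x, Omega x -> partials_exist l v x /\
    partials l v x = trig_integral (amplitudes l P Q).1 (amplitudes l P Q).2 x.
Proof.
move=> oO mP mQ; elim: l => [|i l IH] sw vE x Ox; first by split => //; exact: vE.
have {}IH := IH (weight_le mP mQ sw) vE.
have [m1 m2] := measurable_amplitudes l mP mQ.
have nO : \forall y \near x, Omega y by exact: open_nbhs_nbhs.
have D : is_derive x (delta_mx ord0 i)
    (trig_integral (amplitudes l P Q).1 (amplitudes l P Q).2)
    (trig_integral (amplitudes (i :: l) P Q).1 (amplitudes (i :: l) P Q).2 x).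
  apply: trig_integral_partial => //.
    apply: le_summable (weight_le mP mQ sw) => [|w].
      by apply: measurable_funD; exact: measurableT_comp.
    by rewrite ger0_norm ?addr_ge0//; exact: amplitudes_le.
  apply: le_summable sw => [|w].
    apply: measurable_funM; last by apply: measurable_funD; exact: measurableT_comp.
    by apply: measurableT_comp => //; exact: measurable_coord.
  rewrite ger0_norm ?mulr_ge0 ?addr_ge0//.
  have := amplitudes_le (i :: l) P Q w; rewrite /= normrN !normrM -mulrDr.
  by rewrite (addrC `|(amplitudes l P Q).2 w|).
have E : \forall y \near x, trig_integral (amplitudes l P Q).1 (amplitudes l P Q).2 y =
    partials l v y.
  by apply: filterS nO => y /IH[_ ->].
have [D1 D2] := near_eq_is_derive E D.
by split; [split; [apply: filterS nO => y /IH[]|exact: D1]|exact: D2].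
Qed.

End trigonometric_integrals.

(** * Derivatives of the activation function and of ridge functions *)

Section activation_derivatives.
Context {R : realType}.
Implicit Types (sigma g : R -> R).

Lemma derivable_der g x : derivable g x 1 -> der g x (derive1 g x).
Proof. by move=> dg; rewrite derive1E; exact: derivableP. Qed.

(** A function with constant derivative c is affine of slope c, hence unbounded unless
    c = 0. *)
Lemma derive1_nonconstant g (M : R) : (forall x, derivable g x 1) -> (forall x, `|g x| <= M) ->
  (exists x y, g x != g y) -> exists x y, derive1 g x != derive1 g y.
Proof.
move=> dg gM [a [b gab]]; apply: contrapT => cst; move/negP: gab; apply; apply/eqP.
have dcst x : derive1 g x = derive1 g 0.
  by apply: contrapT => /eqP h; apply: cst; exists x, 0.
set c := derive1 g 0 in dcst.
have gE x : g x = g 0 + c * x.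
  have d0 y : der (fun y => g y - c * y) y 0.
    apply: der_eq.
      apply: derD; first exact: (derivable_der (dg y)).
      by apply: derN; apply: derM; [exact: der_cst|exact: der_id].
    by rewrite /= dcst; ring.
  have /= := is_derive_0_is_cst x 0 d0; lra.
suff c0 : c = 0 by rewrite (gE a) (gE b) c0 !mul0r.
apply/eqP; apply: contrapT => /negP c0.
have M0 : 0 <= M by exact: le_trans (normr_ge0 _) (gM 0).
have := gM ((2 * M + 1) / c); rewrite gE mulrC divfK//.
have := gM 0; rewrite !ler_norml => /andP[h1 h2] /andP[h3 h4]; lra.
Qed.

Lemma activation_derivative sigma K : activation_A1 sigma -> (K <= 2)%N ->
  [/\ continuous (derive1n K sigma), exists M, forall x, `|derive1n K sigma x| <= M &
      exists x y, derive1n K sigma x != derive1n K sigma y].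
Proof.
move=> [ds c2 [x [y xy]] bl] K2.
have bd n : (n <= 2)%N -> exists M, forall x, `|derive1n n sigma x| <= M.
  move=> /bl[[M [_ hM]] _]; exists (M + 1) => z; apply: (hM (M + 1)) => //.
  by rewrite ltrDl.
split; last 1 first.
- elim: K K2 => [|n IH] n2; first by exists x, y.
  rewrite /derive1n iterS -/(derive1n n sigma).
  have [M hM] := bd n (ltnW n2).
  by apply: (derive1_nonconstant _ hM (IH (ltnW n2))) => z; exact: ds.
- move: K2; rewrite leq_eqVlt => /orP[/eqP->//|K2].
  by move=> z; apply/differentiable_continuous/derivable1_diffP/ds.
- exact: bd.
Qed.

End activation_derivatives.

Section ridge_partials.
Context {R : realType} {d : nat}.
Implicit Types (w x : 'rV[R]_d).

Definition monomial (l : seq 'I_d) w : R := \prod_(i <- l) w ord0 i.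

Lemma partials_ridge (sigma : R -> R) (l : seq 'I_d) w b :
  (forall n t, (n < size l)%N -> derivable (derive1n n sigma) t 1) ->
  partials l (fun y => sigma (dotrV w y + b)) =
  fun x => monomial l w * derive1n (size l) sigma (dotrV w x + b).
Proof.
elim: l => [|i l IH] ds; first by apply/funext => x; rewrite /monomial big_nil mul1r.
rewrite /= IH => [|n x nl]; last by apply: ds; exact: ltnW.
apply/funext => x; rewrite /partial.
have D : is_derive x (delta_mx ord0 i)
    (fun y => monomial l w * derive1n (size l) sigma (dotrV w y + b))
    (monomial (i :: l) w * derive1n (size l).+1 sigma (dotrV w x + b)).
  apply: is_derive_line; under eq_fun do rewrite dotrV_line.
  apply: der_eq.
    apply: derM; first exact: der_cst.
    apply: (der_comp (derivable_der (ds (size l) _ _))); first exact: ltnSn.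
    by do !der_step.
  rewrite /monomial big_cons /= mul0r add0r -/(derive1n (size l) sigma); ring.
by case: D.
Qed.

Lemma size_directions (k : 'I_d -> nat) : size (directions k) = morder k.
Proof.
rewrite /directions size_flatten /shape -map_comp sumnE big_map.
by rewrite big_enum/=; apply: eq_bigr => i _; rewrite size_nseq.
Qed.

(** A coordinate hyperplane is a box with one side of length 0. *)
Lemma ae_coord_neq0 (i : 'I_d) : {ae rV_lebesgue d, forall w : 'rV[R]_d, w ord0 i != 0}.
Proof.
pose A (j : 'I_d) : set R := if j == i then [set 0] else setT.
have mA j : measurable (A j) by rewrite /A; case: ifP.
have mB : measurable [set w : 'rV[R]_d | w ord0 i = 0].
  have := measurable_coord i; rewrite -[X in measurable X]setTI => h.
  exact: (h _ measurableT _ (measurable_set1 0)).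
exists [set w : 'rV[R]_d | w ord0 i = 0]; split => //.
  transitivity (rV_lebesgue d [set w : 'rV[R]_d | forall j, A j (w ord0 j)]).
    congr (rV_lebesgue d _); apply/seteqP; split => w /=.
      by move=> wi j; rewrite /A; case: eqP => // ->.
    by move/(_ i); rewrite /A eqxx.
  rewrite (rV_lebesgue_box mA) (bigD1 i)//= /A eqxx lebesgue_measure_set1 mul0e //.
by move=> w /= /negP; rewrite negbK => /eqP.
Qed.

Lemma ae_monomial_neq0 l : {ae rV_lebesgue d, forall w : 'rV[R]_d, monomial l w != 0}.
Proof.
elim: l => [|i l IH]; first by apply: aeW => w; rewrite /monomial big_nil oner_eq0.
apply: filterS2 (ae_coord_neq0 i) IH => w h1 h2.
by rewrite /monomial big_cons mulf_neq0.
Qed.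

End ridge_partials.

(** * Functions with an integrable weighted spectrum *)

Section barron_functions.
Context {R : realType} {d : nat}.
Notation nu := (@rV_lebesgue R d).

Lemma coord_le_norm (x : 'rV[R]_d) i : `|x ord0 i| <= `|x|.
Proof.
by rewrite /Num.norm/= mx_normrE; apply/bigmax_geP; right; exists (ord0, i).
Qed.

Lemma bounded_dotrV (Omega : set 'rV[R]_d) : bounded_set Omega ->
  exists2 rho, 0 <= rho & forall x w, Omega x -> `|dotrV w x| <= rho * l1norm w.
Proof.
move=> [M [_ hM]]; exists (`|M| + 1); first by rewrite addr_ge0.
move=> x w Ox; rewrite /l1norm mulr_sumr; apply: le_trans (ler_norm_sum _ _ _) _.
apply: ler_sum => i _; rewrite normrM mulrC ler_wpM2r//.
apply: le_trans (coord_le_norm x i) _; apply: (hM (`|M| + 1)) => //.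
by apply: le_lt_trans (ler_norm M) _; rewrite ltrDl.
Qed.

Lemma near_coord (x : 'rV[R]_d) (A : set 'rV[R]_d) : nbhs x A ->
  exists2 delta : R, 0 < delta & forall y : 'rV[R]_d, (forall i, `|y ord0 i - x ord0 i| < delta) -> A y.
Proof.
move=> /nbhs_ballP[delta /= d0 h]; exists delta => // y hy; apply: h.
split=> // i j; rewrite (ord1 i) /ball/= distrC; exact: hy.
Qed.

Lemma measurable_cos_transform (v : 'rV[R]_d -> R) : measurable_fun setT v ->
  measurable_fun setT (fun w => \int[nu]_y (v y * cos (dotrV w y))).
Proof.
move=> mv; apply: (@measurable_Rintegral_r _ _ _ _ R nu (fun p => v p.2 * cos (dotrV p.1 p.2))).
apply: measurable_funM; first exact: (measurableT_comp mv).
apply: (measurableT_comp (cont_meas (@continuous_cos R))); exact: measurable_dotrV2.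
Qed.

Lemma measurable_sin_transform (v : 'rV[R]_d -> R) : measurable_fun setT v ->
  measurable_fun setT (fun w => \int[nu]_y (v y * sin (dotrV w y))).
Proof.
move=> mv; apply: (@measurable_Rintegral_r _ _ _ _ R nu (fun p => v p.2 * sin (dotrV p.1 p.2))).
apply: measurable_funM; first exact: (measurableT_comp mv).
apply: (measurableT_comp (cont_meas (@continuous_sin R))); exact: measurable_dotrV2.
Qed.

Lemma sqrt_ge_norm (a b : R) : `|a| <= Num.sqrt (a ^+ 2 + b ^+ 2).
Proof. by rewrite -sqrtr_sqr ler_wsqrtr// lerDl sqr_ge0. Qed.

(** An extension with finite weighted spectral norm has integrable cosine and sine
    transforms, and Fourier inversion applies at every point of Omega: there v is
    continuous, and the extension agrees with v almost everywhere nearby. *)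
Lemma barron_trig_integral (s : R) (n : nat) (Omega : set 'rV[R]_d) (v : 'rV[R]_d -> R) :
  open Omega -> n%:R <= s -> barron s Omega v -> {in Omega, continuous v} ->
  exists P Q : 'rV[R]_d -> R, [/\ measurable_fun setT P, measurable_fun setT Q,
    summable_fun nu (fun w => (1 + l1norm w) ^+ n * (`|P w| + `|Q w|)) &
    forall x, Omega x -> v x = trig_integral P Q x].
Proof.
move=> oO ns [_ _ /ereal_inf_lt[_ [ve [/= sve vev] <-] fin]] cv.
have mve := summable_meas sve.
pose P0 w := \int[nu]_y (ve y * cos (dotrV w y)).
pose Q0 w := \int[nu]_y (ve y * sin (dotrV w y)).
have mP0 : measurable_fun setT P0 by exact: measurable_cos_transform.
have mQ0 : measurable_fun setT Q0 by exact: measurable_sin_transform.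
pose G w := (1 + l1norm w) `^ s * Num.sqrt (P0 w ^+ 2 + (- Q0 w) ^+ 2).
have G0 w : 0 <= G w by rewrite mulr_ge0 ?powR_ge0 ?sqrtr_ge0.
have mG : measurable_fun setT G.
  apply: measurable_funM.
    apply: (@measurableT_comp _ _ _ _ _ _ (@powR R ^~ s)); first exact: measurable_powR.
    by apply: measurable_funD => //; exact: measurable_l1norm.
  apply: (measurableT_comp (cont_meas (@sqrt_continuous R))).
  apply: measurable_funD; apply: measurable_funX => //.
  exact: measurableT_comp.
have sG : summable_fun nu G.
  apply: summableP => //; apply: le_lt_trans fin; apply: ge0_le_integral => //=.
  - by apply/measurable_EFinP; exact: measurableT_comp.
  - exact/measurable_EFinP.
  - by move=> w _; rewrite ger0_norm.
have sPQ : summable_fun nu (fun w => (1 + l1norm w) ^+ n * (`|P0 w| + `|Q0 w|)).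
  apply: le_summable (summable_funZ 2 sG) => [|w].
    apply: measurable_funM; last by apply: measurable_funD; exact: measurableT_comp.
    by apply: measurable_funX; apply: measurable_funD => //; exact: measurable_l1norm.
  have w1 : 1 <= 1 + l1norm w by rewrite lerDl l1norm_ge0.
  have X0 : 0 <= (1 + l1norm w) ^+ n * (`|P0 w| + `|Q0 w|).
    by rewrite mulr_ge0 ?addr_ge0// exprn_ge0// (le_trans _ w1).
  rewrite (ger0_norm X0) /G mulrCA; apply: ler_pM => //.
  - by rewrite exprn_ge0// (le_trans _ w1).
  - by rewrite -powR_mulrn ?(le_trans _ w1)// ler_powR.
  - have := sqrt_ge_norm (P0 w) (- Q0 w); have := sqrt_ge_norm (- Q0 w) (P0 w).
    rewrite normrN (addrC (_ ^+ 2) (P0 w ^+ 2)); lra.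
have sP0 : summable_fun nu P0.
  apply: le_summable sPQ => // w; apply: le_trans (_ : `|P0 w| + `|Q0 w| <= _).
    by rewrite lerDl.
  rewrite ler_peMl ?addr_ge0// exprn_ege1// lerDl l1norm_ge0//.
have sQ0 : summable_fun nu Q0.
  apply: le_summable sPQ => // w; apply: le_trans (_ : `|P0 w| + `|Q0 w| <= _).
    by rewrite lerDr.
  rewrite ler_peMl ?addr_ge0// exprn_ege1// lerDl l1norm_ge0//.
pose c : R := ((2 * pi) ^+ d)^-1.
have pd : 0 < (2 * pi) ^+ d :> R by rewrite exprn_gt0// mulr_gt0 ?pi_gt0.
exists (fun w => c * P0 w), (fun w => c * Q0 w); split.
- by apply: measurable_funM.
- by apply: measurable_funM.
- have := summable_funZ `|c| sPQ; congr summable_fun; apply/funext => w.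
  by rewrite !normrM; ring.
move=> x Ox.
have near_x eta : 0 < eta -> exists2 delta : R, 0 < delta &
    {ae nu, forall y : 'rV[R]_d, (forall i, `|y ord0 i - x ord0 i| < delta) -> `|ve y - v x| <= eta}.
  move=> eta0; have xO : x \in Omega by rewrite inE.
  have h1 : \forall y \near x, `|v x - v y| < eta.
    by have /cvgrPdist_lt/(_ _ eta0) := cv x xO.
  have h2 : \forall y \near x, Omega y by exact: open_nbhs_nbhs.
  have [delta d0 hd] := near_coord (filterI h1 h2).
  exists delta => //; apply: filterS vev => y vey /hd[/= h3 h4].
  by rewrite (vey h4) distrC ltW.
have := fourier_inversion sve sP0 sQ0 near_x => inv.
have s1 := @summable_trig_integrand R d P0 Q0 x mP0 mQ0
  (summable_funD (summable_norm sP0) (summable_norm sQ0)).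
transitivity (c * \int[nu]_w (P0 w * cos (dotrV w x) + Q0 w * sin (dotrV w x))).
  by rewrite inv mulrA mulVf ?mul1r// gt_eqF.
rewrite -(RintegralZl _ measurableT s1); apply: eq_Rintegral => w _; ring.
Qed.

End barron_functions.

Theorem theorem4p3 (R : realType) (d : nat) (hd : (0 < d)%N)
    (Omega : set 'rV[R]_d)
    (Omega_open : open Omega) (Omega_connected : connected Omega)
    (Omega_neq0 : Omega !=set0) (Omega_bounded : bounded_set Omega)
    (sigma : R -> R) (hA1 : activation_A1 sigma) (hA2 : activation_A2 sigma)
    (k : 'I_d -> nat) (hk : (morder k <= 2)%N)
    (s : R) (hs1 : 1 <= s) (hs : (morder k).+1%:R <= s)
    (v : 'rV[R]_d -> R) (hv : barron s Omega v)
    (v_cont : {in Omega, continuous v}) :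
  exists alpha : 'rV[R]_d * R -> R, forall x, Omega x ->
    let integrand (w : 'rV[R]_d) (b : R) : R :=
      mpartial k (fun y => sigma (dotrV w y + b)) x * alpha (w, - b) in
    [/\ mpartial_exists k v x,
        {ae rV_lebesgue d, forall w,
          lebesgue_measure.-integrable setT (EFin \o integrand w)},
        (rV_lebesgue d).-integrable setT
          (fun w => (\int[lebesgue_measure]_b integrand w b)%:E) &
        mpartial k v x =
          \int[rV_lebesgue d]_w \int[lebesgue_measure]_b integrand w b].
Proof.
have [P [Q [mP mQ sPQ vE]]] := barron_trig_integral Omega_open hs hv v_cont.
have [rho rho0 hrho] := bounded_dotrV Omega_bounded.
set l := directions k.
have sl : size l = morder k := size_directions k.
rewrite -sl in sPQ hk.
have [cf [M fM] nf] := activation_derivative hA1 hk.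
set f := derive1n (size l) sigma in cf fM nf.
have [mPl mQl] := measurable_amplitudes l mP mQ.
set Pl := (amplitudes l P Q).1 in mPl; set Ql := (amplitudes l P Q).2 in mQl.
have sl' := weight_le mP mQ sPQ.
have sPl : summable_fun (rV_lebesgue d)
    (fun w => (1 + rho * l1norm w) * (`|Pl w| + `|Ql w|)).
  apply: le_summable (summable_funZ (1 + rho) sPQ) => [|w].
    apply: measurable_funM; last by apply: measurable_funD; exact: measurableT_comp.
    by apply: measurable_funD => //; apply: measurable_funM => //; exact: measurable_l1norm.
  have N0 := l1norm_ge0 w.
  have X0 : 0 <= (1 + rho * l1norm w) * (`|Pl w| + `|Ql w|).
    by rewrite mulr_ge0 ?addr_ge0// mulr_ge0.
  rewrite (ger0_norm X0).
  apply: le_trans (_ : ((1 + rho) * (1 + l1norm w)) * (`|Pl w| + `|Ql w|) <= _).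
    by rewrite ler_wpM2r ?addr_ge0//; nra.
  rewrite -mulrA ler_wpM2l ?addr_ge0// exprS -mulrA ler_wpM2l ?addr_ge0//.
  exact: amplitudes_le.
have [beta hbeta] := ridge_representation hd cf fM nf mPl mQl rho0 sPl.
exists (fun p => beta p.1 (- p.2) / monomial l p.1) => x Ox integrand.
have [D1 D2] := partials_trig_integral Omega_open mP mQ sl' vE Ox.
have [b1 b2 b3] := hbeta x (fun w => hrho x w Ox).
(* equal to 1, except on the null set where the monomial vanishes, where it is 0 *)
pose one w : R := monomial l w / monomial l w.
have iE w b : integrand w b = one w * (f (dotrV w x + b) * beta w b).
  rewrite /integrand /mpartial -/l partials_ridge/=; last first.
    by case: hA1 => ds _ _ _ n t nl; apply: ds; exact: leq_trans nl hk.
  (* the argument - b of alpha is undone by the sign in its definition *)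
  by rewrite opprK -/f /one; ring.
have one01 w : one w = 0 \/ one w = 1.
  by rewrite /one; have [->|m0] := eqVneq (monomial l w) 0; [left; rewrite mul0r|right; rewrite divff].
have IE w : \int[lebesgue_measure]_b integrand w b =
    one w * \int[lebesgue_measure]_b (f (dotrV w x + b) * beta w b).
  under eq_Rintegral do rewrite iE.
  case: (one01 w) => ->.
    under eq_Rintegral do rewrite mul0r.
    by rewrite /Rintegral integral0 mul0r.
  by rewrite mul1r; apply: eq_Rintegral => b _; rewrite mul1r.
have mone : measurable_fun setT one.
  have mm : measurable_fun setT (monomial l : 'rV[R]_d -> R).
    rewrite /monomial; elim: (l) => [|i l0 IH].
      by under eq_fun do rewrite big_nil; exact: measurable_cst.
    by under eq_fun do rewrite big_cons; apply: measurable_funM => //; exact: measurable_coord.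
  by apply: measurable_funM => //; exact: (measurableT_comp (@measurable_inv R)).
have sI : summable_fun (rV_lebesgue d) (fun w => \int[lebesgue_measure]_b integrand w b).
  under eq_fun do rewrite IE.
  apply: (@summable_funM _ _ _ _ _ _ 1) => // w.
  by case: (one01 w) => ->; rewrite ?normr0 ?normr1.
split => //.
- apply: filterS b1 => w sw.
  have := summable_funZ (one w) sw; congr (integrable _ _ _).
  by apply/funext => b /=; rewrite iE.
rewrite /mpartial -/l D2 /trig_integral -/Pl -/Ql -b3; apply: ae_eq_Rintegral.
- exact: (summable_meas b2).
- exact: (summable_meas sI).
- apply: filterS (ae_monomial_neq0 l) => w wn; by rewrite IE /one divff// mul1r.
Qed.
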